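(* Let $F$ be a totally real field of even degree $g$, let $p$ be a rational prime unramified in $F$, let $U=U_0(\mathfrak n p^s)$ be a sufficiently small level, and let $(\kappa,r)=(\kappa_\psi,r)$ be any locally algebraic weight. Let $h$ be the number of double cosets $D^\times\backslash D_f^\times/U$. For $n\in\mathbb Z_{\ge0}$ let $s(n)$ denote the number of $m\in\mathbb Z_{\ge0}$ such that $b(m)=n$. Then the Newton polygon of the action of $U_p^0$ on $$S^{D,\dagger}_{\kappa,r}(U)\cong\bigoplus_{i=1}^hL\langle\underline X\rangle$$ lies on or above the polygon with slopes $\{0_{s(0)h},1_{s(1)h},\dots,i_{s(i)h},\dots\}$, where $i_n$ means that the slope $i$ appears $n$ times.
   Context: **Setting.** $F$ is a totally real field of even degree $g=[F:\mathbb Q]$, $\mathcal O_F$ its ring of integers, $p$ a rational prime unramified in $F$, $\mathcal O_p=\mathcal O_F\otimes\mathbb Z_p=\prod_{\mathfrak p\mid p}\mathcal O_{\mathfrak p}$, with fixed uniformisers $\pi_{\mathfrak p}$. $D$ is the totally definite quaternion algebra over $F$ unramified at all finite places, $\mathcal O_D$ a fixed maximal order, $D_f^\times=(D\otimes_{\mathbb Q}\mathbb A_f)^\times$, with fixed splittings $\mathcal O_D\otimes_{\mathcal O_F}\mathcal O_{\mathfrak q}\cong M_2(\mathcal O_{\mathfrak q})$ at the primes $\mathfrak q$ dividing $\mathfrak n p$; for $u\in D_f^\times$, $u_p$ denotes the component in $\mathrm{GL}_2(F\otimes\mathbb Q_p)$. **Levels.** $\mathfrak n$ is an ideal of $\mathcal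 O_F$ prime to $p$, $s\ge1$ an integer, and $U_0(\mathfrak n p^s)=\{\gamma\in(\mathcal O_D\otimes\widehat{\mathbb Z})^\times:\gamma\equiv\left(\begin{smallmatrix}*&*\\0&*\end{smallmatrix}\right)\bmod \mathfrak n p^s\}$. Write $D_f^\times=\coprod_{i=1}^h D^\times t_iU$ and $\Gamma^i(U)=D^\times\cap t_iUt_i^{-1}$. $U$ is *sufficiently small* if $\Gamma^i(U)/(F^\times\cap\Gamma^i(U))$ is trivial for all $i$. **Weights.** Let $L$ be a complete extension of $\mathbb Q_p$ (inside $\mathbb C_p$) containing the images of all embeddings $\sigma_1,\dots,\sigma_g:F\to\overline{\mathbb Q}_p$ (these are identified with the infinite places of $F$ through a fixed isomorphism $\mathbb C\cong\overline{\mathbb Q}_p$) and the values of $\psi$. A locally algebraic weight $(\kappa,r)=(\kappa_\psi,r)$ is given by $n,v\in\mathbb Z^g$ and $r\in\mathbb Z$ with $n+2v=(r,\dots,r)$ (algebraic part $(k,r)$, $k=n+2$), together with a finite order character $\psi:\mathcal O_p^\times\to L^\times$ factoring through $(\mathcal O_p/p^s)^\times$. It is assumed that $\psi(x)=N_{F/\mathbb Q}(x)^r$ for all $x\in\mathcal O_F^\times$. **Overconvergent forms.** Let $\Delta_s$ be the monoid of $\gamma=\left(\begin{smallmatrix}a&b\\c&d\end{smallmatrix}\right)\in M_2(\mathcal O_p)$ such that at each $\mathfrak p\mid p$ the determinant is nonzero, $\pi_{\mathfrak p}^s\mid c$ and $\pi_{\mathfrak p}\nmid d$. Let $a_i,b_i,c_i,d_i$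 be the images of $a,b,c,d$ under $\sigma_i:\mathcal O_p\to L$ and $\gamma_i=\left(\begin{smallmatrix}a_i&b_i\\c_i&d_i\end{smallmatrix}\right)$. Let $L\langle\underline X\rangle=L\langle X_1,\dots,X_g\rangle$ be the Tate algebra (power series with coefficients tending to $0$). $\Delta_s$ acts on the right by $$\prod_iX_i^{l_i}\cdot\gamma=\psi(d)\prod_{i=1}^g\det(\gamma_i)^{v_i}(c_iX_i+d_i)^{n_i}\left(\frac{a_iX_i+b_i}{c_iX_i+d_i}\right)^{l_i}.$$ $S^{D,\dagger}_{\kappa,r}(U)$ is the $L$-vector space of functions $f:D^\times\backslash D_f^\times\to L\langle\underline X\rangle$ with $f(gu^{-1})\cdot u_p=f(g)$ for all $u\in U$, $g\in D_f^\times$. The displayed isomorphism is $f\mapsto(f(t_i))_i$. **Hecke operators.** For $\mathfrak p\mid p$, $U_{\mathfrak p}$ is the operator $$(f|U_{\mathfrak p})(g)=\sum_{\alpha\in\mathcal O_{\mathfrak p}/\pi_{\mathfrak p}}f(gu_\alpha^{-1})\cdot(u_\alpha)_p,$$ where $u_\alpha\in D_f^\times$ is $\left(\begin{smallmatrix}\pi_{\mathfrak p}&0\\\alpha\pi_{\mathfrak p}^s&1\end{smallmatrix}\right)$ at $\mathfrak p$ and $1$ elsewhere. Put $U_p=\prod_{\mathfrak p\mid p}U_{\mathfrak p}$ (a compact operator) and $U_p^0=\prod_{\mathfrak p\mid p}\pi_{\mathfrak p}^{-v_{\mathfrak p}(\kappa)}U_p$, where $v_{\mathfrak p}(\kappa)=\sum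 v_i$ over those $i$ for which $\sigma_i$ induces the place $\mathfrak p$, and $\pi_{\mathfrak p}$ is viewed in $L$ through any such $\sigma_i$ (the choice does not affect Newton polygons). The Newton polygon of a compact operator $V$ is that of the Fredholm series $\det(1-XV)=\sum_m c_mX^m$, i.e. the lower convex hull of the points $(m,\mathrm{val}_p(c_m))$, with $\mathrm{val}_p(p)=1$. **The function $b$.** Fix a bijection $Bi:\mathbb Z_{\ge0}^g\to\mathbb Z_{\ge0}$; for $m\in\mathbb Z_{\ge0}$ with $Bi^{-1}(m)=(m_1,\dots,m_g)$ put $b(m)=\sum_im_i$. *)

(* Defs.v *)
From HB Require Import structures.
From mathcomp Require Import all_boot all_order all_algebra all_field.
From mathcomp Require Import ring_quotient generic_quotient complex finmap.
From mathcomp Require Import all_classical all_reals all_analysis.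
From mathcomp Require Import ring lra.

Set Implicit Arguments.
Unset Strict Implicit.
Unset Printing Implicit Defensive.

Import Order.TTheory GRing.Theory Num.Theory.
Import numFieldNormedType.Exports.

Local Open Scope classical_set_scope.
Local Open Scope ring_scope.

(* A nonarchimedean absolute value. *)
Record absval (R : realType) (K : fieldType) := AbsVal {
  av :> K -> R;
  av_ge0 : forall x, 0 <= av x;
  av_eq0 : forall x, av x = 0 <-> x = 0;
  avM : forall x y, av (x * y) = av x * av y;
  av_ultra : forall x y, av (x + y) <= Num.max (av x) (av y)
}.

Definition av_cvg (R : realType) (K : fieldType) (v : absval R K)
    (x : nat -> K) (y : K) :=
  forall e : R, 0 < e -> exists N, forall n, (N <= n)%N -> v (x n - y) < e.

Definition av_cauchy (R : realType) (K : fieldType) (v : absval R K)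
    (x : nat -> K) :=
  forall e : R, 0 < e ->
    exists N, forall m n, (N <= m)%N -> (N <= n)%N -> v (x m - x n) < e.

Definition av_complete (R : realType) (K : fieldType) (v : absval R K) :=
  forall x : nat -> K, av_cauchy v x -> exists y, av_cvg v x y.

Section AbsvalTheory.
Variables (R : realType) (K : fieldType) (v : absval R K).

Lemma av0 : v 0 = 0. Proof. exact/av_eq0. Qed.

Lemma av_gt0 x : x <> 0 -> 0 < v x.
Proof.
by move=> x0; rewrite lt_def av_ge0 andbT; apply/eqP => /av_eq0.
Qed.

Lemma av1 : v 1 = 1.
Proof.
have h : v 1 * v 1 = v 1 * 1 by rewrite -avM !mulr1.
by apply: mulfI h; rewrite gt_eqF// av_gt0//; apply/eqP; exact: oner_neq0.
Qed.

Lemma avN x : v (- x) = v x.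
Proof.
have h : v (-1) = 1.
  apply/eqP; rewrite -(@eqrXn2 _ 2)// ?av_ge0// expr1n expr2 -avM.
  by rewrite mulrNN mulr1 av1.
by rewrite -mulN1r avM h mul1r.
Qed.

Lemma av_subC x y : v (x - y) = v (y - x).
Proof. by rewrite -avN opprB. Qed.

Lemma av_lt_add x y e : v x < e -> v y < e -> v (x + y) < e.
Proof. by move=> hx hy; apply: le_lt_trans (av_ultra v x y) _; rewrite gt_max hx. Qed.

Lemma av_eq_lt x y : v (x - y) < v x -> v y = v x.
Proof.
move=> h; apply/eqP; rewrite eq_le; apply/andP; split.
  have -> : y = x + - (x - y) by ring.
  by apply: le_trans (av_ultra _ _ _) _; rewrite avN ge_max lexx (ltW h).
have : v x <= Num.max (v (x - y)) (v y).
  by apply: le_trans (av_ultra _ _ _); rewrite subrK.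
by rewrite le_max leNgt h.
Qed.

Lemma av_cauchy_bounded x : av_cauchy v x ->
  exists B : R, 0 < B /\ exists N, forall n, (N <= n)%N -> v (x n) < B.
Proof.
move=> /(_ 1 ltr01)[N hN]; exists (v (x N) + 1); split.
  by rewrite ltr_wpDl// av_ge0.
exists N => n Nn; rewrite -[x n](subrK (x N)).
apply: av_lt_add; last by rewrite ltrDl.
by apply: lt_le_trans (hN _ _ Nn (leqnn _)) _; rewrite lerDr av_ge0.
Qed.

Lemma av_cauchy_cst c : av_cauchy v (cst c).
Proof. by move=> e e0; exists 0%N => m n _ _ /=; rewrite subrr av0. Qed.

Lemma av_cauchyB x y : av_cauchy v x -> av_cauchy v y -> av_cauchy v (x - y).
Proof.
move=> hx hy e e0; have [N hN] := hx _ e0; have [M hM] := hy _ e0.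
exists (maxn N M) => m n; rewrite !geq_max => /andP[m1 m2] /andP[n1 n2].
have -> : (x - y) m - (x - y) n = (x m - x n) + - (y m - y n).
  by change (x m - y m - (x n - y n) = x m - x n + - (y m - y n)); ring.
by apply: av_lt_add; rewrite ?avN; [exact: hN|exact: hM].
Qed.

Lemma av_nullM x y : av_cauchy v x -> av_cvg v y 0 -> av_cvg v (x * y) 0.
Proof.
move=> hx hy e e0; have [B [B0 [N hN]]] := av_cauchy_bounded hx.
have [M hM] := hy _ (divr_gt0 e0 B0).
exists (maxn N M) => n; rewrite geq_max => /andP[n1 n2].
have := hM _ n2; rewrite !subr0 => h.
have -> : e = B * (e / B) by rewrite mulrC divfK// gt_eqF.
change (v (x n * y n) < B * (e / B)); rewrite avM ltr_pM ?av_ge0//.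
exact: hN.
Qed.

Lemma av_cauchyM x y : av_cauchy v x -> av_cauchy v y -> av_cauchy v (x * y).
Proof.
move=> hx hy e e0.
have [B [B0 [N1 hN1]]] := av_cauchy_bounded hx.
have [C [C0 [N2 hN2]]] := av_cauchy_bounded hy.
have [N3 hN3] := hx _ (divr_gt0 e0 C0).
have [N4 hN4] := hy _ (divr_gt0 e0 B0).
exists (maxn (maxn N1 N2) (maxn N3 N4)) => m n.
rewrite !geq_max => /andP[/andP[m1 m2] /andP[m3 m4]] /andP[/andP[n1 n2] /andP[n3 n4]].
have -> : (x * y) m - (x * y) n = x m * (y m - y n) + (x m - x n) * y n.
  change (x m * y m - x n * y n = x m * (y m - y n) + (x m - x n) * y n).
  by ring.
apply: av_lt_add; rewrite avM.
  have -> : e = B * (e / B) by rewrite mulrC divfK// gt_eqF.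
  by rewrite ltr_pM ?av_ge0//; [exact: hN1|exact: hN4].
have -> : e = (e / C) * C by rewrite divfK// gt_eqF.
by rewrite ltr_pM ?av_ge0//; [exact: hN3|exact: hN2].
Qed.

Lemma av_cauchy_const x : av_cauchy v x -> ~ av_cvg v x 0 ->
  exists c : R, 0 < c /\ exists N, forall n, (N <= n)%N -> v (x n) = c.
Proof.
move=> hx /existsNP[e /not_implyP[e0 /forallNP h]].
have [N hN] := hx _ e0.
have /existsNP[n /not_implyP[Nn /negP]] := h N; rewrite subr0 -leNgt => en.
exists (v (x n)); split; first exact: lt_le_trans en.
by exists n => m nm; apply: av_eq_lt; apply: lt_le_trans (hN _ _ _ _) en => //; exact: leq_trans nm.
Qed.

Lemma av_cauchyV x : av_cauchy v x -> ~ av_cvg v x 0 ->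
  av_cauchy v (fun n => (x n)^-1).
Proof.
move=> hx nx; have [c [c0 [N hN]]] := av_cauchy_const hx nx.
move=> e e0; have [M hM] := hx _ (mulr_gt0 e0 (mulr_gt0 c0 c0)).
exists (maxn N M) => m n; rewrite !geq_max => /andP[m1 m2] /andP[n1 n2].
have xm : x m != 0 by apply: contra_eqN (hN _ m1) => /eqP ->; rewrite av0 lt_eqF.
have xn : x n != 0 by apply: contra_eqN (hN _ n1) => /eqP ->; rewrite av0 lt_eqF.
rewrite -(@ltr_pM2r _ (c * c)) ?mulr_gt0//.
rewrite -{1}(hN m m1) -{1}(hN n n1) -!avM.
have -> : ((x m)^-1 - (x n)^-1) * (x m * x n) = x n - x m.
  by field; rewrite xm xn.
exact: hM.
Qed.

Definition cauchy_pred : {pred nat -> K} := fun x => `[< av_cauchy v x >].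

Lemma cauchy_subring : subring_closed cauchy_pred.
Proof.
split; first by apply/asboolP; exact: av_cauchy_cst.
  by move=> x y /asboolP hx /asboolP hy; apply/asboolP; exact: av_cauchyB.
by move=> x y /asboolP hx /asboolP hy; apply/asboolP; exact: av_cauchyM.
Qed.

Record cseq := CSeq { csval : nat -> K; csvalP : cauchy_pred csval }.
HB.instance Definition _ := [isSub for csval].
HB.instance Definition _ := [Choice of cseq by <:].
HB.instance Definition _ :=
  GRing.SubChoice_isSubComNzRing.Build (nat -> K) cauchy_pred cseq cauchy_subring.

Definition null_pred : {pred cseq} := fun x => `[< av_cvg v (csval x) 0 >].

Lemma null_idealr : idealr_closed null_pred.
Proof.
split.
- by apply/asboolP => e e0; exists 0%N => n _; rewrite [csval _ _]/= subrr av0.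
- apply/asboolP => /(_ 1 ltr01)[N /(_ N (leqnn N))].
  by rewrite [csval _ _]/= subr0 av1 ltxx.
- move=> a x y /asboolP hx /asboolP hy; apply/asboolP => e e0.
  have ha : av_cauchy v (csval a) by apply/asboolP; exact: csvalP.
  have [N hN] := av_nullM ha hx e0; have [M hM] := hy _ e0.
  exists (maxn N M) => n; rewrite geq_max => /andP[n1 n2].
  rewrite subr0; apply: av_lt_add.
    by have := hN _ n1; rewrite subr0.
  by have := hM _ n2; rewrite subr0.
Qed.

HB.instance Definition _ := isIdealr.Build cseq null_pred null_idealr.
End AbsvalTheory.

(* Cauchy sequences modulo null sequences. *)
Definition completion (R : realType) (K : fieldType) (v : absval R K) :=
  {ideal_quot (null_pred (v := v))}.

HB.instance Definition _ R K (v : absval R K) :=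
  GRing.ComNzRing.on (completion v).

Section Completion.
Variables (R : realType) (K : fieldType) (v : absval R K).
Local Notation Kv := (completion v).
Local Open Scope quotient_scope.

(* A chosen Cauchy sequence of elements of K that represents x. *)
Definition crep (x : Kv) : nat -> K := csval (repr x).

Lemma crep_cauchy x : av_cauchy v (crep x).
Proof. by apply/asboolP; exact: csvalP. Qed.

Lemma pi_eq (x y : cseq v) :
  \pi_Kv x = \pi_Kv y <-> av_cvg v (csval x - csval y) 0.
Proof.
split=> [/eqP|h].
  by rewrite -Quotient.idealrBE => /asboolP.
by apply/eqP; rewrite -Quotient.idealrBE; apply/asboolP.
Qed.

Lemma crep_eq0 (x : Kv) : av_cvg v (crep x) 0 -> x = 0.
Proof.
move=> h; rewrite -[x]reprK -[0 : Kv](rmorph0 \pi_Kv).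
by apply/pi_eq; rewrite subr0.
Qed.

Lemma completion_inv (x : Kv) : x <> 0 -> exists y, y * x = 1.
Proof.
move=> x0; have nx : ~ av_cvg v (crep x) 0 by move=> /crep_eq0.
have cV := av_cauchyV (@crep_cauchy x) nx.
have [z zE] : exists z : cseq v, csval z = fun n => (crep x n)^-1.
  by exists (CSeq (asboolT cV)).
exists (\pi_Kv z).
rewrite -[in LHS](reprK x) -rmorphM -[1 : Kv](rmorph1 \pi_Kv); apply/pi_eq => e e0.
have [c [c0 [N hN]]] := av_cauchy_const (@crep_cauchy x) nx.
exists N => n Nn; rewrite subr0.
have xn : crep x n != 0.
  by apply: contra_eqN (hN _ Nn) => /eqP ->; rewrite av0 lt_eqF.
change (v (csval z n * crep x n - 1) < e).
rewrite zE.
by rewrite mulVf// subrr av0.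
Qed.

Definition completion_invf (x : Kv) : Kv :=
  if pselect (x = 0) is right x0 then projT1 (cid (completion_inv x0)) else 0.

Lemma completion_mulVf x : x != 0 -> completion_invf x * x = 1.
Proof.
move=> /eqP x0; rewrite /completion_invf.
by case: pselect => // y; case: cid.
Qed.

Lemma completion_invf0 : completion_invf 0 = 0.
Proof. by rewrite /completion_invf; case: pselect. Qed.

HB.instance Definition _ :=
  GRing.ComNzRing_isField.Build Kv completion_mulVf completion_invf0.

Definition cinc (x : K) : Kv := \pi_Kv (CSeq (asboolT (av_cauchy_cst v x))).

Lemma cinc_is_zmod_morphism : zmod_morphism cinc.
Proof.
move=> x y; rewrite /cinc -rmorphB; congr (\pi_Kv _).
by apply: val_inj; apply/funext.
Qed.

Lemma cinc_is_monoid_morphism : monoid_morphism cinc.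
Proof.
split; first by rewrite -[1 in RHS](rmorph1 \pi_Kv); congr (\pi_Kv _); exact: val_inj.
move=> x y; rewrite /cinc -rmorphM; congr (\pi_Kv _).
by apply: val_inj; apply/funext.
Qed.

HB.instance Definition _ := GRing.isZmodMorphism.Build K Kv cinc cinc_is_zmod_morphism.
HB.instance Definition _ := GRing.isMonoidMorphism.Build K Kv cinc cinc_is_monoid_morphism.

Definition cav (x : Kv) : R := limn (fun n => v (crep x n)).

Lemma cav_dich (s : nat -> K) : av_cauchy v s ->
  (av_cvg v s 0 /\ limn (fun n => v (s n)) = 0) \/
  exists c, [/\ 0 < c, limn (fun n => v (s n)) = c &
                exists N, forall n, (N <= n)%N -> v (s n) = c].
Proof.
move=> hs; have [h|h] := pselect (av_cvg v s 0); [left|right].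
  split=> //; apply/cvg_lim => //; apply/cvgrPdist_lt => e e0.
  have [N hN] := h _ e0; exists N => // n Nn.
  by rewrite sub0r normrN ger0_norm ?av_ge0//; have := hN _ Nn; rewrite subr0.
have [c [c0 [N hN]]] := av_cauchy_const hs h; exists c; split=> //; last by exists N.
apply/cvg_lim => //; apply: cvg_near_cst; exists N => // n Nn; exact: hN.
Qed.

Lemma cavE (x : cseq v) : cav (\pi_Kv x) = limn (fun n => v (csval x n)).
Proof.
have hx : av_cauchy v (csval x) by apply/asboolP; exact: csvalP.
have hy := @crep_cauchy (\pi_Kv x).
have : \pi_Kv (repr (\pi_Kv x)) = \pi_Kv x by rewrite reprK.
move/pi_eq; rewrite -/(crep _) /cav; move: (crep _) hy => y hy hxy.
have [[h ->]|[c [c0 -> [N hN]]]] := cav_dich hx.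
  have [[_ ->//]|[d [d0 _ [M hM]]]] := cav_dich hy.
  have [N1 h1] := h _ d0; have [N2 h2] := hxy _ d0.
  pose n := maxn M (maxn N1 N2).
  have Mn : (M <= n)%N by rewrite leq_max leqnn.
  have n1 : (N1 <= n)%N by rewrite !leq_max leqnn orbT.
  have n2 : (N2 <= n)%N by rewrite !leq_max leqnn !orbT.
  have : v (y n) < d.
    rewrite -[y n](subrK (csval x n)); apply: av_lt_add.
      by have := h2 _ n2; rewrite subr0.
    by have := h1 _ n1; rewrite subr0.
  by rewrite (hM _ Mn) ltxx.
have [M hM] := hxy _ c0.
apply/cvg_lim => //; apply: cvg_near_cst; exists (maxn N M) => // n /=.
rewrite geq_max => /andP[n1 n2]; rewrite -(hN _ n1); apply: av_eq_lt.
by rewrite (hN _ n1) av_subC; have := hM _ n2; rewrite subr0.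
Qed.

Lemma cav_ge0 x : 0 <= cav x.
Proof.
have [[_ h]|[c [c0 h _]]] := cav_dich (@crep_cauchy x); rewrite /cav h//.
exact: ltW.
Qed.

Lemma cav_eq0 x : cav x = 0 <-> x = 0.
Proof.
have [[h h0]|[c [c0 h [N hN]]]] := cav_dich (@crep_cauchy x).
  by rewrite /cav h0; split=> // _; exact: crep_eq0.
rewrite /cav h; split=> [c0'|x0]; first by rewrite c0' ltxx in c0.
move: h; rewrite -/(cav x) x0 -[0 : Kv](rmorph0 \pi_Kv) cavE => <-.
by rewrite [X in limn X](_ : _ = cst 0) ?lim_cst//; apply/funext => n; exact: av0.
Qed.

Lemma is_cvg_av (s : nat -> K) : av_cauchy v s -> cvgn (fun n => v (s n)).
Proof.
move=> hs; have [h|h] := pselect (av_cvg v s 0).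
  apply/cvg_ex; exists 0; apply/cvgrPdist_lt => e e0.
  have [N hN] := h _ e0; exists N => // n Nn.
  by rewrite sub0r normrN ger0_norm ?av_ge0//; have := hN _ Nn; rewrite subr0.
have [c [c0 [N hN]]] := av_cauchy_const hs h; apply/cvg_ex; exists c.
by apply: cvg_near_cst; exists N => // n Nn; exact: hN.
Qed.

Lemma cavM x y : cav (x * y) = cav x * cav y.
Proof.
rewrite -[in LHS](reprK x) -[in LHS](reprK y) -rmorphM cavE -limM.
- by congr (limn _); apply/funext => n; exact: avM.
- exact: is_cvg_av (@crep_cauchy x).
- exact: is_cvg_av (@crep_cauchy y).
Qed.

Lemma cav_ultra x y : cav (x + y) <= Num.max (cav x) (cav y).
Proof.
have hx := is_cvg_av (@crep_cauchy x); have hy := is_cvg_av (@crep_cauchy y).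
rewrite -[in leLHS](reprK x) -[in leLHS](reprK y) -rmorphD cavE.
have hm : (fun n => Num.max (v (crep x n)) (v (crep y n))) @ \oo -->
    Num.max (cav x) (cav y).
  apply: (@continuous2_cvg _ _ _ _ _ _ _ _ Num.max) hx hy.
  exact: (@max_continuous _ R (cav x, cav y)).
rewrite -(cvg_lim _ hm)//; apply: ler_lim.
- by apply: is_cvg_av; apply/asboolP; exact: csvalP.
- by apply/cvg_ex; exists (Num.max (cav x) (cav y)).
- by apply: nearW => n; exact: av_ultra.
Qed.

Definition cabs : absval R Kv := AbsVal cav_ge0 cav_eq0 cavM cav_ultra.

End Completion.

Definition valuation_ring (R : realType) (K : fieldType) (v : absval R K) :
  set K := [set x | v x <= 1].

Definition uniformiser (R : realType) (K : fieldType) (v : absval R K) (pi : K) :=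
  forall x, v x < 1 <-> exists2 y, valuation_ring v y & x = pi * y.

(* The quaternion algebra (a, b / A): 1, i, j, k with i^2 = a, j^2 = b and
   k = ij = -ji. Extension of scalars along f : A -> B is (f a, f b / B). *)
Record quat (A : comNzRingType) (a b : A) := Quat { q0 : A; q1 : A; q2 : A; q3 : A }.
Arguments Quat {A} a b.

Section Quaternions.
Variables (A : comNzRingType) (a b : A).
Local Notation Q := (quat a b).

Lemma quat_ext (x y : Q) :
  q0 x = q0 y -> q1 x = q1 y -> q2 x = q2 y -> q3 x = q3 y -> x = y.
Proof. by case: x y => ? ? ? ? [? ? ? ?] /= -> -> -> ->. Qed.

Definition quat_tuple (x : Q) := (q0 x, q1 x, q2 x, q3 x).
Definition tuple_quat (t : A * A * A * A) : Q :=
  Quat a b t.1.1.1 t.1.1.2 t.1.2 t.2.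
Lemma quat_tupleK : cancel quat_tuple tuple_quat. Proof. by case. Qed.
HB.instance Definition _ := Choice.copy Q (can_type quat_tupleK).

Definition qadd (x y : Q) :=
  Quat a b (q0 x + q0 y) (q1 x + q1 y) (q2 x + q2 y) (q3 x + q3 y).
Definition qopp (x : Q) := Quat a b (- q0 x) (- q1 x) (- q2 x) (- q3 x).
Definition qscal (c : A) := Quat a b c 0 0 0.
Definition qmul (x y : Q) := Quat a b
  (q0 x * q0 y + a * q1 x * q1 y + b * q2 x * q2 y - a * b * q3 x * q3 y)
  (q0 x * q1 y + q1 x * q0 y - b * q2 x * q3 y + b * q3 x * q2 y)
  (q0 x * q2 y + q2 x * q0 y + a * q1 x * q3 y - a * q3 x * q1 y)
  (q0 x * q3 y + q3 x * q0 y + q1 x * q2 y - q2 x * q1 y).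

Lemma qaddA : associative qadd.
Proof. by move=> x y z; congr Quat; rewrite /=; ring. Qed.
Lemma qaddC : commutative qadd.
Proof. by move=> x y; congr Quat; rewrite /=; ring. Qed.
Lemma qadd0 : left_id (qscal 0) qadd.
Proof. by case=> *; congr Quat; rewrite /=; ring. Qed.
Lemma qaddN : left_inverse (qscal 0) qopp qadd.
Proof. by move=> x; congr Quat; rewrite /=; ring. Qed.
HB.instance Definition _ := GRing.isZmodule.Build Q qaddA qaddC qadd0 qaddN.

Lemma qmulA : associative qmul.
Proof. by move=> x y z; congr Quat; rewrite /=; ring. Qed.
Lemma qmul1 : left_id (qscal 1) qmul.
Proof. by case=> *; congr Quat; rewrite /=; ring. Qed.
Lemma qmulr1 : right_id (qscal 1) qmul.
Proof. by case=> *; congr Quat; rewrite /=; ring. Qed.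
Lemma qmulDl : left_distributive qmul qadd.
Proof. by move=> x y z; congr Quat; rewrite /=; ring. Qed.
Lemma qmulDr : right_distributive qmul qadd.
Proof. by move=> x y z; congr Quat; rewrite /=; ring. Qed.
Lemma qone_neq0 : qscal 1 != 0 :> Q.
Proof. by apply/eqP => -[/eqP]; rewrite oner_eq0. Qed.
HB.instance Definition _ := GRing.Zmodule_isNzRing.Build Q
  qmulA qmul1 qmulr1 qmulDl qmulDr qone_neq0.

Lemma qscalM (x y : A) : qscal (x * y) = qscal x * qscal y.
Proof. by apply: quat_ext => /=; ring. Qed.
Lemma qscalC (x : A) (y : Q) : qscal x * y = y * qscal x.
Proof. by apply: quat_ext => /=; ring. Qed.

Definition qinvertible : set Q := [set x | exists y, x * y = 1 /\ y * x = 1].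
End Quaternions.

Section QuatMap.
Variables (A B : comNzRingType) (f : {rmorphism A -> B}) (a b : A).
Definition qmap (x : quat a b) : quat (f a) (f b) :=
  Quat (f a) (f b) (f (q0 x)) (f (q1 x)) (f (q2 x)) (f (q3 x)).
Lemma qmapM x y : qmap (x * y) = qmap x * qmap y.
Proof. by apply: quat_ext; rewrite /= !(rmorphB, rmorphD, rmorphM). Qed.
Lemma qmap1 : qmap 1 = 1.
Proof. by apply: quat_ext; rewrite /= ?(rmorph1, rmorph0). Qed.
End QuatMap.
Arguments qmap {A B} f {a b} x.

(* The C-span of G; i : K -> A is the structure map of the K-algebra A. *)
Definition lspan (K A : nzRingType) (i : K -> A) (C : set K) (G : set A) : set A :=
  [set x | exists2 s : seq (K * A), (forall c, c \in s -> C c.1 /\ G c.2) &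
           x = \sum_(c <- s) i c.1 * c.2].

Lemma lspanM (K A : nzRingType) (i : K -> A) (C : set K) (G : set A) :
  (forall c d, i (c * d) = i c * i d) -> (forall c x, i c * x = x * i c) ->
  (forall c d, C c -> C d -> C (c * d)) -> (forall x y, G x -> G y -> G (x * y)) ->
  forall x y, lspan i C G x -> lspan i C G y -> lspan i C G (x * y).
Proof.
move=> iM iC CM GM x y [s hs ->] [t ht ->].
exists [seq (c.1 * d.1, c.2 * d.2) | c <- s, d <- t].
  move=> _ /allpairsP[[c d] [/= cs dt ->]] /=.
  by have [? ?] := hs _ cs; have [? ?] := ht _ dt; split; [exact: CM|exact: GM].
rewrite big_allpairs_dep mulr_suml; apply: eq_bigr => c _.
rewrite mulr_sumr; apply: eq_bigr => d _ /=.
by rewrite iM !mulrA; congr (_ * _); rewrite -!mulrA; congr (_ * _); rewrite iC.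
Qed.

Definition OF (F : fieldExtType rat) : set F :=
  [set x | integralOver (intr : int -> F) x].

(* A finite place, i.e. a nontrivial nonarchimedean absolute value up to
   equivalence, represented by the one with |l| = 1/l at its residue
   characteristic l. *)
Record place (R : realType) (F : fieldExtType rat) := Place {
  place_av :> absval R F;
  place_norm : exists2 l, prime l & place_av l%:R = l%:R^-1
}.
HB.instance Definition _ R F := gen_eqMixin (place R F).
HB.instance Definition _ R F := gen_choiceMixin (place R F).

Definition place_above (R : realType) (F : fieldExtType rat) (p : nat) :=
  {v : place R F | v p%:R == p%:R^-1}.

Coercion place_of_above R F p (v : place_above R F p) : place R F := val v.

Section Quaternion_adeles.
Variables (R : realType) (F : fieldExtType rat) (a b : F).

Local Notation place := (place R F).
Local Notation Fv v := (completion (place_av v)).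

Definition Ov (v : place) : set (Fv v) := valuation_ring (cabs v).
Arguments Ov : clear implicits.
Definition Dv (v : place) : nzRingType := quat (cinc v a) (cinc v b).

Record quat_order := QuatOrder {
  ord :> set (quat a b);
  ord1 : ord 1;
  ordB : forall x y, ord x -> ord y -> ord (x - y);
  ordM : forall x y, ord x -> ord y -> ord (x * y);
  ord_fg : exists n (e : 'I_n -> quat a b),
    ord = lspan (@qscal _ a b) (@OF F) (range e);
  ord_full : lspan (@qscal _ a b) setT ord = setT
}.

Definition maximal_order (O : quat_order) :=
  forall O' : quat_order, O `<=` O' -> O' `<=` O.

Variable O : quat_order.

Definition ODv (v : place) : set (Dv v) :=
  lspan (@qscal _ _ _) (Ov v) (qmap (cinc v) @` O).
Arguments ODv : clear implicits.

Lemma ODv1 v : ODv v 1.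
Proof.
exists [:: (1, 1)]; last by rewrite big_seq1 /= mulr1.
move=> _ /[!inE] /eqP ->; split; first by change (cabs v 1 <= 1); rewrite av1.
by exists 1; [exact: ord1|rewrite qmap1].
Qed.

Lemma ODvM v x y : ODv v x -> ODv v y -> ODv v (x * y).
Proof.
apply: lspanM => [c d|c z|c d|].
- exact: qscalM.
- exact: qscalC.
- move=> hc hd; change (cabs v (c * d) <= 1).
  by rewrite avM mulr_ile1// av_ge0.
- move=> _ _ [x' ox <-] [y' oy <-]; exists (x' * y'); first exact: ordM.
  exact: qmapM.
Qed.

(* The group D_f^* : invertible elements of the restricted product of the D_v
   with respect to the O_{D,v}; dinv is the componentwise inverse. *)
Record Dfx := MkDfx {
  dval :> forall v : place, Dv v;
  dinv : forall v : place, Dv v;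
  dval_dinv : forall v, dval v * dinv v = 1;
  dinv_dval : forall v, dinv v * dval v = 1;
  dval_fin : finite_set [set v | ~ ODv v (dval v)];
  dinv_fin : finite_set [set v | ~ ODv v (dinv v)]
}.

Lemma Dfx_eq (x y : Dfx) : (forall v, x v = y v) -> x = y.
Proof.
move=> h0; have h : dval x = dval y by exact: functional_extensionality_dep.
have : dinv x = dinv y.
  apply: functional_extensionality_dep => v.
  rewrite -[LHS]mulr1 -(dval_dinv y v) -h0 mulrA.
  by rewrite dinv_dval mul1r.
case: x y h {h0} => [x x' a1 a2 a3 a4] [y y' b1 b2 b3 b4] /= h h'.
by subst y y'; congr MkDfx; exact: Prop_irrelevance.
Qed.

HB.instance Definition _ := gen_eqMixin Dfx.
HB.instance Definition _ := gen_choiceMixin Dfx.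

Lemma fin_ODv1 : finite_set [set v | ~ ODv v 1].
Proof. by rewrite [X in finite_set X](_ : _ = set0) // -subset0 => v /= []; exact: ODv1. Qed.

Lemma fin_ODvM (x y : forall v, Dv v) :
  finite_set [set v | ~ ODv v (x v)] -> finite_set [set v | ~ ODv v (y v)] ->
  finite_set [set v | ~ ODv v (x v * y v)].
Proof.
move=> fx fy; apply: sub_finite_set (_ : _ `<=` [set v | ~ ODv v (x v)] `|`
    [set v | ~ ODv v (y v)]) _; last by rewrite finite_setU.
move=> v /= h; apply: contrapT => /not_orP[/contrapT hx /contrapT hy].
by apply: h; exact: ODvM.
Qed.

Definition dfx_one := @MkDfx (fun v => 1) (fun v => 1)
  (fun v => mulr1 1) (fun v => mulr1 1) fin_ODv1 fin_ODv1.

Definition dfx_inv (x : Dfx) := MkDfx (dinv_dval x) (dval_dinv x)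
  (dinv_fin x) (dval_fin x).

Program Definition dfx_mul (x y : Dfx) := @MkDfx (fun v => x v * y v)
  (fun v => dinv y v * dinv x v) _ _
  (fin_ODvM (dval_fin x) (dval_fin y)) (fin_ODvM (dinv_fin y) (dinv_fin x)).
Next Obligation.
by move=> x y v; rewrite mulrA -[_ * _ * dinv y v]mulrA dval_dinv mulr1 dval_dinv.
Qed.
Next Obligation.
by move=> x y v; rewrite mulrA -[_ * _ * x v]mulrA dinv_dval mulr1 dinv_dval.
Qed.

Lemma dfx_mulA : associative dfx_mul.
Proof. by move=> x y z; apply: Dfx_eq => v /=; rewrite mulrA. Qed.
Lemma dfx_mul1g : left_id dfx_one dfx_mul.
Proof. by move=> x; apply: Dfx_eq => v /=; rewrite mul1r. Qed.
Lemma dfx_mulg1 : right_id dfx_one dfx_mul.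
Proof. by move=> x; apply: Dfx_eq => v /=; rewrite mulr1. Qed.
Lemma dfx_mulVg : left_inverse dfx_one dfx_inv dfx_mul.
Proof. by move=> x; apply: Dfx_eq => v /=; rewrite dinv_dval. Qed.
Lemma dfx_mulgV : right_inverse dfx_one dfx_inv dfx_mul.
Proof. by move=> x; apply: Dfx_eq => v /=; rewrite dval_dinv. Qed.
HB.instance Definition _ := isGroup.Build Dfx
  dfx_mulA dfx_mul1g dfx_mulg1 dfx_mulVg dfx_mulgV.

(* x = d * y, with d in D embedded diagonally. *)
Definition lmul_eq (d : quat a b) (x y : Dfx) :=
  forall v, x v = (qmap (cinc v) d : Dv v) * y v.

End Quaternion_adeles.
Arguments Ov {R F} v.
Arguments ODv {R F a b} O v.

Definition totally_real (R : realType) (F : fieldExtType rat) :=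
  forall (tau : {rmorphism F -> R[i]}) x, tau x \is Num.real.

(* e(v | p) = 1 for every v above p, where e(v | p) is the index of the value
   group of Q in that of F. *)
Definition unramified (R : realType) (F : fieldExtType rat) (p : nat) :=
  forall (v : place_above R F p) (x : F), x != 0 -> exists y : rat, v x = v (ratr y).

Definition alg_iso (K A B : nzRingType) (iA : K -> A) (iB : K -> B)
    (f : {rmorphism A -> B}) :=
  bijective f /\ forall c, f (iA c) = iB c.

Definition totally_definite (R : realType) (F : fieldExtType rat) (a b : F) :=
  forall tau : {rmorphism F -> R},
    exists f : {rmorphism quat (tau a) (tau b) -> quat (-1 : R) (-1)},
      alg_iso (@qscal _ _ _) (@qscal _ _ _) f.

Definition splitting (R : realType) (F : fieldExtType rat) (a b : F)
    (v : place R F) (f : {rmorphism Dv a b v -> 'M[completion v]_2}) :=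
  alg_iso (@qscal _ _ _) (fun c => c%:M) f.

Definition finitely_unramified (R : realType) (F : fieldExtType rat) (a b : F) :=
  forall v : place R F, exists f, @splitting R F a b v f.

Definition is_ideal (F : fieldExtType rat) (n : set F) :=
  [/\ n `<=` @OF F, n 0, (forall x y, n x -> n y -> n (x + y)) &
      forall c x, OF c -> n x -> n (c * x)].

Definition prime_to (F : fieldExtType rat) (n : set F) (p : nat) :=
  exists x y, [/\ n x, OF y & x + p%:R * y = 1].

(* C_p up to isometric isomorphism: the complete algebraically closed field,
   with |p| = 1/p, in which the algebraic closure of Q_p is dense; Q_p is the
   closure of Q. *)
Definition is_Cp (R : realType) (p : nat) (C : closedFieldType) (v : absval R C) :=
  let Qp := [set x : C | exists s : nat -> rat, av_cvg v (fun n => ratr (s n)) x] in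
  [/\ v p%:R = p%:R^-1, av_complete v &
      forall x (e : R), 0 < e -> exists y (P : {poly C}),
        [/\ v (x - y) < e, P != 0, root P y & forall k, Qp P`_k]].

Section Level.
Variables (R : realType) (F : fieldExtType rat) (a b : F) (O : quat_order a b).
Variable theta : forall v : place R F, {rmorphism Dv a b v -> 'M[completion v]_2}.
Variables (p : nat) (n : set F) (s : nat).

(* v divides n p *)
Definition divides_np (v : place R F) :=
  (forall x, n x -> v x < 1) \/ v p%:R < 1.

Definition integral_splitting (v : place R F) :=
  splitting (theta v) /\
  forall x, ODv O v x <-> forall i j, Ov v (theta v x i j).

(* n p^s O_v *)
Definition npsOv (v : place R F) : set (completion v) :=
  lspan id (Ov v) ((fun y => cinc v (y * p%:R ^+ s)) @` n).

Arguments npsOv : clear implicits.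

Definition U0 : set (Dfx R O) :=
  [set u : Dfx R O | forall v, [/\ ODv O v (u v), ODv O v (dinv u v) &
     divides_np v -> npsOv v (theta v (u v) 1 0)]].

Variables (h : nat) (U : set (Dfx R O)) (t : 'I_h -> Dfx R O).

(* D_f^* is the disjoint union of the D^* t_i U. *)
Definition coset_representatives :=
  forall x : Dfx R O, exists! i : 'I_h, exists d u,
    [/\ qinvertible d, U u & lmul_eq d x (t i * u)%g].

(* Gamma^i = D^* \cap t_i U t_i^-1 is contained in F^* for all i. *)
Definition sufficiently_small :=
  forall (i : 'I_h) (d : quat a b), qinvertible d ->
    (exists2 u, U u & lmul_eq d (t i * u * (t i)^-1)%g 1%g) ->
    exists c : F, d = qscal a b c.
End Level.

Section Nonarchimedean.
Variables (R : realType) (L : fieldType) (w : absval R L).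

(* Sum of a family, as the limit of its finite partial sums. *)
Definition is_sum (I : choiceType) (x : I -> L) (y : L) :=
  forall e : R, 0 < e -> exists A : {fset I}, forall B : {fset I},
    (A `<=` B)%fset -> w (\sum_(i <- B) x i - y) < e.

Definition series_sum (I : choiceType) (x : I -> L) : L := xget 0 (is_sum x).

(* One-variable power series over L, as sequences of coefficients. *)
Definition smul (x y : nat -> L) : nat -> L :=
  fun k => \sum_(i < k.+1) x i * y (k - i)%N.

Definition sexp (x : nat -> L) (k : nat) : nat -> L :=
  iter k (smul x) (fun j => (j == 0%N)%:R).

Definition lin (c d : L) : nat -> L := nth 0 [:: d; c].

(* (c X + d)^-1, for d <> 0 *)
Definition lin_inv (c d : L) : nat -> L := fun k => (- c) ^+ k / d ^+ k.+1.

(* (c X + d)^e, for d <> 0 when e < 0 *)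
Definition lin_exp (c d : L) (e : int) : nat -> L :=
  match e with
  | Posz k => sexp (lin c d) k
  | Negz k => sexp (lin_inv c d) k.+1
  end.

(* Power series in X_1, ..., X_g, as functions of the exponent. *)
Definition mindex (g : nat) := {ffun 'I_g -> nat}.

Definition tate (g : nat) : set (mindex g -> L) :=
  [set f | forall e : R, 0 < e -> finite_set [set l | e <= w (f l)]].

(* Coefficient of X^m in det(1 - X A_B), A_B = (A i j)_(i, j in B). *)
Definition trunc_fredholm (I : choiceType) (A : I -> I -> L) (B : {fset I}) (m : nat) : L :=
  (\det (1%:M - 'X *: map_mx polyC (\matrix_(i < size B, j < size B)
     A (tnth (in_tuple B) i) (tnth (in_tuple B) j))))`_m.

(* c is the sequence of coefficients of the Fredholm series det(1 - X A) of the
   operator with matrix A in an orthonormal basis indexed by I. *)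
Definition is_fredholm (I : choiceType) (A : I -> I -> L) (c : nat -> L) :=
  forall m (e : R), 0 < e -> exists B0 : {fset I}, forall B : {fset I},
    (B0 `<=` B)%fset -> w (trunc_fredholm A B m - c m) < e.

(* val_p, for x != 0 *)
Definition valp (p : nat) (x : L) : R := - ln (w x) / ln p%:R.

(* Lower boundary at abscissa x of the convex hull of the points
   (m, val_p (c m)), c m != 0. *)
Definition newton_polygon (p : nat) (c : nat -> L) (x : R) : \bar R :=
  ereal_inf [set y%:E | y in [set y | exists N (lam : 'I_N -> R) (m : 'I_N -> nat),
    [/\ forall i, 0 <= lam i, \sum_i lam i = 1, forall i, c (m i) != 0,
        \sum_i lam i * (m i)%:R = x & \sum_i lam i * valp p (c (m i)) = y]]].
End Nonarchimedean.

(* The nondecreasing sequence in which each i occurs mult i times, for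
   mult i > 0. *)
Definition slopes (mult : nat -> nat) (k : nat) : nat :=
  nth 0%N (flatten [seq nseq (mult i) i | i <- iota 0 k.+1]) k.

(* The polygon from (0, 0) whose successive unit steps have slopes sl 0, sl 1... *)
Definition polygon (R : realType) (sl : nat -> nat) (x : R) : R :=
  (\sum_(j < Num.truncn x) sl j)%:R + (x - (Num.truncn x)%:R) * (sl (Num.truncn x))%:R.

Section Forms.
Variables (R : realType) (F : fieldExtType rat) (a b : F) (O : quat_order a b).
Variable theta : forall v : place R F, {rmorphism Dv a b v -> 'M[completion v]_2}.
Variables (p : nat) (s : nat).
Variables (L : fieldType) (w : absval R L) (g : nat).
Variable sigma : 'I_g -> {rmorphism F -> L}.

Local Notation above := (place_above R F p).
Local Notation Dfx := (Dfx R O).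
Local Notation mindex := (mindex g).

(* F (x) Q_p, the product of the completions of F at the places above p, and
   M_2(F (x) Q_p) *)
Definition Fp := forall v : above, completion v.
Definition M2Fp := forall v : above, 'M[completion v]_2.

Definition Op_units : set Fp := [set x : Fp | forall v : above, cabs v (x v) = 1].

Definition is_weight_character (psi : Fp -> L) :=
  [/\ psi (fun v => 1) = 1,
      forall x y, Op_units x -> Op_units y ->
        psi (fun v => x v * y v) = psi x * psi y,
      forall x y, Op_units x -> Op_units y ->
        (forall v : above, exists2 z, Ov v z & x v - y v = p%:R ^+ s * z) -> psi x = psi y &
      exists2 N, (0 < N)%N & forall x, Op_units x -> psi x ^+ N = 1].

(* sigma_i induces the place v *)
Definition induces (i : 'I_g) (v : place R F) := forall x, w (sigma i x) = v x.

(* The continuous extension of sigma_i to F (x) Q_p, which factors through the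
   completion at the place induced by sigma_i. *)
Definition sigma_ext (i : 'I_g) (x : Fp) : L :=
  xget 0 [set y | exists2 v : above, induces i v &
                  av_cvg w (fun k => sigma i (crep (x v) k)) y].

Definition sigma_mx (i : 'I_g) (gam : M2Fp) : 'M[L]_2 :=
  \matrix_(k, l) sigma_ext i (fun v => gam v k l).

Variables (nn vv : 'I_g -> int) (psi : Fp -> L).

(* The coefficient of X^m in X^l . gam, that is in
     psi(d) \prod_i det(gam_i)^v_i (c_i X_i + d_i)^(n_i - l_i) (a_i X_i + b_i)^l_i,
   for gam integral with c divisible by pi_v^s and d prime to pi_v at each v. *)
Definition monomial_act (gam : M2Fp) (l m : mindex) : L :=
  psi (fun v => gam v 1 1) *
  \prod_i (let A := sigma_mx i gam in
    \det A ^ vv i *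
    smul (lin_exp (A 1 0) (A 1 1) (nn i - (l i)%:Z))
         (sexp (lin (A 0 0) (A 0 1)) (l i)) (m i)).

Definition weight_act (f : mindex -> L) (gam : M2Fp) : mindex -> L :=
  fun m => series_sum w (fun l => f l * monomial_act gam l m).

Definition comp_p (u : Dfx) : M2Fp := fun v => theta (v : place R F) (u v).

Definition forms (U : set Dfx) : set (Dfx -> mindex -> L) :=
  [set f | [/\ forall x, tate w (f x),
      forall d x y, qinvertible d -> lmul_eq d y x -> f y = f x &
      forall u x, U u -> weight_act (f (x * u^-1)%g) (comp_p u) = f x]].

Variable varpi : forall v : above, completion v.

(* The element [varpi_v, 0; alpha varpi_v^s, 1] at v and 1 elsewhere. *)
Definition u_alpha (v : above) (alpha : completion v) : Dfx :=
  xget 1%g [set u : Dfx |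
    theta v (u v) = \matrix_(i, j)
      (if i == 0 then if j == 0 then varpi v else 0
       else if j == 0 then alpha * varpi v ^+ s else 1) /\
    forall q : place R F, q != v -> u q = 1].

Arguments u_alpha : clear implicits.

(* residues v lists representatives of O_v / pi_v. *)
Variable residues : forall v : above, seq (completion v).

Definition is_residues := forall v : above,
  [/\ uniq (residues v), forall x, x \in residues v -> Ov v x &
      forall x, Ov v x -> exists! alpha, alpha \in residues v /\
        exists2 y, Ov v y & x - alpha = varpi v * y].

Definition Uv (v : above) (f : Dfx -> mindex -> L) : Dfx -> mindex -> L :=
  fun x m => \sum_(alpha <- residues v)
    weight_act (f (x * (u_alpha v alpha)^-1)%g) (comp_p (u_alpha v alpha)) m.

Variable ps : seq above.

Definition Up (f : Dfx -> mindex -> L) : Dfx -> mindex -> L :=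
  foldr Uv f ps.

Variable ind : above -> 'I_g.

Definition v_kappa (v : above) : int := \sum_(i < g | `[< induces i v >]) vv i.

Definition Up0 (f : Dfx -> mindex -> L) : Dfx -> mindex -> L :=
  fun x m => (\prod_(v <- ps) sigma_ext (ind v) varpi ^ (- v_kappa v)) * Up f x m.

Variables (h : nat) (t : 'I_h -> Dfx).

(* A is the matrix of T on forms U, transported by f |-> (f (t_i))_i, in the
   orthonormal basis of the monomials of the h copies of the Tate algebra. *)
Definition matrix_on_forms (U : set Dfx) (T : (Dfx -> mindex -> L) -> Dfx -> mindex -> L)
    (A : 'I_h * mindex -> 'I_h * mindex -> L) :=
  forall il, exists2 f, forms U f &
    (forall k m, f (t k) m = ((k, m) == il)%:R) /\
    (forall k m, A (k, m) il = T f (t k) m).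
End Forms.

(* Main.v *)
Require Import Defs.
From HB Require Import structures.
From mathcomp Require Import all_boot all_order all_algebra all_field.
From mathcomp Require Import perm ring_quotient generic_quotient complex finmap.
From mathcomp Require Import all_classical all_reals all_analysis.
From mathcomp Require Import ring zify.

Set Implicit Arguments.
Unset Strict Implicit.
Unset Printing Implicit Defensive.

Import Order.TTheory GRing.Theory Num.Theory.
Import numFieldNormedType.Exports.

Local Open Scope classical_set_scope.
Local Open Scope ring_scope.

(** Write [A] for the matrix of the normalised operator in the basis formed by the
    monomials [X^m] in the [h] copies of the Tate algebra. The theorem follows from
    one estimate on its rows: the entries in the row of [X^m] have absolute value
    at most [p ^ - |m|] ([Up0_le]). A coefficient of index [m] of the Fredholm
    series is a limit of sums of products of [m] entries in distinct rows, hence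
    has valuation at least the sum of the [m] smallest weights [|m|], each degree
    [k] being available [s(k) h] times ([trunc_fredholm_le], [slopes_sum_le]). These
    sums are the ordinates of the polygon with slopes [0, 0, ..., 1, 1, ...], and
    since this polygon is convex it lies below the Newton polygon
    ([newton_polygon_ge]). The limit exists because the rows tend to 0
    ([trunc_fredholm_close]).

    The estimate on the rows comes from the shape of the Hecke matrices. An element
    of the level acts with integral coefficients, so the values of a basis form are
    integral at every adele ([forms_le1]). The matrix with rows [(pi, 0)] and
    [(alpha pi^s, 1)] sends [X^l] to a series in [pi X]: its coefficient of [X^m] is
    divisible by [pi ^ m] up to the determinant factor, which the normalisation
    removes. The places above [p] are treated one after the other, with a Gauss
    norm whose radius changes in the variables of the place concerned ([Uv_le]);
    [pi] has the valuation of [p] because [p] is unramified ([av_uniformiser]).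

    The isomorphism with the sum of Tate algebras ([forms_bij]) needs that the
    weight action is an action of the level, and that the scalars in the level act
    trivially. Both are checked on values at integral points: the transform of [f]
    by [gam] takes at [z] the value of [f] at the image of [z], times a cocycle
    ([weight_act_eval]), and a convergent series is determined by its values
    ([tate_ext]). A scalar of the level is bounded at all the places of [F], hence
    it is a unit of the ring of integers ([integral_of_places], where the places
    are obtained from valuation rings); it acts by the power [2 r] of its norm,
    which is 1 or -1 ([norm_unit]). *)

(** * Unconditional sums over a nonarchimedean field *)

Section NonarchimedeanSums.
Variables (R : realType) (L : fieldType) (w : absval R L).

Lemma av_sum_lt (I : eqType) (t : seq I) (P : pred I) (x : I -> L) (e : R) :
  0 < e -> (forall i, i \in t -> P i -> w (x i) < e) ->
  w (\sum_(i <- t | P i) x i) < e.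
Proof.
move=> e0 h; rewrite big_seq_cond; apply: (big_ind (fun z => w z < e)).
- by rewrite av0.
- by move=> y z; exact: av_lt_add.
- by move=> i /andP[]; exact: h.
Qed.

Lemma av_sum_le (I : eqType) (t : seq I) (P : pred I) (x : I -> L) (e : R) :
  0 <= e -> (forall i, i \in t -> P i -> w (x i) <= e) ->
  w (\sum_(i <- t | P i) x i) <= e.
Proof.
move=> e0 h; rewrite big_seq_cond; apply: (big_ind (fun z => w z <= e)).
- by rewrite av0.
- by move=> y z hy hz; apply: le_trans (av_ultra _ _ _) _; rewrite ge_max hy.
- by move=> i /andP[]; exact: h.
Qed.

Lemma av_prod (I : Type) (t : seq I) (P : pred I) (x : I -> L) :
  w (\prod_(i <- t | P i) x i) = \prod_(i <- t | P i) w (x i).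
Proof. by apply: (big_morph w (avM w)); exact: av1. Qed.

Lemma avX x k : w (x ^+ k) = w x ^+ k.
Proof. by elim: k => [|k ih]; rewrite ?expr0 ?av1// !exprS avM ih. Qed.

Lemma avV x : w x^-1 = (w x)^-1.
Proof.
have [->|/eqP x0] := eqVneq x 0; first by rewrite invr0 av0 invr0.
have wx := av_gt0 w x0; apply: (mulfI (lt0r_neq0 wx)).
by rewrite -avM divff ?av1 ?divff ?lt0r_neq0//; exact/eqP.
Qed.

Lemma avXz x (k : int) : w (x ^ k) = w x ^ k.
Proof.
case: k => k; first exact: avX.
by rewrite !NegzE -!exprnN avV avX.
Qed.

Definition null_family (I : choiceType) (x : I -> L) :=
  forall e : R, 0 < e -> finite_set [set i | e <= w (x i)].

(** Over a nonarchimedean field the finite partial sum over [t] is within [e]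
    of the sum as soon as all the terms outside [t] are below [e]. Asking for
    one good list per precision therefore describes convergence and the
    tendency to 0 of the family at the same time, and lets sums be computed
    by exhibiting lists. *)
Definition sums_to (I : choiceType) (x : I -> L) (y : L) :=
  forall e : R, 0 < e -> exists t : seq I,
    [/\ uniq t, forall i, i \notin t -> w (x i) < e &
        w (\sum_(i <- t) x i - y) < e].

Section Basic.
Variable I : choiceType.
Implicit Types (x : I -> L) (t : seq I).

Lemma sums_to_close x y t (e : R) : sums_to x y -> 0 < e -> uniq t ->
  (forall i, i \notin t -> w (x i) < e) -> w (\sum_(i <- t) x i - y) < e.
Proof.
move=> hx e0 ut ht; have [t' [ut' ht' ty]] := hx _ e0.
have E : \sum_(i <- t | i \in t') x i = \sum_(i <- t' | i \in t) x i.
  rewrite -big_filter -[RHS]big_filter; apply: perm_big.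
  apply: uniq_perm; rewrite ?filter_uniq// => i.
  by rewrite !mem_filter andbC.
have -> : \sum_(i <- t) x i - y = \sum_(i <- t | i \notin t') x i
    + - \sum_(i <- t' | i \notin t) x i + (\sum_(i <- t') x i - y).
  rewrite (bigID (mem t'))/= E [X in _ + (X - y)](bigID (mem t))/=.
  by ring.
apply: av_lt_add => //; apply: av_lt_add; first by apply: av_sum_lt => // i _ /ht'.
by rewrite avN; apply: av_sum_lt => // i _ /ht.
Qed.

Lemma sums_to_lt x y (e : R) : sums_to x y -> 0 < e ->
  (forall i, w (x i) < e) -> w y < e.
Proof.
move=> hx e0 h; have := @sums_to_close x y [::] e hx e0 isT.
by rewrite big_nil sub0r avN; apply=> i _; exact: h.
Qed.

Lemma sums_to_null x y : sums_to x y -> null_family x.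
Proof.
move=> hx e e0; have [t [_ ht _]] := hx _ e0.
apply: (sub_finite_set _ (finite_seq t)) => i /=; rewrite leNgt => wi.
by apply/negPn/negP => /ht; rewrite (negbTE wi).
Qed.

Lemma null_family_tail x (e : R) : null_family x -> 0 < e ->
  exists2 t : seq I, uniq t & forall i, i \notin t -> w (x i) < e.
Proof.
move=> hx e0; have fx := hx _ e0; exists (fset_set [set i | e <= w (x i)]) => // i.
by rewrite in_fset_set// => h; rewrite ltNge; apply: contra h => h; rewrite inE.
Qed.

Lemma null_family_bounded x : null_family x ->
  exists2 c : R, 0 < c & forall i, w (x i) < c.
Proof.
move=> hx; have [t _ ht] := null_family_tail hx ltr01.
exists (1 + \sum_(i <- t) w (x i)).
  by rewrite ltr_pwDl// sumr_ge0// => i _; exact: av_ge0.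
move=> i; have [it|/ht] := boolP (i \in t); last first.
  by move=> /lt_le_trans; apply; rewrite lerDl sumr_ge0// => j _; exact: av_ge0.
rewrite (big_rem i)//= addrCA ltrDl ltr_pwDl// sumr_ge0// => j _; exact: av_ge0.
Qed.

Lemma sums_to_unique x y y' : sums_to x y -> sums_to x y' -> y = y'.
Proof.
move=> h h'; apply/eqP; rewrite -subr_eq0; apply/negPn/negP => /eqP yy.
have e0 := av_gt0 w yy; have [t [ut ht ty]] := h _ e0.
have ty' := sums_to_close h' e0 ut ht.
have := av_lt_add ty' (etrans (congr1 (fun z => z < _) (avN w _)) ty).
rewrite (_ : _ + _ = y - y') ?ltxx//; by ring.
Qed.

Lemma is_sum_unique x y y' : is_sum w x y -> is_sum w x y' -> y = y'.
Proof.
move=> h h'; apply/eqP; rewrite -subr_eq0; apply/negPn/negP => /eqP yy.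
have e0 := av_gt0 w yy; have [A hA] := h _ e0; have [A' hA'] := h' _ e0.
have a1 := hA (A `|` A')%fset (fsubsetUl _ _).
have a2 := hA' (A `|` A')%fset (fsubsetUr _ _).
have := av_lt_add a2 (etrans (congr1 (fun z => z < _) (avN w _)) a1).
by rewrite (_ : _ + _ = y - y') ?ltxx//; ring.
Qed.

Lemma sums_to_is_sum x y : sums_to x y -> is_sum w x y.
Proof.
move=> hx e e0; have [t [ut ht _]] := hx _ e0.
exists [fset i | i in t]%fset => B tB; apply: sums_to_close => // i iB.
apply: ht; apply: contra iB => it; apply: (fsubsetP tB).
by rewrite !inE.
Qed.

Lemma series_sumE x y : sums_to x y -> series_sum w x = y.
Proof.
move=> /sums_to_is_sum h; rewrite /series_sum.
by case: xgetP => [z _ hz|/(_ y)//]; exact: is_sum_unique hz h.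
Qed.

(** The convention that a divergent sum is 0 makes this bound unconditional. *)
Lemma series_sum_le x (c : R) : 0 <= c -> (forall i, w (x i) <= c) ->
  w (series_sum w x) <= c.
Proof.
move=> c0 h; rewrite /series_sum; case: xgetP => [y _ hy|_]; last by rewrite av0.
apply/ler_addgt0Pr => e e0; have [A /(_ A (fsubset_refl A)) hA] := hy _ e0.
have -> : y = \sum_(i <- A) x i + - (\sum_(i <- A) x i - y) by ring.
apply: le_trans (av_ultra _ _ _) _; rewrite avN ge_max; apply/andP; split.
  by apply: (@le_trans _ _ c); [exact: av_sum_le|rewrite lerDl ltW].
by apply: le_trans (ltW hA) _; rewrite lerDr.
Qed.

Lemma sums_to_seq x t : uniq t -> (forall i, i \notin t -> x i = 0) ->
  sums_to x (\sum_(i <- t) x i).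
Proof.
move=> ut ht e e0; by exists t; split=> [//|i /ht ->|]; rewrite ?subrr av0.
Qed.

Lemma eq_sums_to x x' y : x =1 x' -> sums_to x y -> sums_to x' y.
Proof. by move=> /funext ->. Qed.

Lemma sums_toZ c x y : sums_to x y -> sums_to (fun i => c * x i) (c * y).
Proof.
move=> hx e e0; have [->|/eqP c0] := eqVneq c 0.
  exists [::]; split=> [//|i _|]; first by rewrite mul0r av0.
  by rewrite big_nil mul0r subrr av0.
have wc := av_gt0 w c0; have [t [ut ht ty]] := hx _ (divr_gt0 e0 wc).
exists t; split=> [//|i /ht h|]; first by rewrite avM mulrC -ltr_pdivlMr.
by rewrite -mulr_sumr -mulrBr avM mulrC -ltr_pdivlMr.
Qed.

Lemma sums_toB x x' y y' : sums_to x y -> sums_to x' y' ->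
  sums_to (fun i => x i - x' i) (y - y').
Proof.
move=> hx hx' e e0; have [t [ut ht ty]] := hx _ e0; have [t' [ut' ht' ty']] := hx' _ e0.
have U := undup_uniq (t ++ t').
have tl i : i \notin undup (t ++ t') -> w (x i) < e /\ w (x' i) < e.
  by rewrite mem_undup mem_cat negb_or => /andP[/ht ? /ht' ?].
exists (undup (t ++ t')); split=> [//|i /tl[? ?]|].
  by apply: av_lt_add; rewrite ?avN.
rewrite sumrB (_ : _ - _ - _ = (\sum_(i <- undup (t ++ t')) x i - y)
  + - (\sum_(i <- undup (t ++ t')) x' i - y')); last by ring.
by apply: av_lt_add; rewrite ?avN; apply: sums_to_close => // i /tl[].
Qed.

(** The partial sums over the finite sets of terms of absolute value at least
    [1 / (k + 1)] form a Cauchy sequence. *)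
Lemma null_sums_to x : av_complete w -> null_family x -> exists y, sums_to x y.
Proof.
move=> cw hx; have d0 k : 0 < (k.+1%:R)^-1 :> R by rewrite invr_gt0.
pose t k : seq I := fset_set [set i | k.+1%:R^-1 <= w (x i)].
have tP k i : (i \in t k) = (k.+1%:R^-1 <= w (x i)).
  by rewrite in_fset_set ?mem_setE//; exact: hx.
have small e : 0 < e -> exists N, forall k, (N <= k)%N -> k.+1%:R^-1 < e :> R.
  move=> e0; exists (Num.truncn e^-1) => k Nk.
  rewrite invf_plt ?posrE//; apply: lt_le_trans (truncnS_gt _) _.
  by rewrite ler_nat.
pose S k := \sum_(i <- t k) x i.
have sub k m : (k <= m)%N -> w (S m - S k) < k.+1%:R^-1.
  move=> km; rewrite /S (bigID (mem (t k)))/= -big_filter.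
  rewrite (_ : \sum_(i <- [seq _ <- _ | _]) _ = \sum_(i <- t k) x i).
    rewrite addrAC subrr add0r; apply: av_sum_lt => // i _.
    by rewrite tP -ltNge.
  apply: perm_big; apply: uniq_perm; rewrite ?filter_uniq ?fset_uniq// => i.
  rewrite mem_filter !tP andb_idr//; apply: le_trans.
  by rewrite lef_pV2 ?posrE// ler_nat.
have cS : av_cauchy w S.
  move=> e e0; have [N hN] := small _ e0; exists N => m k Nm Nk.
  wlog mk : m k Nm Nk / (m <= k)%N.
    move=> H; have [mk|/ltnW km] := leqP m k; first exact: H.
    by rewrite av_subC; exact: H.
  by rewrite av_subC; apply: lt_trans (sub _ _ mk) (hN _ Nm).
have [y hy] := cw _ cS; exists y => e e0.
have [N hN] := small _ e0; have [M hM] := hy _ e0.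
exists (t (maxn N M)); split; first exact: fset_uniq.
  move=> i; rewrite tP -ltNge => /lt_trans; apply; apply: hN.
  exact: leq_maxl.
by apply: hM; exact: leq_maxr.
Qed.

End Basic.

Lemma sums_to_inj (I J : choiceType) (k : J -> I) (x : I -> L) y :
  injective k -> (forall i, (forall j, i <> k j) -> x i = 0) ->
  sums_to (x \o k) y -> sums_to x y.
Proof.
move=> kI x0 h e e0; have [t [ut ht ty]] := h _ e0.
exists (map k t); split; [by rewrite map_inj_uniq| |by rewrite big_map].
move=> i it; have [[j ij]|nij] := pselect (exists j, i = k j).
  by rewrite ij; apply: ht; apply: contra it => jt; rewrite ij map_f.
by rewrite x0 ?av0// => j ij; apply: nij; exists j.
Qed.

(** Summation by packets: this is what replaces Fubini, Cauchy products and
    regroupings of multivariate series. *)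
Lemma sums_to_fiber (I J : choiceType) (K : I -> J) (x : I -> L) (y : J -> L) s :
  sums_to x s ->
  (forall j, sums_to (fun i => if K i == j then x i else 0) (y j)) ->
  sums_to y s.
Proof.
move=> hx hy e e0; have [t [ut ht ts]] := hx _ e0.
have tl j i : i \notin t -> w (if K i == j then x i else 0) < e.
  by move=> /ht h; case: ifP => // _; rewrite av0.
exists (undup (map K t)); split; first exact: undup_uniq.
  move=> j; rewrite mem_undup => jt; apply: (sums_to_lt (hy j)) => // i.
  have [Kij|_] := eqVneq (K i) j; last by rewrite av0.
  by apply: ht; apply: contra jt => it; rewrite -Kij map_f.
have -> : \sum_(j <- undup (map K t)) y j - s =
    \sum_(j <- undup (map K t)) - (\sum_(i <- t) (if K i == j then x i else 0) - y j)
    + (\sum_(i <- t) x i - s).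
  have <- : \sum_(j <- undup (map K t)) \sum_(i <- t) (if K i == j then x i else 0)
      = \sum_(i <- t) x i.
    rewrite exchange_big/= big_seq [RHS]big_seq; apply: eq_bigr => i it.
    rewrite (bigD1_seq (K i)) ?undup_uniq ?mem_undup ?map_f//= eqxx.
    by rewrite big1 ?addr0// => j; rewrite eq_sym => /negbTE ->.
  by rewrite sumrN sumrB; ring.
apply: av_lt_add => //; apply: av_sum_lt => // j _ _.
by rewrite avN; apply: sums_to_close => // i; exact: tl.
Qed.

Lemma sums_to_pair1 (I J : choiceType) (u : I * J -> L) (y : I -> L) s :
  sums_to u s -> (forall i, sums_to (fun j => u (i, j)) (y i)) -> sums_to y s.
Proof.
move=> hu hy; apply: (sums_to_fiber (K := fst) hu) => i.
apply: (@sums_to_inj _ _ (pair i)) => [j j' []//|[i' j] /= h|].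
  by case: eqP => // E; case: (h j); rewrite E.
by apply: eq_sums_to (hy i) => j /=; rewrite eqxx.
Qed.

Lemma sums_to_pair2 (I J : choiceType) (u : I * J -> L) (y : J -> L) s :
  sums_to u s -> (forall j, sums_to (fun i => u (i, j)) (y j)) -> sums_to y s.
Proof.
move=> hu hy; apply: (sums_to_fiber (K := snd) hu) => j.
apply: (@sums_to_inj _ _ (pair^~ j)) => [i i' []//|[i j'] /= h|].
  by case: eqP => // E; case: (h i); rewrite E.
by apply: eq_sums_to (hy j) => i /=; rewrite eqxx.
Qed.

Lemma sums_to_mul (I J : choiceType) (x : I -> L) (y : J -> L) s t :
  sums_to x s -> sums_to y t -> sums_to (fun ij => x ij.1 * y ij.2) (s * t).
Proof.
move=> hx hy e e0.
have [c c0 hc] := null_family_bounded (sums_to_null hx).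
have [d d0 hd] := null_family_bounded (sums_to_null hy).
have wt : w t < d by exact: sums_to_lt hy _ _.
have [a [ua ha sa]] := hx _ (divr_gt0 e0 d0).
have [b [ub hb sb]] := hy _ (divr_gt0 e0 c0).
exists [seq (i, j) | i <- a, j <- b]; split.
- by apply: allpairs_uniq => // -[? ?] [? ?].
- move=> [i j] /= h; rewrite avM.
  have [ia|/ha xi] := boolP (i \in a); last first.
    by rewrite -(divfK (lt0r_neq0 d0) e) ltr_pM ?av_ge0.
  have [jb|/hb yj] := boolP (j \in b).
    by case/negP: h; apply/allpairsP; exists (i, j).
  by rewrite -(divfK (lt0r_neq0 c0) e) [_ * c]mulrC ltr_pM ?av_ge0.
- rewrite big_allpairs /=.
  under eq_bigr do rewrite -mulr_sumr.
  rewrite -mulr_suml; set a' := \sum_(i <- a) _ in sa *; set b' := \sum_(j <- b) _ in sb *.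
  rewrite (_ : a' * b' - s * t = a' * (b' - t) + (a' - s) * t); last by ring.
  apply: av_lt_add; rewrite avM.
    rewrite -(divfK (lt0r_neq0 c0) e) [_ * c]mulrC ltr_pM ?av_ge0//.
    exact: av_sum_lt.
  by rewrite -(divfK (lt0r_neq0 d0) e) ltr_pM ?av_ge0.
Qed.

(** The factors are compared one at a time. *)
Lemma av_prod_close (I : Type) (t : seq I) (a b : I -> L) (c e : R) :
  1 <= c -> 0 < e -> (forall i, w (a i) <= c) -> (forall i, w (b i) <= c) ->
  (forall i, w (a i - b i) < e) ->
  w (\prod_(i <- t) a i - \prod_(i <- t) b i) < e * c ^+ size t.
Proof.
move=> c1 e0 ha hb hab; have c0 : 0 < c by exact: lt_le_trans c1.
have hB t' : w (\prod_(i <- t') b i) <= c ^+ size t'.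
  elim: t' => [|i t' ih]; first by rewrite big_nil av1.
  by rewrite big_cons exprS avM ler_pM ?av_ge0.
elim: t => [|i t ih]; first by rewrite !big_nil subrr av0 mulr1.
rewrite !big_cons /= (_ : _ - _ = a i * (\prod_(j <- t) a j - \prod_(j <- t) b j)
  + (a i - b i) * \prod_(j <- t) b j); last by ring.
apply: av_lt_add; rewrite avM exprS.
  rewrite mulrCA; apply: le_lt_trans (ler_wpM2r (av_ge0 _ _) (ha i)) _.
  by rewrite ltr_pM2l.
apply: le_lt_trans (ler_wpM2l (av_ge0 _ _) (hB t)) _.
rewrite mulrA ltr_pM2r ?exprn_gt0//; apply: lt_le_trans (hab i) _.
by apply: ler_peMr => //; exact: ltW.
Qed.

(** A product of [g] one-variable sums is the sum over the exponents in
    [g] variables: compare both along the boxes [m_i < N]. *)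
Lemma sums_to_prod (g : nat) (x : 'I_g -> nat -> L) (s : 'I_g -> L) :
  (forall i, sums_to (x i) (s i)) ->
  sums_to (fun m : mindex g => \prod_i x i (m i)) (\prod_i s i).
Proof.
move=> hx.
have [c c1 hc] : exists2 c : R, 1 <= c & forall i k, w (x i k) < c.
  have /choice[C hC] : forall i, exists c : R, 0 < c /\ forall k, w (x i k) < c.
    by move=> i; have [c c0 hc] := null_family_bounded (sums_to_null (hx i)); exists c.
  exists (1 + \sum_i C i) => [|i k].
    by rewrite lerDl sumr_ge0// => i _; rewrite ltW//; case: (hC i).
  apply: lt_le_trans (proj2 (hC i) k) _; rewrite (bigD1 i)//= addrCA lerDl addr_ge0//.
  by rewrite sumr_ge0// => j _; rewrite ltW//; case: (hC j).
have c0 : 0 < c by exact: lt_le_trans c1.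
move=> e e0; have e'0 : 0 < e / c ^+ g by rewrite divr_gt0// exprn_gt0.
have /choice[M hM] : forall i, exists M, forall k, (M <= k)%N -> w (x i k) < e / c ^+ g.
  move=> i; have [t _ ht] := null_family_tail (sums_to_null (hx i)) e'0.
  exists (\max_(k <- t) k).+1 => k Mk; apply: ht; apply/negP => kt.
  by move: Mk; rewrite ltnNge (leq_bigmax_seq (F := id) k kt).
pose N := \max_i M i.
have hN i k : (N <= k)%N -> w (x i k) < e / c ^+ g.
  by move=> Nk; apply: hM; apply: leq_trans Nk; exact: leq_bigmax.
pose inj (f : {ffun 'I_g -> 'I_N}) : mindex g := [ffun i => val (f i)].
have injI : injective inj.
  move=> f f' /ffunP E; apply/ffunP => i; apply: val_inj.
  by have := E i; rewrite !ffunE.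
exists [seq inj f | f <- enum {: {ffun 'I_g -> 'I_N}}]; split.
- by rewrite map_inj_uniq ?enum_uniq.
- move=> m hm; have [i Ni] : exists i, (N <= m i)%N.
    apply: contrapT => /forallNP h; case/negP: hm.
    have lt i : (m i < N)%N by rewrite ltnNge; exact/negP.
    apply/mapP; exists [ffun i => Ordinal (lt i)]; first by rewrite mem_enum.
    by apply/ffunP => i; rewrite !ffunE.
  rewrite av_prod (bigD1 i)//=.
  apply: (@le_lt_trans _ _ (w (x i (m i)) * c ^+ g)); last first.
    by rewrite -ltr_pdivlMr ?exprn_gt0// hN.
  rewrite ler_wpM2l ?av_ge0//.
  apply: (@le_trans _ _ (\prod_(j < g | j != i) c)).
    by apply: ler_prod => j _; rewrite av_ge0 ltW.
  by rewrite prodr_const ler_weXn2l// (leq_trans (max_card _))// card_ord.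
- rewrite big_map big_enum /=.
  rewrite (_ : \sum_f _ = \prod_i \sum_(k < N) x i k); last first.
    rewrite bigA_distr_bigA/=; apply: eq_bigr => f _; apply: eq_bigr => i _.
    by rewrite ffunE.
  rewrite -(divfK (lt0r_neq0 (exprn_gt0 g c0)) e).
  have sz : size (index_enum 'I_g) = g by rewrite -[RHS]card_ord cardE enumT.
  have := @av_prod_close _ (index_enum 'I_g) (fun i => \sum_(k < N) x i k) s c _ c1 e'0.
  rewrite sz; apply=> i.
  - by apply: av_sum_le => [|k _ _]; rewrite ltW.
  - by apply: ltW; exact: sums_to_lt (hx i) _ _.
  - rewrite -(big_mkord xpredT (x i)); apply: sums_to_close => //.
      by rewrite iota_uniq.
    by move=> k; rewrite mem_index_iota -leqNgt; exact: hN.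
Qed.

End NonarchimedeanSums.

(** * Identity principles for convergent series *)

Lemma small_power (R : realType) (r e : R) : 0 <= r < 1 -> 0 < e ->
  exists N, r ^+ N < e.
Proof.
move=> /andP[r0 r1] e0; have h : (fun n => r ^+ n) @ \oo --> (0 : R).
  by apply: cvg_expr; rewrite ger0_norm.
have /cvgrPdist_lt/(_ _ e0)[N _ /(_ N (leqnn N))] := h.
by rewrite /= sub0r normrN ger0_norm ?exprn_ge0// => hN; exists N.
Qed.

Lemma digits_inj (g B : nat) (a b : 'I_g -> nat) :
  (forall i, a i < B)%N -> (forall i, b i < B)%N ->
  (\sum_i a i * B ^ i = \sum_i b i * B ^ i)%N -> a =1 b.
Proof.
elim: g a b => [|g ih] a b ha hb; first by move=> _ [].
rewrite !big_ord_recl/= !expn0 !muln1.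
have shift (c : 'I_g.+1 -> nat) : (\sum_(i < g) c (lift ord0 i) * B ^ bump 0 i =
    (\sum_(i < g) c (lift ord0 i) * B ^ i) * B)%N.
  rewrite big_distrl/=; apply: eq_bigr => i _.
  by rewrite /bump/= add1n expnSr mulnA.
rewrite !shift => E.
have E0 : a ord0 = b ord0.
  have := congr1 (modn^~ B) E; rewrite /= ![(_ + _ * B)%N]addnC !modnMDl.
  by rewrite !modn_small.
move: E; rewrite E0 => /addnI /eqP; rewrite eqn_pmul2r; last first.
  by apply: leq_ltn_trans (ha ord0).
move=> /eqP/ih E i; have [j ->|->//] := unliftP ord0 i.
by apply: E => j'; rewrite ?ha ?hb.
Qed.

Section Identity.
Variables (R : realType) (L : fieldType) (w : absval R L) (pi : L).
Hypotheses (pi_gt0 : 0 < w pi) (pi_lt1 : w pi < 1) (cw : av_complete w).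

(** If [x k] is the first nonzero coefficient, then at a small argument [z] its
    term is larger than all the later ones together. *)
Lemma sums_to0_eq0 (x : nat -> L) :
  (forall z, w z <= 1 -> sums_to w (fun k => x k * z ^+ k) 0) ->
  forall k, x k = 0.
Proof.
move=> h.
have nx : null_family w x.
  apply: (@sums_to_null _ _ _ _ _ 0); apply: eq_sums_to (h 1 _); last by rewrite av1.
  by move=> k; rewrite expr1n mulr1.
have [c c0 hc] := null_family_bounded nx.
elim/ltn_ind => k ih; apply/eqP/negPn/negP => /eqP xk.
have wx := av_gt0 w xk.
have [N hN] : exists N, w pi ^+ N < w (x k) / c.
  by apply: small_power; rewrite ?ltW//= divr_gt0.
rewrite -avX in hN; set z := pi ^+ N in hN.
have z0 : 0 < w z by rewrite avX exprn_gt0.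
have z1 : w z <= 1 by rewrite avX exprn_ile1 ?ltW.
have zc : 0 < c * w z ^+ k.+1 by rewrite mulr_gt0// exprn_gt0.
have Ek : \sum_(i <- iota 0 k.+1) x i * z ^+ i = x k * z ^+ k.
  rewrite -addn1 iotaD big_cat big_seq1/= big1_seq ?add0r// => i.
  by rewrite mem_iota => /andP[_ /ih ->]; rewrite mul0r.
have : w (x k) * w z ^+ k < c * w z ^+ k.+1.
  rewrite -avX -avM -Ek -[X in w X]subr0.
  apply: sums_to_close (h z z1) zc (iota_uniq _ _) _ => i.
  rewrite mem_iota/= -leqNgt => ki; rewrite avM avX.
  apply: (@le_lt_trans _ _ (w (x i) * w z ^+ k.+1)).
    by rewrite ler_wpM2l ?av_ge0// ler_wiXn2l ?av_ge0.
  by rewrite ltr_pM2r ?exprn_gt0.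
rewrite exprS mulrA ltr_pM2r ?exprn_gt0// => xz.
by move: hN; rewrite ltr_pdivlMr// mulrC => /lt_trans/(_ xz); rewrite ltxx.
Qed.

(** Kronecker substitution [z_i = t ^ (B ^ i)]: if [B] bounds the exponents of
    all the coefficients at least as large as [f l0], then in the one-variable
    series so obtained the coefficient of the image of [X^l0] is [f l0] plus
    strictly smaller terms. *)
Lemma sums_to0_mindex (g : nat) (f : mindex g -> L) :
  (forall z : 'I_g -> L, (forall i, w (z i) <= 1) ->
     sums_to w (fun l => f l * \prod_i z i ^+ l i) 0) ->
  forall l, f l = 0.
Proof.
move=> h l0; apply/eqP/negPn/negP => /eqP fl0.
have e0 := av_gt0 w fl0.
have h1 : sums_to w f 0.
  apply: eq_sums_to (h (fun=> 1) _) => [l|i]; last by rewrite av1.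
  by rewrite big1 ?mulr1// => i _; rewrite expr1n.
have [t _ ht] := null_family_tail (sums_to_null h1) e0.
pose B := (\max_(l <- t) \max_i l i).+1.
have tB l : l \in t -> forall i, (l i < B)%N.
  move=> lt i; rewrite ltnS.
  apply: leq_trans (leq_bigmax_seq (F := fun l : mindex g => \max_i l i) l lt isT).
  exact: leq_bigmax.
have l0t : l0 \in t by apply/negPn/negP => /ht; rewrite ltxx.
pose K (l : mindex g) := (\sum_i l i * B ^ i)%N.
have /choice[y hy] : forall k, exists y,
    sums_to w (fun l => if K l == k then f l else 0) y.
  move=> k; apply: null_sums_to => // e e0'.
  apply: sub_finite_set (sums_to_null h1 e0') => l /=.
  by case: ifP => // _; rewrite av0 leNgt e0'.
have y0 : forall k, y k = 0.
  apply: sums_to0_eq0 => z z1.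
  apply: (sums_to_fiber (K := K) (h (fun i => z ^+ (B ^ i)) _)) => [i|k].
    by rewrite avX exprn_ile1 ?av_ge0.
  rewrite mulrC; apply: eq_sums_to (sums_toZ (z ^+ k) (hy k)) => l.
  case: eqP => [<-|]; rewrite ?mulr0// mulrC; congr (_ * _).
  by rewrite -prodrXr; apply: eq_bigr => i _; rewrite -exprM mulnC.
have := sums_to_close (t := [:: l0]) (hy (K l0)) e0 isT.
rewrite big_seq1 eqxx y0 subr0 ltxx => H; apply/notF/H => l.
rewrite inE => ll0; case: eqP => [E|]; last by rewrite av0.
apply: ht; apply/negP => lt; case/eqP: ll0; apply/ffunP.
by apply: digits_inj E; exact: tB.
Qed.
End Identity.

(** * Power series in one variable *)

Section OneVariable.
Variables (R : realType) (L : fieldType) (w : absval R L).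

(** The Gauss norm of [x] for the radius [1 / rho] is at most [c]; it is
    submultiplicative. *)
Definition gauss_le (c rho : R) (x : nat -> L) := forall k, w (x k) <= c * rho ^+ k.

Definition evals_to (x : nat -> L) (z s : L) := sums_to w (fun k => x k * z ^+ k) s.

Section Bounds.
Variables (rho : R) (rho_ge0 : 0 <= rho).

Lemma gauss_le_ge0 c x : gauss_le c rho x -> 0 <= c.
Proof. by move=> /(_ 0%N); rewrite mulr1; apply: le_trans; exact: av_ge0. Qed.

Lemma gauss_le_smul c d x y :
  gauss_le c rho x -> gauss_le d rho y -> gauss_le (c * d) rho (smul x y).
Proof.
move=> hx hy k; have [c0 d0] := (gauss_le_ge0 hx, gauss_le_ge0 hy).
apply: av_sum_le => [|i _ _]; first by rewrite !mulr_ge0// exprn_ge0.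
rewrite avM -[X in _ ^+ X](subnKC (ltn_ord i : (i <= k)%N)) exprD mulrACA.
by rewrite ler_pM ?av_ge0.
Qed.

Lemma gauss_le_sexp c x k : gauss_le c rho x -> gauss_le (c ^+ k) rho (sexp x k).
Proof.
move=> hx; elim: k => [|k ih]; last by rewrite exprS; exact: gauss_le_smul.
case=> [|j]; first by rewrite /sexp/= av1 mulr1.
by rewrite /sexp/= av0 mul1r exprn_ge0.
Qed.

Lemma gauss_le_lin c a b : 0 <= c -> w a <= c * rho -> w b <= c ->
  gauss_le c rho (lin a b).
Proof.
move=> c0 ha hb [|[|k]]; rewrite /lin/= ?mulr1//.
by rewrite nth_nil av0 mulr_ge0// exprn_ge0.
Qed.

Lemma gauss_le_lin_inv c d : w c <= rho -> w d = 1 -> gauss_le 1 rho (lin_inv c d).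
Proof.
move=> hc hd k; rewrite avM avV !avX avN hd expr1n invr1 mulr1 mul1r.
by apply: lerXn2r; rewrite ?nnegrE ?av_ge0 ?rho_ge0.
Qed.

Lemma gauss_le_lin_exp c d e : w c <= rho -> w d = 1 ->
  gauss_le 1 rho (lin_exp c d e).
Proof.
move=> hc hd; case: e => k; rewrite /lin_exp.
  rewrite -(expr1n _ k); apply: gauss_le_sexp; apply: gauss_le_lin => //.
    by rewrite mul1r.
  by rewrite hd.
by rewrite -(expr1n _ k.+1); apply: gauss_le_sexp; exact: gauss_le_lin_inv.
Qed.

End Bounds.

Lemma evals_to_smul x y z s t :
  evals_to x z s -> evals_to y z t -> evals_to (smul x y) z (s * t).
Proof.
move=> hx hy; apply: (sums_to_fiber (K := fun ij => (ij.1 + ij.2)%N) (sums_to_mul hx hy)).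
move=> k; have -> : smul x y k * z ^+ k =
    \sum_(ij <- [seq (val i, (k - val i)%N) | i <- enum 'I_k.+1])
      (if (ij.1 + ij.2)%N == k then x ij.1 * z ^+ ij.1 * (y ij.2 * z ^+ ij.2) else 0).
  rewrite big_map big_enum/= mulr_suml; apply: eq_bigr => i _.
  have ik : (i <= k)%N by rewrite -ltnS.
  by rewrite subnKC// eqxx mulrACA -exprD subnKC.
apply: sums_to_seq => [|[i j] /= h].
  rewrite map_inj_uniq ?enum_uniq// => i j [ij _]; exact: val_inj.
case: eqP => // ijk; case/mapP: h.
have ik : (i < k.+1)%N by rewrite ltnS -ijk leq_addr.
by exists (Ordinal ik); rewrite ?mem_enum//= -ijk addKn.
Qed.

Lemma evals_to_sexp x z s k : evals_to x z s -> evals_to (sexp x k) z (s ^+ k).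
Proof.
move=> hx; elim: k => [|k ih]; last by rewrite exprS; exact: evals_to_smul.
have -> : s ^+ 0 = \sum_(j <- [:: 0%N]) sexp x 0 j * z ^+ j.
  by rewrite big_seq1 /sexp/= mulr1.
by apply: sums_to_seq => // -[|j]; rewrite /sexp//= mul0r.
Qed.

Lemma evals_to_lin c d z : evals_to (lin c d) z (c * z + d).
Proof.
have -> : c * z + d = \sum_(j <- [:: 0%N; 1%N]) lin c d j * z ^+ j.
  by rewrite big_cons big_seq1 /lin/= expr0 expr1 mulr1 addrC.
by apply: sums_to_seq => // -[|[|j]]; rewrite /lin//= nth_nil mul0r.
Qed.

Lemma av_lin_unit c d z : w c < 1 -> w d = 1 -> w z <= 1 -> w (c * z + d) = 1.
Proof.
move=> hc hd hz; rewrite -hd; apply: av_eq_lt.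
rewrite opprD addrCA subrr addr0 avN avM hd.
by apply: le_lt_trans hc; rewrite ler_piMr ?av_ge0.
Qed.

Lemma evals_to_lin_inv c d z : w c < 1 -> w d = 1 -> w z <= 1 ->
  evals_to (lin_inv c d) z (c * z + d)^-1.
Proof.
move=> hc hd hz e e0.
have [N hN] : exists N, w c ^+ N < e by apply: small_power; rewrite ?av_ge0.
have wl := av_lin_unit hc hd hz.
have d0 : d != 0 by apply/eqP => d0; move: hd; rewrite d0 av0 => /eqP; rewrite eq_sym oner_eq0.
have l0 : c * z + d != 0.
  by apply/eqP => l0; move: wl; rewrite l0 av0 => /eqP; rewrite eq_sym oner_eq0.
have termE k : lin_inv c d k * z ^+ k = (- (c * z) / d) ^+ k / d.
  by rewrite /lin_inv exprSr invfM -mulNr !exprMn exprVn; ring.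
have wq k : w ((- (c * z) / d) ^+ k) <= w c ^+ k.
  rewrite avX avM avV avN hd invr1 mulr1 avM.
  apply: lerXn2r; rewrite ?nnegrE ?mulr_ge0 ?av_ge0//.
  by rewrite ler_piMr ?av_ge0.
exists (iota 0 N); split; first exact: iota_uniq.
  move=> k; rewrite mem_iota/= -leqNgt => Nk.
  rewrite termE avM avV hd invr1 mulr1; apply: le_lt_trans hN.
  by apply: le_trans (wq k) _; rewrite ler_wiXn2l ?av_ge0// ltW.
have -> : \sum_(k <- iota 0 N) lin_inv c d k * z ^+ k - (c * z + d)^-1 =
    - ((- (c * z) / d) ^+ N / (c * z + d)).
  elim: N {hN} => [|N ih]; first by rewrite big_nil expr0; ring.
  rewrite -addn1 iotaD big_cat big_seq1/= addrAC ih termE add0n exprD expr1.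
  by field; rewrite l0 d0.
by rewrite avN avM avV wl invr1 mulr1; exact: le_lt_trans (wq N) hN.
Qed.

Lemma evals_to_lin_exp c d z e : w c < 1 -> w d = 1 -> w z <= 1 ->
  evals_to (lin_exp c d e) z ((c * z + d) ^ e).
Proof.
move=> hc hd hz; case: e => k; rewrite /lin_exp; first exact/evals_to_sexp/evals_to_lin.
by rewrite NegzE -exprnN -exprVn; apply/evals_to_sexp/evals_to_lin_inv.
Qed.

End OneVariable.

(** * The embeddings of the completions above p into L *)

Section Limits.
Variables (R : realType) (K : fieldType) (v : absval R K).

Lemma av_cvg_unique s x y : av_cvg v s x -> av_cvg v s y -> x = y.
Proof.
move=> hx hy; apply/eqP; rewrite -subr_eq0; apply/negPn/negP => /eqP xy.
have e0 := av_gt0 v xy; have [N hN] := hx _ e0; have [M hM] := hy _ e0.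
have := av_lt_add (hM _ (leq_maxr N M))
  (etrans (congr1 (fun z => z < _) (avN v _)) (hN _ (leq_maxl N M))).
by rewrite (_ : _ + _ = x - y) ?ltxx//; ring.
Qed.

Lemma av_cvgD s s' x x' :
  av_cvg v s x -> av_cvg v s' x' -> av_cvg v (fun k => s k + s' k) (x + x').
Proof.
move=> hx hy e e0; have [N hN] := hx _ e0; have [M hM] := hy _ e0.
exists (maxn N M) => k; rewrite geq_max => /andP[Nk Mk].
rewrite (_ : _ - _ = (s k - x) + (s' k - x')); last by ring.
by apply: av_lt_add; [exact: hN|exact: hM].
Qed.

Lemma av_cvgM s s' x x' :
  av_cvg v s x -> av_cvg v s' x' -> av_cvg v (fun k => s k * s' k) (x * x').
Proof.
move=> hx hy e e0; pose c := v x + v x' + 1.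
have c0 : 0 < c by rewrite ltr_wpDl// addr_ge0// av_ge0.
have xc : v x <= c by rewrite /c -addrA lerDl addr_ge0 ?av_ge0.
have x'c : v x' <= c by rewrite /c addrAC lerDr addr_ge0 ?av_ge0.
have c1 : 1 <= c by rewrite /c lerDr addr_ge0 ?av_ge0.
have [N hN] := hx _ (divr_gt0 e0 c0); have [M hM] := hy _ (divr_gt0 e0 c0).
have [M' hM'] := hy _ c0.
exists (maxn N (maxn M M')) => k; rewrite !geq_max => /and3P[Nk Mk M'k].
have step a b : v a < e / c -> v b <= c -> v (a * b) < e.
  move=> ha hb; rewrite avM -(divfK (lt0r_neq0 c0) e).
  apply: le_lt_trans (ler_wpM2l (av_ge0 _ _) hb) _.
  by rewrite ltr_pM2r.
rewrite (_ : _ - _ = (s k - x) * (s' k - x') + ((s k - x) * x' + (s' k - x') * x)); last by ring.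
apply: av_lt_add; first by apply: step; [exact: hN|exact/ltW/hM'].
by apply: av_lt_add; apply: step => //; [exact: hN|exact: hM].
Qed.

Lemma av_cvg_av s x : av_cvg v s x -> x <> 0 ->
  exists N, forall k, (N <= k)%N -> v (s k) = v x.
Proof.
move=> hx x0; have [N hN] := hx _ (av_gt0 v x0); exists N => k Nk.
by apply: av_eq_lt; rewrite av_subC hN.
Qed.

End Limits.

Lemma place_ext (R : realType) (F : fieldExtType rat) (u v : place R F) :
  u =1 v -> u = v.
Proof.
case: u v => -[u u1 u2 u3 u4] u5 [[v v1 v2 v3 v4] v5] /= /funext uv; subst v.
have e1 : u1 = v1 by exact: Prop_irrelevance.
have e2 : u2 = v2 by exact: Prop_irrelevance.
have e3 : u3 = v3 by exact: Prop_irrelevance.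
have e4 : u4 = v4 by exact: Prop_irrelevance.
by subst v1 v2 v3 v4; congr Place; exact: Prop_irrelevance.
Qed.

Section SigmaExt.
Variables (R : realType) (F : fieldExtType rat) (p : nat) (p_prime : prime p).
Variables (L : fieldType) (w : absval R L) (cw : av_complete w).
Hypothesis wp : w p%:R = p%:R^-1.
Variables (g : nat) (sigma : 'I_g -> {rmorphism F -> L}).
Local Notation above := (place_above R F p).
Implicit Types (i : 'I_g) (x y : Fp R F p).

(** The absolute value of [L] pulled back along [sigma i] is normalised at [p],
    hence is one of the places above [p]. *)
Section Pullback.
Variable i : 'I_g.
Let u (x : F) := w (sigma i x).
Let u_ge0 (x : F) : 0 <= u x. Proof. exact: av_ge0. Qed.
Let u_eq0 (x : F) : u x = 0 <-> x = 0.
Proof.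
rewrite /u; split=> [/av_eq0/eqP|->]; last by rewrite rmorph0 av0.
by rewrite fmorph_eq0 => /eqP.
Qed.
Let uM (x y : F) : u (x * y) = u x * u y. Proof. by rewrite /u rmorphM avM. Qed.
Let u_ultra (x y : F) : u (x + y) <= Num.max (u x) (u y).
Proof. by rewrite /u rmorphD; exact: av_ultra. Qed.

Lemma induced_place : exists v : above, induces w sigma i v.
Proof.
pose a := AbsVal u_ge0 u_eq0 uM u_ultra.
have ap : a p%:R = p%:R^-1 by rewrite /= /u rmorph_nat.
have h : exists2 l, prime l & a l%:R = l%:R^-1 by exists p.
by exists (exist _ (Place h) (introT eqP ap)).
Qed.
End Pullback.

Definition vplace i : above := projT1 (cid (induced_place i)).

Lemma vplaceP i : induces w sigma i (vplace i).
Proof. by rewrite /vplace; case: cid. Qed.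

Lemma induces_vplace i (v : above) : induces w sigma i v <-> v = vplace i.
Proof.
split=> [h|->]; last exact: vplaceP.
by apply: val_inj; apply: place_ext => x; rewrite -h vplaceP.
Qed.

Lemma sigma_ext_cvg i x :
  av_cvg w (fun k => sigma i (crep (x (vplace i)) k)) (sigma_ext w sigma i x).
Proof.
have hc : av_cauchy w (fun k => sigma i (crep (x (vplace i)) k)).
  move=> e e0; have [N hN] := @crep_cauchy _ _ _ (x (vplace i)) _ e0.
  by exists N => m k Nm Nk; rewrite -rmorphB vplaceP hN.
have [y hy] := cw hc; rewrite /sigma_ext; case: xgetP => [z _|/(_ y)].
  by case=> v /induces_vplace ->.
by case; exists (vplace i) => //; exact: vplaceP.
Qed.

(** The limit can be computed on any Cauchy sequence representing the component
    of [x]; choosing sums and products of representatives makes [sigma_ext] a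
    ring morphism. *)
Lemma sigma_ext_rep i x (s : cseq (vplace i)) :
  x (vplace i) = \pi_(completion (vplace i))%qT s ->
  av_cvg w (fun k => sigma i (csval s k)) (sigma_ext w sigma i x).
Proof.
move=> xs e e0; have [N hN] := sigma_ext_cvg i x e0.
have /pi_eq h : \pi_(completion (vplace i))%qT s =
   \pi_(completion (vplace i))%qT (repr (x (vplace i))) by rewrite reprK.
have [M hM] := h _ e0; exists (maxn N M) => k; rewrite geq_max => /andP[Nk Mk].
have := hM _ Mk; rewrite subr0 -(vplaceP i) => {}hM.
rewrite -[X in w X](subrKA (sigma i (crep (x (vplace i)) k))).
by apply: av_lt_add; [move: hM; rewrite rmorphB|exact: hN].
Qed.

Lemma sigma_extD i x y z : (forall v, z v = x v + y v) ->
  sigma_ext w sigma i z = sigma_ext w sigma i x + sigma_ext w sigma i y.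
Proof.
move=> h; have zE : z (vplace i) = \pi_(completion (vplace i))%qT
    (repr (x (vplace i)) + repr (y (vplace i))) by rewrite h -[in LHS](reprK (x _)) -[in LHS](reprK (y _)) -rmorphD.
apply: (av_cvg_unique (sigma_ext_rep zE)).
have := av_cvgD (sigma_ext_cvg i x) (sigma_ext_cvg i y).
move=> H e /H[N hN]; exists N => k /hN.
by rewrite -rmorphD.
Qed.

Lemma sigma_extM i x y z : (forall v, z v = x v * y v) ->
  sigma_ext w sigma i z = sigma_ext w sigma i x * sigma_ext w sigma i y.
Proof.
move=> h; have zE : z (vplace i) = \pi_(completion (vplace i))%qT
    (repr (x (vplace i)) * repr (y (vplace i))) by rewrite h -[in LHS](reprK (x _)) -[in LHS](reprK (y _)) -rmorphM.
apply: (av_cvg_unique (sigma_ext_rep zE)).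
have := av_cvgM (sigma_ext_cvg i x) (sigma_ext_cvg i y).
move=> H e /H[N hN]; exists N => k /hN.
by rewrite -rmorphM.
Qed.

Lemma sigma_ext_cinc i (c : F) x : x (vplace i) = cinc (vplace i) c ->
  sigma_ext w sigma i x = sigma i c.
Proof.
move=> h; apply: (av_cvg_unique (sigma_ext_rep h)) => e e0.
by exists 0%N => k _ /=; rewrite subrr av0.
Qed.

Lemma av_sigma_ext i x : w (sigma_ext w sigma i x) = cabs (vplace i) (x (vplace i)).
Proof.
have h := sigma_ext_cvg i x.
have [xi|/eqP x0] := eqVneq (x (vplace i)) 0.
  by rewrite (@sigma_ext_cinc i 0) xi ?rmorph0 ?av0.
have s0 : sigma_ext w sigma i x <> 0.
  move=> s0; apply: x0; apply: crep_eq0 => e e0.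
  rewrite s0 in h; have [N hN] := h _ e0; exists N => k /hN.
  by rewrite !subr0 vplaceP.
have [N hN] := av_cvg_av h s0.
apply/esym/cvg_lim => //; apply: cvg_near_cst; exists N => // k /= /hN <-.
by rewrite vplaceP.
Qed.

End SigmaExt.

(** * Values at an unramified place *)

Lemma cabs_cinc (R : realType) (K : fieldType) (v : absval R K) c :
  cabs v (cinc v c) = v c.
Proof. by rewrite /cabs/= cavE; apply/cvg_lim => //; apply: cvg_near_cst; exact: nearW. Qed.

Lemma cabs_value (R : realType) (K : fieldType) (v : absval R K) (x : completion v) :
  exists c, cabs v x = v c.
Proof.
have [[_ h]|[c [_ h [N hN]]]] := cav_dich (@crep_cauchy _ _ _ x); rewrite /cabs/= /cav h.
  by exists 0; rewrite av0.
by exists (crep x N); rewrite hN.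
Qed.

Section Uniformiser.
Variables (R : realType) (F : fieldExtType rat) (p : nat) (p_prime : prime p).
Variable v : place_above R F p.

Lemma place_p : v p%:R = p%:R^-1. Proof. exact/eqP/(valP v). Qed.

Lemma av_nat_le1 (K : fieldType) (u : absval R K) k : u k%:R <= 1.
Proof.
elim: k => [|k ih]; first by rewrite av0.
by rewrite -natr1; apply: le_trans (av_ultra _ _ _) _; rewrite ge_max ih av1 lexx.
Qed.

Lemma av_int_le1 (K : fieldType) (u : absval R K) (k : int) : u k%:~R <= 1.
Proof. by case: k => k; rewrite ?NegzE ?mulrNz ?avN -?pmulrn av_nat_le1. Qed.

Lemma place_nat_lt1 k : v k%:R < 1 -> (p %| k)%N.
Proof.
move=> vk; rewrite -[(_ %| _)%N]negbK -prime_coprime//; apply/negP => /coprimeP[|[a b] /= E].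
  exact: prime_gt0.
have vp : v p%:R < 1 by rewrite place_p invf_lt1 ?ltr1n ?prime_gt1// ltr0n prime_gt0.
have le (c : nat) x : v x < 1 -> v (c%:R * x) < 1.
  by move=> x1; rewrite avM; apply: le_lt_trans x1; rewrite ler_piMl ?av_ge0// av_nat_le1.
have : v (1 : F) < 1.
  rewrite (_ : 1 = a%:R * p%:R - b%:R * k%:R :> F); last first.
    rewrite -!natrM -natrB ?E//; last by rewrite ltnW// -subn_gt0 E.
  by apply: av_lt_add; rewrite ?avN; exact: le.
by rewrite av1 ltxx.
Qed.

(** By unramifiedness the value is that of a rational number, which is divisible
    by [p] as soon as it is below 1. *)
Lemma place_lt1 (unram : unramified R F p) (x : F) : v x < 1 -> v x <= p%:R^-1.
Proof.
have [->|x0] := eqVneq x 0; first by rewrite av0 invr_ge0.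
have [q ->] := unram v x x0; rewrite /ratr avM avV => q1.
have dq : v (denq q)%:~R = 1 \/ v (denq q)%:~R < 1.
  by have := av_int_le1 v (denq q); rewrite le_eqVlt => /orP[/eqP|]; tauto.
have abs (k : int) : v k%:~R = v `|k|%N%:R.
  by case: k => k; rewrite ?NegzE ?mulrNz ?avN -?pmulrn.
have np : (p %| `|numq q|)%N.
  apply: place_nat_lt1; rewrite -abs; apply: le_lt_trans q1.
  rewrite ler_peMr ?av_ge0// invf_ge1 ?av_int_le1// av_gt0//.
  by apply/eqP; rewrite -(rmorph_int (in_alg F)) fmorph_eq0 intr_eq0.
have nd : ~~ (p %| `|denq q|)%N.
  have := coprime_num_den q; rewrite -(divnK np) coprimeMl => /andP[_].
  by rewrite prime_coprime.
case: dq => [->|]; last by rewrite abs => /place_nat_lt1; rewrite (negbTE nd).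
rewrite invr1 mulr1 abs -(divnK np) natrM avM place_p.
by rewrite ler_piMl ?invr_ge0// av_nat_le1.
Qed.

Lemma av_uniformiser (unram : unramified R F p) pi :
  uniformiser (cabs v) pi -> cabs v pi = p%:R^-1.
Proof.
move=> hpi; apply/eqP; rewrite eq_le; apply/andP; split.
  have : cabs v pi < 1 by apply/hpi; exists 1; rewrite ?mulr1//; change (cabs v 1 <= 1); rewrite av1.
  by have [c ->] := cabs_value pi; exact: place_lt1.
have : cabs v p%:R < 1.
  rewrite -(rmorph_nat (cinc v)) cabs_cinc place_p.
  by rewrite invf_lt1 ?ltr1n ?prime_gt1// ltr0n prime_gt0.
case/hpi => y y1 /(congr1 (cabs v)); rewrite avM.
rewrite -{1}(rmorph_nat (cinc v)) cabs_cinc place_p => ->.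
by rewrite ler_piMr ?av_ge0.
Qed.

End Uniformiser.

(** * The weight action on the Tate algebra *)

Lemma null_pair (R : realType) (L : fieldType) (w : absval R L) (I J : choiceType)
    (f : I -> L) (u : I * J -> L) :
  null_family w f -> (forall i j, w (u (i, j)) <= w (f i)) ->
  (forall i, null_family w (fun j => u (i, j))) -> null_family w u.
Proof.
move=> hf huf hu e e0.
apply: sub_finite_set (_ : finite_set (\bigcup_(i in [set i | e <= w (f i)])
  [set (i, j) | j in [set j | e <= w (u (i, j))]])).
  move=> [i j] /= ue; exists i; first exact: le_trans ue (huf i j).
  by exists j.
by apply: bigcup_finite => [|i _]; [exact: hf|apply/finite_image/hu].
Qed.

Section WeightAction.
Variables (R : realType) (F : fieldExtType rat) (p : nat) (p_prime : prime p).
Variables (L : fieldType) (w : absval R L) (cw : av_complete w).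
Hypothesis wp : w p%:R = p%:R^-1.
Variables (g : nat) (sigma : 'I_g -> {rmorphism F -> L}).
Variables (nn vv : 'I_g -> int) (psi : Fp R F p -> L).
Local Notation above := (place_above R F p).
Local Notation mindex := (mindex g).
Local Notation mat i gam := (sigma_mx w sigma i gam).
Local Notation act := (weight_act w sigma nn vv psi).
Implicit Types (gam : M2Fp R F p) (z : 'I_g -> L) (f : mindex -> L).

Definition lower_right gam : Fp R F p := fun v => gam v 1 1.

Lemma av_sigma_mx i gam k l :
  w (mat i gam k l) = cabs (vplace p_prime wp sigma i) (gam (vplace p_prime wp sigma i) k l).
Proof. by rewrite mxE (av_sigma_ext p_prime cw wp). Qed.

(** The image is measured by the Gauss norm of radius [1 / rho i] in the variable
    [X_i]; [c i] bounds the norm of [a_i X_i + b_i]. *)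
Lemma monomial_act_le gam (c rho : 'I_g -> R) l m :
  (forall i, 0 <= c i) -> (forall i, 0 <= rho i) -> w (psi (lower_right gam)) <= 1 ->
  (forall i, [/\ w (mat i gam 0 0) <= c i * rho i, w (mat i gam 0 1) <= c i,
     w (mat i gam 1 0) <= rho i & w (mat i gam 1 1) = 1]) ->
  w (monomial_act w sigma nn vv psi gam l m) <=
    \prod_i (w (\det (mat i gam)) ^ vv i * (c i ^+ l i * rho i ^+ m i)).
Proof.
move=> c0 r0 psi1 h; rewrite avM -[leRHS]mul1r ler_pM ?av_ge0// av_prod.
apply: ler_prod => i _; rewrite av_ge0/= avM avXz ler_wpM2l ?exprz_ge0 ?av_ge0//.
have [h00 h01 h10 h11] := h i; rewrite -[c i ^+ _]mul1r.
apply: gauss_le_smul => //; first exact: gauss_le_lin_exp.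
by apply: gauss_le_sexp => //; exact: gauss_le_lin.
Qed.

Definition in_iwahori (A : 'M[L]_2) :=
  [/\ forall k l, w (A k l) <= 1, w (A 1 0) < 1, w (A 1 1) = 1 & w (\det A) = 1].

Definition moebius (A : 'M[L]_2) (z : L) := (A 0 0 * z + A 0 1) / (A 1 0 * z + A 1 1).

(** The factor by which [X^l . gam] differs from the value of [X^l] at the image
    under [gam] of the point; it depends on [gam] and the point only, which is
    what makes the action multiplicative. *)
Definition cocycle gam z :=
  psi (lower_right gam) * \prod_i (\det (mat i gam) ^ vv i *
    (mat i gam 1 0 * z i + mat i gam 1 1) ^ nn i).

Lemma av_moebius_le1 A (x : L) : in_iwahori A -> w x <= 1 -> w (moebius A x) <= 1.
Proof.
move=> [h1 h10 h11 _] x1; rewrite avM avV (av_lin_unit h10 h11 x1) invr1 mulr1.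
apply: le_trans (av_ultra _ _ _) _; rewrite ge_max h1 avM andbT.
by rewrite mulr_ile1 ?av_ge0.
Qed.

Lemma lin_neq0 A (x : L) : in_iwahori A -> w x <= 1 -> A 1 0 * x + A 1 1 != 0.
Proof.
move=> [_ h10 h11 _] x1; apply/eqP => h; have := av_lin_unit h10 h11 x1.
by rewrite h av0 => /eqP; rewrite eq_sym oner_eq0.
Qed.

Lemma monomial_act_sums gam l z : (forall i, in_iwahori (mat i gam)) ->
  (forall i, w (z i) <= 1) ->
  sums_to w (fun m => monomial_act w sigma nn vv psi gam l m * \prod_i z i ^+ m i)
    (cocycle gam z * \prod_i moebius (mat i gam) (z i) ^+ l i).
Proof.
move=> hg hz; rewrite /cocycle -mulrA.
pose A i := mat i gam.
have h i : sums_to w (fun k => \det (A i) ^ vv i *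
    smul (lin_exp (A i 1 0) (A i 1 1) (nn i - (l i)%:Z))
         (sexp (lin (A i 0 0) (A i 0 1)) (l i)) k * z i ^+ k)
    (\det (A i) ^ vv i * ((A i 1 0 * z i + A i 1 1) ^ (nn i - (l i)%:Z) *
       (A i 0 0 * z i + A i 0 1) ^+ l i)).
  have [_ h10 h11 _] := hg i.
  have := evals_to_smul (evals_to_lin_exp (nn i - (l i)%:Z) h10 h11 (hz i))
    (evals_to_sexp (l i) (evals_to_lin w (A i 0 0) (A i 0 1) (z i))).
  move=> /(sums_toZ (\det (A i) ^ vv i)); apply: eq_sums_to => k.
  by rewrite mulrA.
have := sums_toZ (psi (lower_right gam)) (sums_to_prod h).
rewrite (_ : \prod_i (\det (A i) ^ vv i * _) = (\prod_i (\det (A i) ^ vv i *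
    (A i 1 0 * z i + A i 1 1) ^ nn i)) * \prod_i moebius (A i) (z i) ^+ l i).
  by apply: eq_sums_to => m; rewrite /monomial_act -mulrA -big_split.
rewrite -big_split/=; apply: eq_bigr => i _; rewrite -mulrA; congr (_ * _).
rewrite /moebius exprMn exprVn. rewrite expfzDr; last exact: (lin_neq0 (hg i) (hz i)).
by rewrite -invr_expz -mulrA; congr (_ * _); rewrite mulrC.
Qed.

Section Tate.
Variables (gam : M2Fp R F p).
Hypotheses (psi1 : w (psi (lower_right gam)) <= 1).
Hypothesis gam_iw : forall i, in_iwahori (mat i gam).

Lemma monomial_act_le1 l m : w (monomial_act w sigma nn vv psi gam l m) <= 1.
Proof.
apply: le_trans (@monomial_act_le gam (fun=> 1) (fun=> 1) l m _ _ psi1 _) _ => //.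
- by move=> i; have [h1 h10 h11 _] := gam_iw i; split; rewrite ?mulr1//; exact: ltW.
- rewrite big1// => i _; have [_ _ _ ->] := gam_iw i.
  by rewrite exp1rz !expr1n !mulr1.
Qed.

Lemma tate_eval f z : tate w f -> (forall i, w (z i) <= 1) ->
  exists s, sums_to w (fun l => f l * \prod_i z i ^+ l i) s.
Proof.
move=> hf hz; apply: null_sums_to => // e e0; apply: sub_finite_set (hf _ e0) => l /=.
move=> h; apply: le_trans h _; rewrite avM ler_piMr ?av_ge0// av_prod.
by apply: prodr_ile1 => i _; rewrite av_ge0 avX exprn_ile1 ?av_ge0.
Qed.

(** The value at [z] of the transform of [f] is the value of [f] at the image of
    [z], up to the cocycle: sum the double family
    [f l * (coefficient of X^m in X^l . gam) * z ^ m] in both orders. *)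
Lemma weight_act_eval f z s : tate w f -> (forall i, w (z i) <= 1) ->
  sums_to w (fun l => f l * \prod_i moebius (mat i gam) (z i) ^+ l i) s ->
  sums_to w (fun m => act f gam m * \prod_i z i ^+ m i) (cocycle gam z * s).
Proof.
move=> hf hz hs.
pose u (lm : mindex * mindex) := f lm.1 * monomial_act w sigma nn vv psi gam lm.1 lm.2.
have row l z' : (forall i, w (z' i) <= 1) -> sums_to w
    (fun m => u (l, m) * \prod_i z' i ^+ m i)
    (f l * (cocycle gam z' * \prod_i moebius (mat i gam) (z' i) ^+ l i)).
  move=> hz'; apply: eq_sums_to (sums_toZ (f l) (monomial_act_sums l gam_iw hz')).
  by move=> m; rewrite mulrA.
have nu : null_family w u.
  apply: (null_pair hf) => [l m|l].
    by rewrite avM ler_piMr ?av_ge0// monomial_act_le1.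
  apply: (@sums_to_null _ _ _ _ _ _); apply: eq_sums_to (row l (fun=> 1) _).
    by move=> m; rewrite big1 ?mulr1// => i _; rewrite expr1n.
  by move=> i; rewrite av1.
have zle m : w (\prod_i z i ^+ (m : mindex) i) <= 1.
  rewrite av_prod; apply: prodr_ile1 => i _.
  by rewrite av_ge0 avX exprn_ile1 ?av_ge0.
have [S hS] : exists S, sums_to w (fun lm => u lm * \prod_i z i ^+ lm.2 i) S.
  apply: null_sums_to => // e e0; apply: sub_finite_set (nu _ e0) => lm /= h.
  by apply: le_trans h _; rewrite avM ler_piMr ?av_ge0.
have -> : cocycle gam z * s = S.
  apply: sums_to_unique (sums_to_pair1 hS (fun l => row l z hz)).
  by apply: eq_sums_to (sums_toZ (cocycle gam z) hs) => l; rewrite mulrCA.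
apply: (sums_to_pair2 hS) => m.
have [t ht] : exists t, sums_to w (fun l => u (l, m)) t.
  apply: null_sums_to => // e e0; apply: sub_finite_set (hf _ e0) => l /= h.
  by apply: le_trans h _; rewrite avM ler_piMr ?av_ge0// monomial_act_le1.
rewrite /weight_act (series_sumE ht) mulrC.
by apply: eq_sums_to (sums_toZ _ ht) => l; rewrite mulrC.
Qed.

Lemma weight_act_tate f : tate w f -> tate w (act f gam).
Proof.
move=> hf; have h1 (i : 'I_g) : w 1 <= 1 by rewrite av1.
have hz i : w (moebius (mat i gam) 1) <= 1 by apply: av_moebius_le1; rewrite ?av1.
have [s hs] := tate_eval hf hz.
apply: (sums_to_null (y := cocycle gam (fun=> 1) * s)).
apply: eq_sums_to (weight_act_eval hf h1 hs) => m.
by rewrite big1 ?mulr1// => i _; rewrite expr1n.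
Qed.

Lemma weight_act_le f (c : R) m : 0 <= c -> (forall l, w (f l) <= c) ->
  w (act f gam m) <= c.
Proof.
move=> c0 hf; apply: series_sum_le => // l; rewrite avM.
by apply: le_trans (hf l); rewrite ler_piMr ?av_ge0// monomial_act_le1.
Qed.

End Tate.

(** Elements of the Tate algebra are determined by their values at integral
    points. *)
Lemma tate_ext f f' : tate w f -> tate w f' ->
  (forall z, (forall i, w (z i) <= 1) -> exists s,
     sums_to w (fun l => f l * \prod_i z i ^+ l i) s /\
     sums_to w (fun l => f' l * \prod_i z i ^+ l i) s) -> f = f'.
Proof.
move=> hf hf' h; apply/funext => l; apply/eqP; rewrite -subr_eq0; apply/eqP.
have p0 : 0 < w p%:R by rewrite wp invr_gt0 ltr0n prime_gt0.
have p1 : w p%:R < 1 by rewrite wp invf_lt1 ?ltr1n ?prime_gt1// ltr0n prime_gt0.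
apply: (sums_to0_mindex p0 p1 cw (f := fun l => f l - f' l)) => z hz.
have [s [hs hs']] := h z hz; rewrite -(subrr s).
by apply: eq_sums_to (sums_toB hs hs') => k; rewrite mulrBl.
Qed.

End WeightAction.

(** * A number bounded at all places is an integer *)

Section ChevalleyExtension.
Variables (F : fieldType) (y : F) (y_neq0 : y != 0).

Definition is_subring (A : set F) :=
  [/\ A 1, forall a b, A a -> A b -> A (a - b) & forall a b, A a -> A b -> A (a * b)].

Section Subring.
Variables (A : set F) (hA : is_subring A).
Lemma subring0 : A 0.
Proof. by have [A1 AB _] := hA; rewrite -(subrr 1); exact: AB. Qed.
Lemma subringN a : A a -> A (- a).
Proof. by move=> ?; have [_ AB _] := hA; rewrite -sub0r; apply: AB => //; exact: subring0. Qed.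
Lemma subringD a b : A a -> A b -> A (a + b).
Proof. by move=> Aa Ab; have [_ AB _] := hA; rewrite -[b]opprK; apply/AB/subringN. Qed.
Lemma subring_sum (I : Type) (s : seq I) (P : pred I) (x : I -> F) :
  (forall i, P i -> A (x i)) -> A (\sum_(i <- s | P i) x i).
Proof. by move=> h; apply: big_ind => //; [exact: subring0|exact: subringD]. Qed.
Lemma subringX a k : A a -> A (a ^+ k).
Proof.
have [A1 _ AM] := hA; move=> Aa; elim: k => [//|k ih].
by rewrite exprS; exact: AM.
Qed.
Lemma subring_int (k : int) : A k%:~R.
Proof.
have [A1 _ _] := hA; have nat_in n : A n%:R.
  by elim: n => [|n ih]; [exact: subring0|rewrite -natr1; exact: subringD].
by case: k => k; rewrite ?NegzE ?mulrNz -?pmulrn//; exact: subringN.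
Qed.

Definition adjoin (z : F) : set F :=
  [set t | exists2 q : {poly F}, (forall i, A q`_i) & t = q.[z]].

Lemma adjoin_subring z : is_subring (adjoin z).
Proof.
have [A1 AB AM] := hA; split.
- exists 1; last by rewrite hornerC.
  by move=> i; rewrite coef1; case: eqP => // _; exact: subring0.
- move=> _ _ [q hq ->] [r hr ->]; exists (q - r); last by rewrite hornerD hornerN.
  by move=> i; rewrite coefB; exact: AB.
- move=> _ _ [q hq ->] [r hr ->]; exists (q * r); last by rewrite hornerM.
  by move=> i; rewrite coefM; apply: subring_sum => j _; exact: AM.
Qed.

Lemma sub_adjoin z : A `<=` adjoin z.
Proof.
move=> a Aa; exists a%:P; last by rewrite hornerC.
by move=> i; rewrite coefC; case: eqP => // _; exact: subring0.
Qed.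

Lemma mem_adjoin z : adjoin z z.
Proof.
have [A1 _ _] := hA; exists 'X; last by rewrite hornerX.
by move=> i; rewrite coefX; case: eqP => // _; exact: subring0.
Qed.

Hypotheses (Ay : A y) (nA : ~ A y^-1).

(** Such a relation says that [y] is invertible in [A[z]]. The number of terms is
    recorded because relations for [z] and [z^-1] shorten each other. *)
Definition unit_relation n (z : F) := exists2 a : nat -> F,
  (forall i, A (a i)) & 1 = \sum_(i < n) y * a i * z ^+ i.

Lemma unit_relation_leq n m z : (n <= m)%N -> unit_relation n z -> unit_relation m z.
Proof.
move=> nm [a ha E]; exists (fun i => if (i < n)%N then a i else 0).
  by move=> i; case: ifP => // _; exact: subring0.
rewrite (big_ord_widen m (fun i => y * a i * z ^+ i) nm) in E.
rewrite E big_mkcond; apply: eq_bigr => i _; case: ifP => //.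
by rewrite mulr0 mul0r.
Qed.

(** The relation for [z^-1] expresses [z ^ n * (1 - y * b 0)] by lower powers of
    [z]; substituted in [1 - y * b 0] times the relation for [z], it removes the
    leading term. *)
Lemma unit_relation_step n z : (0 < n)%N -> z != 0 ->
  unit_relation n.+1 z -> unit_relation n.+1 z^-1 -> unit_relation n z.
Proof.
have [A1 AB AM] := hA.
case: n => // n _ z0 [a ha Ea] [b hb Eb].
exists (fun i => (1 - y * b 0%N) * a i + (if i == 0%N then b 0%N else 0)
  + y * a n.+1 * b (n.+1 - i)%N) => [i|].
  apply: subringD; last by apply: (AM) => //; exact: AM.
  apply: subringD; first by apply: (AM) => //; apply: (AB) => //; exact: AM.
  by case: eqP => // _; exact: subring0.
have Ez : z ^+ n.+1 * (1 - y * b 0%N) = \sum_(i < n.+1) y * b (n.+1 - i)%N * z ^+ i.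
  have -> : 1 - y * b 0%N = \sum_(i < n.+1) y * b i.+1 * z^-1 ^+ i.+1.
    by rewrite Eb big_ord_recl expr0 mulr1 addrAC subrr add0r.
  rewrite mulr_sumr (reindex_inj rev_ord_inj); apply: eq_bigr => i _ /=.
  have ile : (i <= n.+1)%N by exact: ltnW.
  rewrite subSS -subSn; last by rewrite -ltnS.
  rewrite -{1}(subnK ile) exprD exprVn.
  by field; rewrite expf_neq0.
have Sa : \sum_(i < n.+1) y * a i * z ^+ i = 1 - y * a n.+1 * z ^+ n.+1.
  by rewrite [in RHS]Ea [in RHS]big_ord_recr/= addrK.
apply/esym; rewrite (eq_bigr (fun i : 'I_n.+1 => (1 - y * b 0%N) * (y * a i * z ^+ i)
  + (if i == 0%N :> nat then y * b 0%N else 0)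
  + y * a n.+1 * (y * b (n.+1 - i)%N * z ^+ i))) => [|i _]; last first.
  by case: eqP => [->|_]; ring.
rewrite !big_split/= -!mulr_sumr Sa -Ez -big_mkcond /= (big_pred1 ord0) => [|i]; last by [].
by ring.
Qed.

(** Relations of the same length for [z] and [z^-1] can be shortened in turn
    until [1 = y * a], which would put [y^-1] in [A]. *)
Lemma valuation_step z : z != 0 -> ~ (adjoin z y^-1 /\ adjoin z^-1 y^-1).
Proof.
have [A1 AB AM] := hA; move=> z0 [[q hq Eq] [r hr Er]].
have rel (s : {poly F}) t : (forall i, A s`_i) -> y^-1 = s.[t] ->
    unit_relation (size s) t.
  move=> hs E; exists (fun i => s`_i) => //.
  rewrite -(divff y_neq0) E horner_coef mulr_sumr.
  by apply: eq_bigr => i _; rewrite mulrA.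
have : exists n, unit_relation n z /\ unit_relation n z^-1.
  exists (maxn (size q) (size r)).
  split; [apply: unit_relation_leq (rel q z hq Eq)|apply: unit_relation_leq (rel r _ hr Er)].
    exact: leq_maxl.
  exact: leq_maxr.
case; elim=> [|[|n] ih] [h h'].
- by have [a _ /eqP] := h; rewrite big_ord0 oner_eq0.
- have [a ha /esym] := h; rewrite big_ord1 mulr1 => E; apply: nA.
  by rewrite -[y^-1]mulr1 -E mulKf.
- apply: ih; split; first exact: unit_relation_step.
  by apply: unit_relation_step => //; rewrite ?invr_eq0 ?invrK.
Qed.

End Subring.

(** By Zorn's lemma there is a maximal subring containing [y] but not its inverse;
    if it contained neither [z] nor [z^-1], both could be adjoined only at the
    price of inverting [y]. *)
Lemma exists_valuation_ring (B : set F) : is_subring B -> B y -> ~ B y^-1 ->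
  exists V, [/\ is_subring V, V y, ~ V y^-1 & forall z, V z \/ V z^-1].
Proof.
move=> hB By nB.
(* the empty set is admitted for the sake of empty chains *)
pose P (A : set F) := A = set0 \/ [/\ is_subring A, A y & ~ A y^-1].
have chain (G : set (set F)) : G `<=` P -> total_on G subset ->
    P (\bigcup_(X in G) X).
  move=> GP Gt; have [[A0 [GA0 nA0]]|nG] := pselect (exists A, G A /\ A <> set0); last first.
    left; apply/seteqP; split=> // x [X GX Xx]; apply: nG; exists X; split=> // X0.
    by rewrite X0 in Xx.
  have sub A x : G A -> A x -> [/\ is_subring A, A y & ~ A y^-1].
    by move=> /GP[->|].
  have [x0 A0x0] : exists x, A0 x by apply/set0P/eqP.
  have [[A01 _ _] A0y _] := sub _ _ GA0 A0x0.
  have join x x' : (\bigcup_(X in G) X) x -> (\bigcup_(X in G) X) x' ->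
      exists A, [/\ G A, A x & A x'].
    move=> [X GX Xx] [X' GX' Xx']; case: (Gt X X' GX GX') => h.
      by exists X'; split=> //; exact: h.
    by exists X; split=> //; exact: h.
  right; split; last by case=> X GX /[dup] Xy /(sub _ _ GX)[_ _].
    split; first by exists A0.
      move=> x x' hx hx'; have [A [GA Ax Ax']] := join _ _ hx hx'.
      by exists A => //; have [[_ AB _] _ _] := sub _ _ GA Ax; exact: AB.
    move=> x x' hx hx'; have [A [GA Ax Ax']] := join _ _ hx hx'.
    by exists A => //; have [[_ _ AM] _ _] := sub _ _ GA Ax; exact: AM.
  by exists A0.
have [V [PV maxV]] := Zorn_bigcup chain.
have [V0|[hV Vy nV]] := PV.
  exfalso; apply: (maxV B); last by right.
  rewrite V0; split; first exact: sub0set.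
  by move=> /(_ y By).
exists V; split=> // z.
have [->|z0] := eqVneq z 0; first by left; exact: subring0.
have ext t : ~ V t -> adjoin V t y^-1.
  move=> nVt; apply: contrapT => nadj; apply: (maxV (adjoin V t)); last first.
    right; split=> //; [exact: adjoin_subring|exact: sub_adjoin].
  split; first exact: sub_adjoin.
  by move=> /(_ t (mem_adjoin hV t)).
apply: contrapT => /not_orP[nz nz']; apply: (valuation_step hV Vy nV z0).
by split; exact: ext.
Qed.

End ChevalleyExtension.

Section RankOne.
Variables (R : realType) (F : fieldExtType rat) (V : set F) (hV : is_subring V).
Hypothesis Vdich : forall z, V z \/ V z^-1.

Let V1 : V 1. Proof. by case: hV. Qed.
Let VM a b : V a -> V b -> V (a * b). Proof. by case: hV => _ _; apply. Qed.

Definition vunit (x : F) := [/\ x != 0, V x & V x^-1].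
(** The maximal ideal of [V]. *)
Definition vsmall (x : F) := x = 0 \/ ~ V x^-1.

Lemma vunitM x z : vunit x -> vunit z -> vunit (x * z).
Proof.
case=> x0 Vx Vx' [z0 Vz Vz']; split; first by rewrite mulf_neq0.
  exact: VM.
by rewrite invfM; exact: VM.
Qed.

Lemma vunitV x : vunit x -> vunit x^-1.
Proof. by case=> x0 Vx Vx'; split; rewrite ?invr_eq0// invrK. Qed.

Lemma vunitX x k : vunit x -> vunit (x ^+ k).
Proof.
move=> ux; elim: k => [|k ih]; last by rewrite exprS; exact: vunitM.
by split; rewrite ?oner_eq0// invr1.
Qed.

Lemma vunitN x : vunit x -> vunit (- x).
Proof.
by case=> x0 Vx Vx'; split; rewrite ?oppr_eq0 ?invrN//; exact: subringN.
Qed.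

Lemma vsmallV x : vsmall x -> V x.
Proof. by case=> [->|nx]; [exact: subring0|case: (Vdich x)]. Qed.

Lemma vsmallM x z : vsmall x -> V z -> vsmall (x * z).
Proof.
case=> [->|nx] Vz; first by left; rewrite mul0r.
have [->|z0] := eqVneq z 0; first by left; rewrite mulr0.
by right => h; apply: nx; rewrite -[x^-1](mulfK z0) mulrAC -invfM// mulrC; exact: VM.
Qed.

Lemma vsmallD x z : vsmall x -> vsmall z -> vsmall (x + z).
Proof.
move=> sx sz.
have [->|x0] := eqVneq x 0; first by rewrite add0r.
have [->|z0] := eqVneq z 0; first by rewrite addr0.
case: (Vdich (z / x)) => h.
  by rewrite -[x + z](_ : x * (1 + z / x) = _); [apply: vsmallM => //; exact: subringD|field].
rewrite invfM invrK mulrC in h.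
by rewrite -[x + z](_ : z * (1 + x / z) = _); [apply: vsmallM => //; exact: subringD|field].
Qed.

Lemma vsmallN x : vsmall x -> vsmall (- x).
Proof. by move=> sx; rewrite -mulrN1; apply: vsmallM => //; exact: subringN. Qed.

Lemma vunit_not_small x : vunit x -> ~ vsmall x.
Proof. by case=> /eqP x0 _ Vx' []. Qed.

Lemma vunitP x : V x -> ~ vsmall x -> vunit x.
Proof.
by move=> Vx /not_orP[/eqP x0 /contrapT Vx']; split.
Qed.

Lemma vunitD x z : vunit x -> vsmall z -> vunit (x + z).
Proof.
move=> ux sz; apply: vunitP => [|sxz].
  by apply: subringD => //; [case: ux|exact: vsmallV].
apply: (vunit_not_small ux); rewrite -(addrK z x).
by apply: vsmallD => //; exact: vsmallN.
Qed.

Lemma nonunit_small x : x != 0 -> ~ vunit x -> vsmall x \/ vsmall x^-1.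
Proof.
move=> x0 nu; have [Vx'|] := pselect (V x^-1); last by left; right.
by right; right; rewrite invrK => Vx; apply: nu.
Qed.

(** If no ratio of two terms is a unit, their valuations are distinct and the sum
    has the valuation of the largest one. *)
Lemma dominant_term (I : eqType) (s : seq I) (t : I -> F) : s != [::] -> uniq s ->
  (forall i, i \in s -> t i != 0) ->
  (forall i j, i \in s -> j \in s -> i != j -> ~ vunit (t i / t j)) ->
  exists2 i, i \in s & vunit ((\sum_(i <- s) t i) / t i).
Proof.
elim: s => // y s ih _ /= /andP[ys us] t0 nu.
have ty : t y != 0 by rewrite t0 ?mem_head.
have u1 : vunit 1 by split; rewrite ?oner_eq0// invr1.
have [s0|s0] := eqVneq s [::].
  by exists y; rewrite ?mem_head// s0 big_seq1 divff.
have [||i is_ ui] := ih s0 us.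
- by move=> i is_; rewrite t0// inE is_ orbT.
- by move=> i j is_ js; apply: nu; rewrite inE ?is_ ?js orbT.
have ti : t i != 0 by rewrite t0// inE is_ orbT.
have yi : y != i by apply: contraNneq ys => ->.
have nuyi := nu _ _ (mem_head y s) (mem_behead (s := y :: s) is_) yi.
rewrite big_cons; case: (nonunit_small _ nuyi); rewrite ?mulf_neq0 ?invr_eq0// => sm.
  by exists i; [rewrite inE is_ orbT|rewrite mulrDl addrC; exact: vunitD].
exists y; first exact: mem_head.
rewrite (_ : _ / _ = 1 + (t y / t i)^-1 * ((\sum_(j <- s) t j) / t i)); last first.
  by field; rewrite ty ti.
by apply: vunitD => //; apply: vsmallM => //; case: ui.
Qed.

Lemma nat_neq0 n : (0 < n)%N -> n%:R != 0 :> F.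
Proof. by move=> n0; rewrite -(rmorph_nat (in_alg F)) fmorph_eq0 pnatr_eq0 -lt0n. Qed.

(** Otherwise the terms of an algebraic equation for [z] would have distinct
    valuations, and their sum could not vanish. This makes the value group of [V]
    commensurable with that of the rationals, hence of rank one. *)
Lemma rational_power z : z != 0 ->
  exists m (r : rat), [/\ (0 < m)%N, r != 0 & vunit (z ^+ m * in_alg F r)].
Proof.
move=> z0; apply: contrapT => H.
have nu m (r : rat) : (0 < m)%N -> r != 0 -> ~ vunit (z ^+ m * in_alg F r).
  by move=> m0 r0 h; apply: H; exists m, r.
have [q qm /rootP qz] := algebraics_fundamentals.alg_integral z.
pose t i := in_alg F q`_i * z ^+ i : F.
pose s := [seq i <- iota 0 (size q) | q`_i != 0].
have sP i : i \in s -> q`_i != 0 by rewrite mem_filter => /andP[].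
have t0 i : i \in s -> t i != 0.
  by move=> /sP qi; rewrite mulf_neq0 ?expf_neq0// fmorph_eq0.
have st : \sum_(i <- s) t i = 0.
  rewrite big_filter -[RHS]qz horner_coef size_map_poly -(big_mkord xpredT
    (fun i => (map_poly (in_alg F) q)`_i * z ^+ i)).
  rewrite big_mkcond /index_iota subn0; apply: eq_bigr => i _.
  rewrite coef_map; have [->|_] := eqVneq; last by [].
  by rewrite /= scale0r mul0r.
have s0 : s != [::].
  rewrite -has_filter; apply/hasP; exists (size q).-1.
    by rewrite mem_iota/= prednK// size_poly_gt0 monic_neq0.
  by rewrite -lead_coefE (monicP qm) oner_eq0.
have us : uniq s by rewrite filter_uniq ?iota_uniq.
have [|i _] := dominant_term s0 us t0; last by rewrite st mul0r => -[/eqP].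
move=> i j is_ js; wlog ij : i j is_ js / (j < i)%N => [W|_ u].
  rewrite neq_ltn => /orP[ij|ji] u; last by apply: (W i j); rewrite // gtn_eqF.
  by apply: (W j i js is_ ij); [rewrite gtn_eqF|rewrite -invf_div; exact: vunitV].
have [qi qj] := (sP _ is_, sP _ js).
apply: (nu (i - j)%N (q`_i / q`_j)); rewrite ?subn_gt0 ?mulf_neq0 ?invr_eq0//.
have zi : z ^+ i = z ^+ (i - j) * z ^+ j by rewrite -exprD (subnK (ltnW ij)).
have qj0 : in_alg F q`_j != 0 by rewrite fmorph_eq0.
rewrite (fmorph_div (in_alg F)) (_ : _ * _ = t i / t j)// /t zi; field.
by rewrite [_ *: _ != 0]qj0 expf_neq0.
Qed.

Lemma nat_unit n : (forall l, prime l -> vunit l%:R) -> (0 < n)%N -> vunit n%:R.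
Proof.
move=> h; elim/ltn_ind: n => n ih n0.
have [n1|n1] := leqP n 1.
  by have -> : n = 1%N; [case: n n0 n1 {ih} => [|[]]|split; rewrite ?oner_eq0// invr1].
rewrite -(divnK (pdiv_dvd n)) natrM; apply: vunitM; last exact/h/pdiv_prime.
apply: ih; first by rewrite ltn_Pdiv// prime_gt1 ?pdiv_prime.
by rewrite divn_gt0 ?pdiv_gt0// dvdn_leq// pdiv_dvd.
Qed.

Lemma int_unit (k : int) : vunit `|k|%N%:R -> vunit k%:~R.
Proof.
case: k => k; first by rewrite -pmulrn.
by rewrite NegzE mulrNz -pmulrn; exact: vunitN.
Qed.

(** The residue characteristic of [V]. *)
Lemma vsmall_prime (b : F) : vsmall b -> b != 0 -> exists2 l, prime l & vsmall l%:R.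
Proof.
move=> sb b0; have [m [r [m0 r0 u]]] := rational_power b0.
apply: contrapT => H.
have h l : prime l -> vunit l%:R.
  move=> lp; apply: vunitP; first exact: (subring_int hV l).
  by move=> sl; apply: H; exists l.
have ur : vunit (in_alg F r).
  rewrite (fmorph_eq_rat (in_alg F)).
  apply: vunitM; first by apply/int_unit/nat_unit; rewrite // absz_gt0 numq_eq0.
  by apply/vunitV/int_unit/nat_unit; rewrite // absz_gt0 denq_neq0.
have ub : vunit (b ^+ m) by rewrite -(mulfK (_ : in_alg F r != 0) (b ^+ m)); [exact/vunitM/vunitV|case: ur].
apply: (vunit_not_small ub); case: m m0 {u ub} => // m _.
by rewrite exprS; apply: vsmallM => //; apply: subringX => //; exact: vsmallV.
Qed.

Section Residue.
Variables (l : nat) (l_prime : prime l) (l_small : vsmall l%:R).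

Let l0 : l%:R != 0 :> F. Proof. by rewrite nat_neq0// prime_gt0. Qed.

Lemma other_prime q : prime q -> q <> l -> vunit q%:R.
Proof.
move=> qp ql; apply: vunitP; first exact: (subring_int hV q).
move=> sq; have /coprimeP[|[a b] /= E] : coprime l q.
- by rewrite prime_coprime// dvdn_prime2// eq_sym; exact/eqP.
- exact: prime_gt0.
have u1 : vunit 1 by split; rewrite ?oner_eq0// invr1.
apply: (vunit_not_small u1); rewrite (_ : 1 = l%:R * a%:R + - (q%:R * b%:R) :> F).
  apply: vsmallD; [|apply: vsmallN]; apply: vsmallM => //.
    exact: (subring_int hV a).
  exact: (subring_int hV b).
rewrite -!natrM -natrB ?[(l * a)%N]mulnC ?[(q * b)%N]mulnC ?E//.
by rewrite ltnW// -subn_gt0 E.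
Qed.

Lemma nat_value n : (0 < n)%N -> exists k : int, vunit (n%:R * l%:R ^ k).
Proof.
elim/ltn_ind: n => n ih n0.
have [n1|n1] := leqP n 1.
  exists 0; have -> : n = 1%N by case: n n0 n1 {ih} => [|[]].
  by rewrite expr0z mulr1; split; rewrite ?oner_eq0// invr1.
have [||k uk] := ih (n %/ pdiv n)%N.
- by rewrite ltn_Pdiv// prime_gt1 ?pdiv_prime.
- by rewrite divn_gt0 ?pdiv_gt0// dvdn_leq// pdiv_dvd.
rewrite -{1}(divnK (pdiv_dvd n)) natrM.
have [pl|/eqP pl] := eqVneq (pdiv n) l.
  exists (k - 1); rewrite pl expfzDr// exprN1 -pl.
  suff -> : (n %/ pdiv n)%N%:R * (pdiv n)%:R * ((pdiv n)%:R ^ k / (pdiv n)%:R)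
    = (n %/ pdiv n)%N%:R * l%:R ^ k :> F by [].
  by rewrite pl; field.
by exists k; rewrite mulrAC; apply: vunitM => //; apply: other_prime => //; exact: pdiv_prime.
Qed.

Lemma value_exists z : z != 0 ->
  exists mk : nat * int, (0 < mk.1)%N /\ vunit (z ^+ mk.1 * l%:R ^ mk.2).
Proof.
move=> z0; have [m [r [m0 r0 u]]] := rational_power z0.
have int_value (k : int) : k != 0 -> exists a : int, vunit (k%:~R * l%:R ^ a).
  move=> k0; have [|a ua] := @nat_value `|k|%N; first by rewrite absz_gt0.
  exists a; case: k k0 ua => k k0 ua; first exact: ua.
  by rewrite NegzE mulrNz -pmulrn mulNr; exact: vunitN.
have [a ua] := int_value _ (etrans (congr1 negb (numq_eq0 r)) r0).
have [b ub] := int_value _ (denq_neq0 r).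
exists (m, b - a); split=> //=.
have d0 : (denq r)%:~R != 0 :> F by rewrite -(rmorph_int (in_alg F)) fmorph_eq0 intr_eq0.
have n0 : (numq r)%:~R != 0 :> F by rewrite -(rmorph_int (in_alg F)) fmorph_eq0 intr_eq0 numq_eq0.
rewrite (fmorph_eq_rat (in_alg F)) in u.
rewrite (_ : _ * _ = z ^+ m * ratr r * ((denq r)%:~R * l%:R ^ b / ((numq r)%:~R * l%:R ^ a))).
  by apply: vunitM => //; apply: vunitM => //; exact: vunitV.
by rewrite expfzDr// -invr_expz /ratr; field; rewrite n0 d0 expfz_neq0.
Qed.

Lemma power_unit (k : int) : vunit (l%:R ^ k) -> k = 0.
Proof.
have pos n : ~ vunit (l%:R ^+ n.+1).
  move=> u; apply: (vunit_not_small u); rewrite exprS; apply: vsmallM => //.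
  by apply: subringX => //; exact: vsmallV.
case: k => [[|n]|n] // u; first by case: (pos n).
by case: (pos n); rewrite -[_ ^+ _]invrK; exact: vunitV.
Qed.

(** The logarithm of the absolute value of [z] in base [l]: if [z ^ m * l ^ k] is a
    unit, it is [k / m]. *)
Definition log_value (z : F) : R :=
  if pselect (z != 0) is left z0 then
    let mk := projT1 (cid (value_exists z0)) in mk.2%:~R / mk.1%:R
  else 0.

Lemma log_valueE z m (k : int) : (0 < m)%N -> vunit (z ^+ m * l%:R ^ k) ->
  log_value z = k%:~R / m%:R.
Proof.
move=> m0 u; have z0 : z != 0.
  by case: u => + _ _; apply: contraNneq => ->; rewrite expr0n gtn_eqF// mul0r.
rewrite /log_value; case: pselect => // z0'; case: cid => -[m' k'] /= [m'0 u'].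
have E : m%:Z * k' - m'%:Z * k = 0.
  apply: power_unit.
  rewrite (_ : _ ^ _ = (z ^+ m' * l%:R ^ k') ^+ m / (z ^+ m * l%:R ^ k) ^+ m').
    by apply: vunitM; [exact: vunitX|exact/vunitV/vunitX].
  rewrite expfzDr// -invr_expz ![_%:Z * _]mulrC -!exprz_exp -!exprnP.
  rewrite !exprMn -!exprM [(m' * m)%N]mulnC.
  by field; rewrite !expf_neq0// expfz_neq0.
have m0' : m%:R != 0 :> R by rewrite pnatr_eq0 -lt0n.
have m'0' : m'%:R != 0 :> R by rewrite pnatr_eq0 -lt0n.
have /eqP := E; rewrite subr_eq0 => /eqP/(congr1 (fun i : int => i%:~R : R)).
rewrite !intrM -!pmulrn => {}E; apply: (mulfI m0'); apply: (mulfI m'0').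
transitivity (m%:R * k'%:~R : R); first by field.
by rewrite E; field.
Qed.

Lemma log_valueP z : z != 0 -> exists m (k : int),
  [/\ (0 < m)%N, vunit (z ^+ m * l%:R ^ k) & log_value z = k%:~R / m%:R].
Proof.
move=> /value_exists[[m k]/= [m0 u]]; exists m, k; split=> //.
exact: log_valueE.
Qed.

Lemma log_valueM x z : x != 0 -> z != 0 -> log_value (x * z) = log_value x + log_value z.
Proof.
move=> /log_valueP[m [k [m0 u ->]]] /log_valueP[m' [k' [m'0 u' ->]]].
rewrite (@log_valueE _ (m * m') (k * m'%:Z + k' * m%:Z)) ?muln_gt0 ?m0//.
  rewrite natrM intrD !intrM -!pmulrn; field.
  by rewrite !pnatr_eq0 -!lt0n m0 m'0.
rewrite exprMn expfzDr// (_ : _ * _ = (x ^+ m * l%:R ^ k) ^+ m' * (z ^+ m' * l%:R ^ k') ^+ m).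
  by apply: vunitM; exact: vunitX.
by rewrite -!exprz_exp -!exprnP !exprMn -!exprM [(m' * m)%N]mulnC; ring.
Qed.

Lemma log_value_le0 z : z != 0 -> (log_value z <= 0) <-> V z.
Proof.
move=> z0; have [m [k [m0 u ->]]] := log_valueP z0.
have -> : (k%:~R / m%:R <= 0 :> R) = (k <= 0).
  by rewrite pmulr_lle0 ?invr_gt0 ?ltr0n// lerz0.
split=> [k0|Vz].
  case: (Vdich z) => // Vz'.
  have Vzm : V (z ^+ m).
    rewrite -[z ^+ m](mulfK (_ : l%:R ^ k != 0)) ?expfz_neq0// invr_expz.
    apply: VM; first by case: u.
    by case: k k0 {u} => [[|//]|k] _ /=; [|apply: subringX => //; exact: vsmallV].
  case: m m0 Vzm {u} => // m _ Vzm.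
  have -> : z = z ^+ m.+1 * z^-1 ^+ m by rewrite exprVn exprS mulfK// expf_neq0.
  by apply: VM => //; exact: subringX.
rewrite leNgt; apply/negP => k0; case: k k0 u => [[|k]|]// _ u.
apply: (vunit_not_small u); rewrite mulrC; apply: vsmallM; last exact: subringX.
by rewrite -exprnP exprS; apply: vsmallM => //; apply: subringX => //; exact: vsmallV.
Qed.

Lemma log_value_ultra x z : x != 0 -> z != 0 -> x + z != 0 ->
  log_value (x + z) <= Num.max (log_value x) (log_value z).
Proof.
move=> x0 z0 xz0; wlog Vr : x z x0 z0 xz0 / V (z / x) => [H|].
  case: (Vdich (z / x)) => h; first exact: H.
  by rewrite addrC maxC; apply: H; rewrite // 1?addrC// -invf_div.
rewrite le_max; apply/orP; left.
have E : x + z = x * (1 + z / x) by field.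
have r0 : 1 + z / x != 0 by apply: contraNneq xz0 => r0; rewrite E r0 mulr0.
rewrite E log_valueM// gerDl; apply/log_value_le0 => //; exact: subringD.
Qed.

Definition value_av (z : F) : R := if z == 0 then 0 else expR (log_value z * ln l%:R).

Lemma value_av_neq0 z : z != 0 -> value_av z = expR (log_value z * ln l%:R).
Proof. by rewrite /value_av => /negbTE ->. Qed.

Let lnl : 0 < ln (l%:R : R). Proof. by rewrite ln_gt0// ltr1n prime_gt1. Qed.

Lemma value_av_ge0 z : 0 <= value_av z.
Proof. by rewrite /value_av; case: eqP => // _; exact: expR_ge0. Qed.

Lemma value_av_eq0 z : value_av z = 0 <-> z = 0.
Proof.
rewrite /value_av; case: eqP => // z0; split=> // /eqP.
by rewrite gt_eqF// expR_gt0.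
Qed.

Lemma value_avM x z : value_av (x * z) = value_av x * value_av z.
Proof.
have [->|x0] := eqVneq x 0; first by rewrite /value_av mul0r eqxx mul0r.
have [->|z0] := eqVneq z 0; first by rewrite /value_av mulr0 eqxx mulr0.
by rewrite !value_av_neq0 ?mulf_neq0// log_valueM// mulrDl expRD.
Qed.

Lemma value_av_ultra x z : value_av (x + z) <= Num.max (value_av x) (value_av z).
Proof.
have [->|x0] := eqVneq x 0; first by rewrite add0r le_max lexx orbT.
have [->|z0] := eqVneq z 0; first by rewrite addr0 le_max lexx.
have [->|xz0] := eqVneq (x + z) 0; first by rewrite {1}/value_av eqxx le_max value_av_ge0.
rewrite !value_av_neq0// le_max !ler_expR !ler_pM2r// -le_max.
exact: log_value_ultra.
Qed.

Lemma value_place : exists v : place R F, forall z, (v z <= 1) <-> V z.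
Proof.
pose a := AbsVal value_av_ge0 value_av_eq0 value_avM value_av_ultra.
have h : exists2 q, prime q & a q%:R = q%:R^-1.
  exists l => //; rewrite /= value_av_neq0// (@log_valueE _ 1 (-1)) //.
    by rewrite divr1 mulN1r expRN lnK// posrE ltr0n prime_gt0.
  by rewrite expr1 exprN1 divff//; split; rewrite ?oner_eq0// invr1.
exists (Place h) => z /=.
have [->|z0] := eqVneq z 0.
  by rewrite /value_av eqxx ler01; split=> // _; exact: subring0.
rewrite value_av_neq0// -[X in _ <= X]expR0 ler_expR pmulr_lle0//; exact: (log_value_le0 z0).
Qed.

End Residue.
End RankOne.

(** If [c] is not an algebraic integer then [c] is not in [Z[c^-1]]; a valuation
    ring containing [c^-1] but not [c] defines a place where [c] is not integral. *)
Theorem integral_of_places (R : realType) (F : fieldExtType rat) (c : F) :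
  (forall v : place R F, v c <= 1) -> OF c.
Proof.
move=> hc; apply: contrapT => nc.
have [c0|c0] := eqVneq c 0.
  apply: nc; rewrite c0; exists 'X; first exact: monicX.
  by rewrite map_polyX /root hornerX.
pose B : set F := [set z | exists q : {poly int}, z = (map_poly intr q).[c^-1]].
have hB : is_subring B.
  split; first by exists 1; rewrite rmorph1 hornerC.
    by move=> _ _ [q ->] [r ->]; exists (q - r); rewrite rmorphB hornerD hornerN.
  by move=> _ _ [q ->] [r ->]; exists (q * r); rewrite rmorphM hornerM.
have By : B c^-1 by exists 'X; rewrite map_polyX hornerX.
have nB : ~ B c^-1^-1.
  rewrite invrK => -[q E]; apply: nc.
  set n := size q; have n0 : (0 < n)%N.
    by rewrite size_poly_gt0; apply: contra_neq c0 => q0; rewrite E q0 rmorph0 horner0.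
  pose r := \poly_(i < n) q`_(n - i.+1).
  exists ('X^n - r).
    rewrite monicE lead_coefDl ?lead_coefXn//.
    by rewrite size_polyN size_polyXn ltnS size_poly.
  have -> : map_poly intr ('X^n - r) = 'X^n - \poly_(i < n) (q`_(n - i.+1))%:~R :> {poly F}.
    rewrite rmorphB/= map_polyXn; congr (_ - _); apply/polyP => i.
    by rewrite coef_map !coef_poly; case: ifP => // _; rewrite rmorph0.
  rewrite /root !hornerE horner_poly subr_eq0; apply/eqP.
  have Ec : c = \sum_(i < n) (q`_i)%:~R * c^-1 ^+ i.
    rewrite {1}E (horner_coef_wide _ (size_poly _ _)); apply: eq_bigr => i _.
    by rewrite coef_map.
  rewrite -{1}(prednK n0) exprS {1}Ec mulr_suml (reindex_inj rev_ord_inj).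
  apply: eq_bigr => i _ /=; rewrite exprVn -mulrA; congr (_ * _).
  have {1}-> : n.-1 = ((n - i.+1) + i)%N by have := ltn_ord i; lia.
  by rewrite exprD mulKf// expf_neq0.
have cV0 : c^-1 != 0 by rewrite invr_eq0.
have [V [hV Vy nV Vd]] := exists_valuation_ring cV0 hB By nB.
have sy : vsmall V c^-1 by right.
have [l lp sl] := vsmall_prime hV Vd sy cV0.
have [v hv] := value_place R hV Vd lp sl.
by apply: nV; rewrite invrK; apply/hv.
Qed.

(** * Norms of units *)

Section Norm.
Variables (F : fieldExtType rat) (L : fieldType).
Local Notation g := (\dim {:F}).
Variable sigma : 'I_g -> {rmorphism F -> L}.
Hypothesis sigma_inj : forall i j, sigma i =1 sigma j -> i = j.

(** Dedekind's independence of characters: subtracting [sigma a z] times a relation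
    from its translate by [z] removes the term of index [a]. *)
Lemma embeddings_free (s : seq 'I_g) (u : 'I_g -> L) : uniq s ->
  (forall y, \sum_(i <- s) u i * sigma i y = 0) -> forall i, i \in s -> u i = 0.
Proof.
elim: s u => // a s ih u /= /andP[as_ us] hu.
have us0 i : i \in s -> u i = 0.
  move=> is_; apply/eqP/negPn/negP => ui.
  have ia : i = a.
    apply: sigma_inj => z; apply/eqP; rewrite -subr_eq0; apply/eqP.
    apply: (mulfI ui); rewrite mulr0.
    apply: (ih (fun i => u i * (sigma i z - sigma a z)) us _ i is_) => y.
    have := hu (z * y); have := hu y; rewrite !big_cons => h1 h2.
    transitivity (u a * sigma a (z * y) + \sum_(j <- s) u j * sigma j (z * y)
      - sigma a z * (u a * sigma a y + \sum_(j <- s) u j * sigma j y)); last first.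
      by rewrite h1 h2 mulr0 subrr.
    rewrite rmorphM mulrDr mulr_sumr opprD addrACA.
    rewrite (_ : _ - _ = 0) ?add0r; last by ring.
    by rewrite -sumrB; apply: eq_bigr => j _; rewrite rmorphM; ring.
  by move: is_; rewrite ia (negbTE as_).
move=> i; rewrite inE => /orP[/eqP ->|/us0//].
have := hu 1; rewrite big_cons rmorph1 mulr1 big1_seq ?addr0// => j /andP[_ /us0 ->].
by rewrite mul0r.
Qed.

Lemma sigma_rat i (q : rat) (y : F) : sigma i (q *: y) = ratr q * sigma i y.
Proof. by rewrite -mulr_algl rmorphM -(fmorph_eq_rat (sigma i \o in_alg F)). Qed.

(** The matrix of the embeddings in a basis of [F] is invertible by independence,
    and it conjugates the multiplication by [x], which has rational entries, to the
    diagonal matrix of the conjugates of [x]. *)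
Lemma norm_rational (x : F) : exists d : rat, \prod_i sigma i x = ratr d.
Proof.
pose i0 : 'I_g := Ordinal (adim_gt0 {:F}).
pose tau : {rmorphism rat -> L} := sigma i0 \o in_alg F.
pose e := vbasis {:F}.
have eE y : y = \sum_j coord e j y *: e`_j by rewrite -coord_vbasis ?memvf.
pose V : 'M[L]_g := \matrix_(i, j) sigma i e`_j.
have uV : V \in unitmx.
  rewrite -row_free_unit -kermx_eq0; apply/rowV0P => v /sub_kermxP vV.
  apply/rowP => i; rewrite mxE.
  apply: (embeddings_free (s := enum 'I_g) (u := v 0)); rewrite ?enum_uniq ?mem_enum// => y.
  rewrite big_enum/= [in LHS](eE y).
  under eq_bigr do rewrite rmorph_sum mulr_sumr.
  rewrite exchange_big big1// => j _.
  under eq_bigr do rewrite sigma_rat mulrCA.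
  rewrite -mulr_sumr; have /rowP/(_ j) := vV; rewrite !mxE => h.
  rewrite (_ : \sum_i _ = 0) ?mulr0// -[RHS]h.
  by apply: eq_bigr => k _; rewrite mxE.
pose M : 'M[rat]_g := \matrix_(j, k) coord e k (x * e`_j).
have E : diag_mx (\row_i sigma i x) *m V = V *m (map_mx tau M)^T.
  apply/matrixP => i j; rewrite mul_diag_mx !mxE -rmorphM [in LHS](eE (x * e`_j)).
  rewrite rmorph_sum; apply: eq_bigr => k _; rewrite sigma_rat !mxE mulrC.
  by rewrite -(fmorph_eq_rat tau).
exists (\det M); rewrite -(fmorph_eq_rat tau) -det_map_mx -det_tr.
have dV : \det V != 0 by rewrite -unitfE -unitmxE.
apply: (mulfI dV); rewrite -det_mulmx -E det_mulmx det_diag mulrC; congr (_ * _).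
by apply: eq_bigr => i _; rewrite mxE.
Qed.

Lemma integral_prod (I : Type) (s : seq I) (x : I -> L) :
  (forall i, integralOver (intr : int -> L) (x i)) ->
  integralOver (intr : int -> L) (\prod_(i <- s) x i).
Proof.
move=> h; apply: big_ind => //; first exact: (integral_nat intr 1).
exact: integral_mul.
Qed.

Lemma norm_integer (x : F) : OF x -> exists d : int, \prod_i sigma i x = d%:~R.
Proof.
move=> ix; have [d hd] := norm_rational x.
pose i0 : 'I_g := Ordinal (adim_gt0 {:F}).
pose tau : {rmorphism rat -> L} := sigma i0 \o in_alg F.
have intd : integralOver (intr : int -> L) (tau d).
  rewrite (fmorph_eq_rat tau) -hd; apply: integral_prod => i.
  have [q qm /rootP qx] := ix; exists q => //; apply/rootP.
  have -> : map_poly intr q = map_poly (sigma i) (map_poly intr q).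
    by rewrite -map_poly_comp; apply: eq_map_poly => k /=; rewrite rmorph_int.
  by rewrite horner_map qx rmorph0.
have [q qm /rootP qd] := intd.
have qd0 : (map_poly intr q).[d] = 0.
  apply: (fmorph_inj tau); rewrite rmorph0 -[RHS]qd -horner_map -map_poly_comp.
  by congr (_.[_]); apply: eq_map_poly => k; rewrite -[RHS](rmorph_int tau).
have /intrP[k Ek] : (ratr d : algC) \in Num.int.
  apply: Cint_rat_Aint; first exact: Crat_rat.
  apply: (@root_monic_Aint (map_poly intr q)).
  - apply/rootP; have -> : map_poly intr q = map_poly ratr (map_poly intr q) :> {poly algC}.
      by rewrite -map_poly_comp; apply: eq_map_poly => j /=; rewrite ratr_int.
    by rewrite horner_map qd0 rmorph0.
  - by rewrite monic_map.
  - by apply/polyOverP => j; rewrite coef_map/= intr_int.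
exists k; rewrite hd -(fmorph_eq_rat tau).
have -> : d = k%:~R by apply: (fmorph_inj (ratr : {rmorphism rat -> algC})); rewrite /= Ek ratr_int.
by rewrite rmorph_int.
Qed.

Lemma norm_unit (x : F) : x != 0 -> OF x -> OF x^-1 -> (\prod_i sigma i x) ^+ 2 = 1.
Proof.
move=> x0 /norm_integer[d hd] /norm_integer[d' hd'].
pose i0 : 'I_g := Ordinal (adim_gt0 {:F}).
pose tau : {rmorphism rat -> L} := sigma i0 \o in_alg F.
have dd : d * d' = 1.
  apply: (@intr_inj rat); apply: (fmorph_inj tau).
  rewrite !rmorph_int intrM -hd -hd' -big_split/= big1// => i _.
  by rewrite -rmorphM divff ?rmorph1.
have : (`|d| * `|d'| = 1)%N by rewrite -abszM dd.
move=> /eqP; rewrite muln_eq1 => /andP[/eqP d1 _]; rewrite hd.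
have [->|->] : d = 1 \/ d = -1 by lia.
  by rewrite expr1n.
by rewrite rmorphN1 sqrrN expr1n.
Qed.

End Norm.

(** * Multiplicativity of the weight action *)

Lemma mx22M (K : comNzRingType) (A B : 'M[K]_2) k l :
  (A *m B) k l = A k 0 * B 0 l + A k 1 * B 1 l.
Proof.
rewrite mxE !big_ord_recl big_ord0 addr0.
by congr (_ + A k _ * B _ l); apply: val_inj.
Qed.

Lemma det22 (K : comNzRingType) (A : 'M[K]_2) :
  \det A = A 0 0 * A 1 1 - A 0 1 * A 1 0.
Proof.
rewrite (expand_det_row _ 0) !big_ord_recl big_ord0 addr0 /cofactor !det_mx11 !mxE /=.
rewrite expr0 mul1r expr1 mulN1r mulrN; congr (_ * A _ _ - A _ _ * A _ _); exact: val_inj.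
Qed.

Section Multiplicativity.
Variables (R : realType) (F : fieldExtType rat) (p : nat) (p_prime : prime p).
Variables (L : fieldType) (w : absval R L) (cw : av_complete w).
Hypothesis wp : w p%:R = p%:R^-1.
Variables (g : nat) (sigma : 'I_g -> {rmorphism F -> L}).
Variables (nn vv : 'I_g -> int) (psi : Fp R F p -> L) (s : nat).
Hypotheses (s_ge1 : (1 <= s)%N) (psi_char : is_weight_character s psi).
Local Notation above := (place_above R F p).
Local Notation mindex := (mindex g).
Local Notation mat i gam := (sigma_mx w sigma i gam).
Local Notation act := (weight_act w sigma nn vv psi).
Implicit Types (gam : M2Fp R F p) (z : 'I_g -> L) (f : mindex -> L).

Definition level_mx gam := forall v : above,
  [/\ forall k l, cabs v (gam v k l) <= 1, cabs v (gam v 0 0) = 1,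
      cabs v (gam v 1 0) <= cabs v (p%:R ^+ s) & cabs v (gam v 1 1) = 1].

Lemma cabs_p (v : above) : cabs v p%:R = p%:R^-1.
Proof. by rewrite -(rmorph_nat (cinc v)) cabs_cinc place_p. Qed.

Lemma pV_lt1 : p%:R^-1 < 1 :> R.
Proof. by rewrite invf_lt1 ?ltr1n ?prime_gt1// ltr0n prime_gt0. Qed.

Lemma cabs_ps (v : above) : cabs v (p%:R ^+ s) < 1.
Proof.
by rewrite avX cabs_p exprn_ilt1 ?invr_ge0 ?pV_lt1// -lt0n.
Qed.

Lemma level_mx_iwahori gam i : level_mx gam -> in_iwahori w (mat i gam).
Proof.
move=> h; have [h1 h00 h10 h11] := h (vplace p_prime wp sigma i).
have E := av_sigma_mx p_prime cw wp sigma i gam.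
split=> [k l||//|]; rewrite ?E//; first exact: le_lt_trans h10 (cabs_ps _).
have e1 : w (mat i gam 0 0 * mat i gam 1 1) = 1 by rewrite avM !E h00 h11 mulr1.
rewrite det22 -e1; apply: av_eq_lt; rewrite opprD addrA subrr add0r opprK e1 avM.
apply: le_lt_trans (cabs_ps (vplace p_prime wp sigma i)).
by rewrite !E -[leRHS]mul1r ler_pM ?av_ge0.
Qed.

Lemma level_mx_unit gam : level_mx gam -> Op_units (lower_right gam).
Proof. by move=> h v; have [] := h v. Qed.

Lemma av_psi x : Op_units x -> w (psi x) = 1.
Proof.
have [_ _ _ [N N0 hN]] := psi_char; move=> /hN/(congr1 w).
by rewrite avX av1 => /eqP; rewrite pexpr_eq1 ?av_ge0// => /eqP.
Qed.

Lemma av_psi_le1 gam : level_mx gam -> w (psi (lower_right gam)) <= 1.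
Proof. by move=> /level_mx_unit/av_psi ->. Qed.

Lemma sigma_mxM gam1 gam2 gam i : (forall v, gam v = gam1 v *m gam2 v) ->
  mat i gam = mat i gam1 *m mat i gam2.
Proof.
move=> h; apply/matrixP => k l; rewrite mx22M !mxE.
pose P j : Fp R F p := fun v => gam1 v k j * gam2 v j l.
have PE j : sigma_ext w sigma i (P j) =
    sigma_ext w sigma i (fun v => gam1 v k j) * sigma_ext w sigma i (fun v => gam2 v j l).
  exact: (sigma_extM p_prime cw wp).
rewrite -!PE; apply: (sigma_extD p_prime cw wp) => v.
by rewrite h mx22M.
Qed.

Lemma psi_lower_rightM gam1 gam2 gam : level_mx gam1 -> level_mx gam2 ->
  (forall v, gam v = gam1 v *m gam2 v) ->
  psi (lower_right gam) = psi (lower_right gam1) * psi (lower_right gam2).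
Proof.
move=> h1 h2 h; have [_ psiM psi_cong _] := psi_char.
rewrite -psiM; [|exact: level_mx_unit|exact: level_mx_unit].
have p0 (v : above) : (p%:R : completion v) ^+ s != 0.
  apply/eqP => /(congr1 (cabs v)); rewrite avX cabs_p av0 => /eqP.
  by rewrite expf_eq0 invr_eq0 pnatr_eq0 gtn_eqF ?andbF// prime_gt0.
have diff (v : above) : gam v 1 1 - gam1 v 1 1 * gam2 v 1 1 = gam1 v 1 0 * gam2 v 0 1.
  by rewrite h mx22M addrK.
have prod_unit : Op_units (fun v : above => gam1 v 1 1 * gam2 v 1 1).
  by move=> v; rewrite avM; have [_ _ _ ->] := h1 v; have [_ _ _ ->] := h2 v; rewrite mulr1.
have small (v : above) : cabs v (gam1 v 1 0 * gam2 v 0 1) <= cabs v (p%:R ^+ s).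
  have [_ _ h10 _] := h1 v; have [h01 _ _ _] := h2 v.
  by rewrite avM -[leRHS]mulr1 ler_pM ?av_ge0.
apply: psi_cong => // v; last first.
  exists ((gam1 v 1 0 * gam2 v 0 1) / p%:R ^+ s); last by rewrite diff [RHS]mulrC (divfK (p0 v)).
  change (cabs v (gam1 v 1 0 * gam2 v 0 1 / p%:R ^+ s) <= 1).
  rewrite avM avV ler_pdivrMr ?mul1r//.
  by apply: av_gt0; exact/eqP/p0.
rewrite /lower_right -(prod_unit v); apply: av_eq_lt.
by rewrite av_subC diff (prod_unit v) (le_lt_trans (small v))// cabs_ps.
Qed.

Lemma moebiusM (A B : 'M[L]_2) (x : L) : in_iwahori w B -> w x <= 1 ->
  moebius (A *m B) x = moebius A (moebius B x).
Proof.
move=> hB x1; have l0 := lin_neq0 hB x1.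
rewrite /moebius !mx22M.
have -> : (A 0 0 * B 0 0 + A 0 1 * B 1 0) * x + (A 0 0 * B 0 1 + A 0 1 * B 1 1) =
  (B 1 0 * x + B 1 1) * (A 0 0 * ((B 0 0 * x + B 0 1) / (B 1 0 * x + B 1 1)) + A 0 1).
  by field.
have -> : (A 1 0 * B 0 0 + A 1 1 * B 1 0) * x + (A 1 0 * B 0 1 + A 1 1 * B 1 1) =
  (B 1 0 * x + B 1 1) * (A 1 0 * ((B 0 0 * x + B 0 1) / (B 1 0 * x + B 1 1)) + A 1 1).
  by field.
by rewrite -mulf_div divff// mul1r.
Qed.

Lemma cocycleM gam1 gam2 gam z : level_mx gam1 -> level_mx gam2 ->
  (forall v, gam v = gam1 v *m gam2 v) -> (forall i, w (z i) <= 1) ->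
  cocycle w sigma nn vv psi gam z =
  cocycle w sigma nn vv psi gam1 (fun i => moebius (mat i gam2) (z i)) *
  cocycle w sigma nn vv psi gam2 z.
Proof.
move=> h1 h2 h hz; rewrite /cocycle (psi_lower_rightM h1 h2 h) mulrACA -big_split/=.
congr (_ * _); apply: eq_bigr => i _; rewrite (sigma_mxM i h) det_mulmx expfzMl.
rewrite [RHS]mulrACA; congr (_ * _); rewrite -expfzMl; congr (_ ^ _).
have l0 := lin_neq0 (level_mx_iwahori i h2) (hz i).
by rewrite /moebius !mx22M; field.
Qed.

(** Both sides have the same values at integral points, by the cocycle
    relation. *)
Lemma weight_actM gam1 gam2 gam f : level_mx gam1 -> level_mx gam2 -> level_mx gam ->
  (forall v, gam v = gam1 v *m gam2 v) -> tate w f ->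
  act (act f gam1) gam2 = act f gam.
Proof.
move=> h1 h2 h3 h hf; have [[t1 t2] t3] := (av_psi_le1 h1, av_psi_le1 h2, av_psi_le1 h3).
have iw i gam' : level_mx gam' -> in_iwahori w (mat i gam') by exact: level_mx_iwahori.
have hf1 : tate w (act f gam1) by apply: weight_act_tate => // i; exact: iw.
apply: (tate_ext p_prime cw wp) => [||z hz].
- by apply: weight_act_tate => // i; exact: iw.
- by apply: weight_act_tate => // i; exact: iw.
have hz2 i : w (moebius (mat i gam2) (z i)) <= 1 by apply: av_moebius_le1 => //; exact: iw.
have hz12 i : w (moebius (mat i gam1) (moebius (mat i gam2) (z i))) <= 1.
  by apply: av_moebius_le1 => //; exact: iw.
have [S hS] := tate_eval cw hf hz12.
have e1 := weight_act_eval cw nn vv t1 (fun i => iw i _ h1) hf hz2 hS.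
have e2 := weight_act_eval cw nn vv t2 (fun i => iw i _ h2) hf1 hz e1.
exists (cocycle w sigma nn vv psi gam z * S); split.
  by rewrite (cocycleM h1 h2 h hz) [X in X * S]mulrC -mulrA.
apply: (weight_act_eval cw nn vv t3 (fun i => iw i _ h3) hf hz).
apply: eq_sums_to hS => l; congr (_ * _); apply: eq_bigr => i _.
by rewrite (sigma_mxM i h) moebiusM//; exact: iw.
Qed.

Lemma weight_act1 gam f : (forall v, gam v = 1%:M) -> tate w f -> act f gam = f.
Proof.
move=> h hf.
have hl : level_mx gam.
  move=> v; have gE k l : gam v k l = (k == l)%:R by rewrite h mxE.
  split=> [k l|||]; rewrite gE ?eqxx ?av1//.
    by case: (k == l); rewrite ?av1 ?av0.
  by rewrite (_ : (1 == 0 :> 'I_2) = false)// av0 av_ge0.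
have matE i k l : mat i gam k l = (k == l)%:R.
  rewrite mxE -(rmorph_nat (sigma i)).
  by apply: (sigma_ext_cinc (p_prime := p_prime) cw (wp := wp)); rewrite h mxE rmorph_nat.
have iw i : in_iwahori w (mat i gam) by exact: level_mx_iwahori.
apply: (tate_ext p_prime cw wp) => [||z hz]; [|by []|].
  by apply: weight_act_tate => //; exact: av_psi_le1.
have [S hS] := tate_eval cw hf hz; exists S; split=> //.
have -> : S = cocycle w sigma nn vv psi gam z * S.
  rewrite /cocycle (_ : lower_right gam = fun v => 1); last first.
    by apply: functional_extensionality_dep => v; rewrite /lower_right h mxE.
  have [-> _ _ _] := psi_char; rewrite big1 ?mulr1 ?mul1r// => i _.
  by rewrite det22 !matE /= !(mulr0, mul0r, mulr1, subr0, add0r) !exp1rz mulr1.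
apply: (weight_act_eval cw nn vv (av_psi_le1 hl) iw hf hz).
apply: eq_sums_to hS => l; congr (_ * _); apply: eq_bigr => i _.
by rewrite /moebius !matE /= !(mulr0, mul0r, mul1r, addr0, add0r) divr1.
Qed.

(** A scalar unit [c] acts by [psi c * N(c) ^ r], which is [N(c) ^ (2 r) = 1]. *)
Lemma weight_act_scalar gam gam' (c : F) (r : int) f :
  level_mx gam -> level_mx gam' -> tate w f ->
  (forall i, nn i + 2 * vv i = r) -> c != 0 ->
  (forall v : above, gam' v = cinc v c *: gam v) ->
  psi (fun v => cinc v c) = (\prod_i sigma i c) ^ r ->
  (\prod_i sigma i c) ^+ 2 = 1 -> act f gam' = act f gam.
Proof.
move=> h h' hf nnvv c0 hc psic norm1.
have [t t'] := (av_psi_le1 h, av_psi_le1 h').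
have iw i gam0 : level_mx gam0 -> in_iwahori w (mat i gam0) by exact: level_mx_iwahori.
have matE i : mat i gam' = sigma i c *: mat i gam.
  apply/matrixP => k l; rewrite !mxE.
  have <- : sigma_ext w sigma i (fun v : above => cinc v c) = sigma i c.
    exact: (sigma_ext_cinc (p_prime := p_prime) cw (wp := wp)).
  by apply: (sigma_extM p_prime cw wp) => v; rewrite hc mxE.
have s0 i : sigma i c != 0 by rewrite fmorph_eq0.
have mobE i x : moebius (mat i gam') x = moebius (mat i gam) x.
  rewrite matE /moebius !mxE -!mulrA -!mulrDr -mulf_div divff ?mul1r//.
apply: (tate_ext p_prime cw wp) => [||z hz].
- by apply: weight_act_tate => // i; exact: iw.
- by apply: weight_act_tate => // i; exact: iw.
have hzm i : w (moebius (mat i gam) (z i)) <= 1 by apply: av_moebius_le1 => //; exact: iw.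
have [S hS] := tate_eval cw hf hzm.
exists (cocycle w sigma nn vv psi gam z * S); split; last first.
  exact: (weight_act_eval cw nn vv t (fun i => iw i _ h) hf hz).
have -> : cocycle w sigma nn vv psi gam z = cocycle w sigma nn vv psi gam' z.
  have cunit (v : above) : cabs v (cinc v c) = 1.
    have [_ _ _ d1] := h v; have [_ _ _] := h' v.
    by rewrite hc mxE avM d1 mulr1.
  have psiE : psi (lower_right gam') = (\prod_i sigma i c) ^ r * psi (lower_right gam).
    have [_ psiM _ _] := psi_char; rewrite -psic -psiM//; last exact: level_mx_unit.
    by congr psi; apply: functional_extensionality_dep => v; rewrite /lower_right hc mxE.
  rewrite /cocycle psiE.
  have -> : \prod_i (\det (mat i gam') ^ vv i * (mat i gam' 1 0 * z i + mat i gam' 1 1) ^ nn i)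
    = (\prod_i sigma i c) ^ r *
      \prod_i (\det (mat i gam) ^ vv i * (mat i gam 1 0 * z i + mat i gam 1 1) ^ nn i).
    rewrite (big_morph (fun x : L => x ^ r) (fun x y => expfzMl x y r) (exp1rz _ r)).
    rewrite -big_split/=; apply: eq_bigr => i _.
    rewrite matE detZ !mxE -mulrA -mulrDr !expfzMl -(nnvv i) expfzDr// -exprz_exp.
    by rewrite -exprnP expr2 expfzMl; ring.
  by rewrite mulrACA -expfzMl -expr2 norm1 exp1rz mul1r.
apply: (weight_act_eval cw nn vv t' (fun i => iw i _ h') hf hz).
by apply: eq_sums_to hS => l; congr (_ * _); apply: eq_bigr => i _; rewrite mobE.
Qed.

End Multiplicativity.

(** * The level and its scalars *)

Lemma integral_av_le1 (R : realType) (K : fieldType) (u : absval R K) (x : K) :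
  integralOver (intr : int -> K) x -> u x <= 1.
Proof.
move=> [q qm /rootP qx]; rewrite leNgt; apply/negP => x1.
have x0 : 0 < u x by exact: lt_trans x1.
pose n := (size q).-1.
have sq : size (map_poly intr q : {poly K}) = n.+1.
  by rewrite size_map_poly_id0 ?(monicP qm) ?rmorph1 ?oner_neq0// prednK// size_poly_gt0 monic_neq0.
have : u (x ^+ n) < u x ^+ n.
  have -> : x ^+ n = - \sum_(i < n) (q`_i)%:~R * x ^+ i.
    apply/eqP; rewrite -addr_eq0 addrC -[X in _ == X]qx horner_coef sq big_ord_recr/=.
    rewrite coef_map/= -/(lead_coef q) (monicP qm) rmorph1 mul1r.
    by apply/eqP; congr (_ + _); apply: eq_bigr => i _; rewrite coef_map.
  rewrite avN; apply: av_sum_lt; first by rewrite exprn_gt0.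
  move=> i _ _; rewrite avM avX.
  apply: le_lt_trans (_ : u x ^+ i < _); last by rewrite ltr_eXn2l.
  by rewrite ler_piMl ?exprn_ge0 ?av_ge0// av_int_le1.
by rewrite avX ltxx.
Qed.

Section Level.
Variables (R : realType) (F : fieldExtType rat) (a b : F) (O : quat_order a b).

Lemma order_bounded (v : place R F) :
  exists2 B : R, 0 <= B & forall y, ord O y -> v (q0 y) <= B.
Proof.
have [n [e Oe]] := ord_fg O.
pose B := \sum_i v (q0 (e i)).
have B0 : 0 <= B by apply: sumr_ge0 => i _; exact: av_ge0.
exists B => // y; rewrite Oe => -[t ht ->].
have -> : q0 (\sum_(c <- t) qscal a b c.1 * c.2) = \sum_(c <- t) c.1 * q0 c.2.
  rewrite (big_morph (@q0 _ a b) (fun x y => erefl) erefl); apply: eq_bigr => c _.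
  by rewrite /=; ring.
apply: av_sum_le => // c ct _; have [hc [i _ <-]] := ht c ct.
rewrite avM; apply: le_trans (_ : v (q0 (e i)) <= _); last first.
  by rewrite /B (bigD1 i)//= lerDl; apply: sumr_ge0 => j _; exact: av_ge0.
by rewrite ler_piMl ?av_ge0//; exact: integral_av_le1.
Qed.

Lemma qscalX (K : comNzRingType) (c d x : K) k :
  (qscal c d x) ^+ k = qscal c d (x ^+ k).
Proof. by elim: k => [//|k ih]; rewrite !exprS ih qscalM. Qed.

(** The powers of a scalar of the local order have bounded first coordinates. *)
Lemma ODv_scalar_le1 (v : place R F) (x : completion v) :
  ODv O v (qscal _ _ x) -> cabs v x <= 1.
Proof.
move=> Ox; have [B B0 hB] := order_bounded v.
have hD y : ODv O v y -> cabs v (q0 y) <= B.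
  case=> t ht ->.
  rewrite (big_morph (@q0 _ _ _) (fun x y => erefl) erefl); apply: av_sum_le => // c ct _.
  have [hc [z Oz zc]] := ht c ct; rewrite -zc.
  have -> : q0 (qscal (cinc v a) (cinc v b) c.1 * qmap (cinc v) z) = c.1 * cinc v (q0 z).
    by rewrite /=; ring.
  rewrite avM cabs_cinc -[leRHS]mul1r.
  by apply: ler_pM; rewrite ?av_ge0//; exact: hB.
have hX k : cabs v x ^+ k <= B.
  rewrite -avX; have : ODv O v (qscal (cinc v a) (cinc v b) x ^+ k).
    elim: k => [|k ih]; first exact: ODv1.
    by rewrite exprS; exact: ODvM.
  by rewrite qscalX => /hD.
rewrite leNgt; apply/negP => x1.
have x0 : 0 < cabs v x by exact: lt_trans x1.
have [N] : exists N, (cabs v x)^-1 ^+ N < (B + 1)^-1.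
  apply: small_power; last by rewrite invr_gt0 ltr_wpDl.
  by rewrite invr_ge0 ltW//= invf_lt1.
rewrite exprVn ltf_pV2 ?posrE ?exprn_gt0 ?ltr_wpDl// => /lt_le_trans/(_ (hX N)).
by rewrite -subr_gt0 opprD addrA subrr add0r oppr_gt0 ltr10.
Qed.

Variable theta : forall v : place R F, {rmorphism Dv a b v -> 'M[completion v]_2}.
Variables (p : nat) (p_prime : prime p) (n : set F) (s : nat) (s_ge1 : (1 <= s)%N).
Hypothesis n_ideal : is_ideal n.
Hypothesis theta_split : forall v, divides_np p n v -> integral_splitting O theta v.
Local Notation U := (U0 theta p n s : set (Dfx R O)).
Local Notation above := (place_above R F p).

Lemma npsOvD (v : place R F) x y :
  npsOv p n s (v := v) x -> npsOv p n s (v := v) y -> npsOv p n s (v := v) (x + y).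
Proof.
case=> t ht -> [t' ht' ->]; exists (t ++ t'); last by rewrite big_cat.
by move=> c; rewrite mem_cat => /orP[/ht|/ht'].
Qed.

Lemma npsOvM (v : place R F) c x : Ov v c ->
  npsOv p n s (v := v) x -> npsOv p n s (v := v) (c * x).
Proof.
move=> hc [t ht ->]; exists [seq (c * d.1, d.2) | d <- t].
  move=> _ /mapP[d dt ->] /=; have [hd1 hd2] := ht d dt; split=> //.
  change (cabs v (c * d.1) <= 1); rewrite avM mulr_ile1 ?av_ge0//.
by rewrite big_map mulr_sumr; apply: eq_bigr => d _; rewrite mulrA.
Qed.

Lemma npsOv_le (v : place R F) x : npsOv p n s (v := v) x -> cabs v x <= cabs v (p%:R ^+ s).
Proof.
case=> t ht ->; apply: av_sum_le => [|c ct _]; first exact: av_ge0.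
have [hc [y ny <-]] := ht c ct; rewrite rmorphM rmorphXn rmorph_nat !avM mulrA.
rewrite ler_piMl ?av_ge0// mulr_ile1 ?av_ge0// cabs_cinc.
by apply: integral_av_le1; case: n_ideal => + _ _ _; exact.
Qed.

Lemma OvM (v : place R F) x y : Ov v x -> Ov v y -> Ov v (x * y).
Proof.
move=> hx hy; change (cabs v (x * y) <= 1).
by rewrite avM mulr_ile1 ?av_ge0.
Qed.

Lemma OvN (v : place R F) x : Ov v x -> Ov v (- x).
Proof. by move=> hx; change (cabs v (- x) <= 1); rewrite avN. Qed.

Lemma OvD (v : place R F) x y : Ov v x -> Ov v y -> Ov v (x + y).
Proof.
move=> hx hy; change (cabs v (x + y) <= 1).
by apply: le_trans (av_ultra _ _ _) _; rewrite ge_max; apply/andP.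
Qed.

Lemma U0_entries u v k l : U u -> divides_np p n v ->
  Ov v (theta v (u v) k l) /\ Ov v (theta v (Defs.dinv u v) k l).
Proof.
move=> Uu dv; have [h h' _] := Uu v; have [_ hT] := theta_split dv.
by split; [move/hT: h|move/hT: h']; apply.
Qed.

Lemma U0_1 : U 1%g.
Proof.
move=> v; split=> [||dv]; [exact: ODv1|exact: ODv1|].
rewrite [X in theta v X](_ : _ = 1)// rmorph1 mxE /=.
by exists [::]; rewrite ?big_nil.
Qed.

Lemma U0_mul u u' : U u -> U u' -> U (u * u')%g.
Proof.
move=> Uu Uu' v; have [h h' hc] := Uu v; have [k k' kc] := Uu' v.
split=> [||dv]; [exact: ODvM|exact: ODvM|].
rewrite [X in theta v X](_ : _ = u v * u' v)// rmorphM mx22M.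
apply: npsOvD; last by apply: npsOvM; [case: (U0_entries 1 1 Uu dv)|exact: kc].
by rewrite mulrC; apply: npsOvM; [case: (U0_entries 0 0 Uu' dv)|exact: hc].
Qed.

Lemma theta_dinv (u : Dfx R O) v : theta v (u v) *m theta v (Defs.dinv u v) = 1.
Proof. by rewrite -[LHS]rmorphM dval_dinv rmorph1. Qed.

Lemma U0_inv u : U u -> U (u^-1)%g.
Proof.
move=> Uu v; have [h h' hc] := Uu v; split=> // dv.
rewrite [X in theta v X](_ : _ = Defs.dinv u v)//.
set A := theta v (u v) in hc *; set B := theta v (Defs.dinv u v).
have AB := theta_dinv u v; rewrite -/A -/B in AB.
have e10 : A 1 0 * B 0 0 + A 1 1 * B 1 0 = 0 by rewrite -mx22M AB mxE.
have e11 : A 1 0 * B 0 1 + A 1 1 * B 1 1 = 1 by rewrite -mx22M AB mxE.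
have -> : B 1 0 = (- \det B) * A 1 0.
  rewrite det22 -[LHS]mulr1 -e11.
  transitivity (B 1 0 * A 1 0 * B 0 1 + B 1 1 * (A 1 0 * B 0 0 + A 1 1 * B 1 0) - A 1 0 * B 0 0 * B 1 1).
    by ring.
  by rewrite e10; ring.
have hB k l : Ov v (B k l) by case: (U0_entries k l Uu dv).
apply: npsOvM; last exact: hc.
by rewrite det22; apply/OvN/OvD; [|apply: OvN]; exact: OvM.
Qed.

Lemma above_divides (v : above) : divides_np p n v.
Proof. by right; rewrite place_p pV_lt1. Qed.

(** The determinant is a unit because the inverse is integral too; as [c] is small,
    [a] and [d] are then units. *)
Lemma U0_level_mx u : U u -> level_mx s (comp_p theta (p := p) u).
Proof.
move=> Uu v; have dv := above_divides v.
have [_ _ hc] := Uu v; have c1 := npsOv_le (hc dv).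
have h k l : cabs v (theta v (u v) k l) <= 1 by case: (U0_entries k l Uu dv).
have h' k l : cabs v (theta v (Defs.dinv u v) k l) <= 1 by case: (U0_entries k l Uu dv).
have cs := cabs_ps p_prime s_ge1 v.
have det_le (A : 'M[completion v]_2) : (forall k l, cabs v (A k l) <= 1) -> cabs v (\det A) <= 1.
  move=> hA; rewrite det22; apply: le_trans (av_ultra _ _ _) _; rewrite avN !avM ge_max.
  by rewrite !mulr_ile1 ?av_ge0.
have det1 : cabs v (\det (theta v (u v))) = 1.
  apply/eqP; rewrite eq_le det_le//=.
  have : cabs v (\det (theta v (u v) *m theta v (Defs.dinv u v))) = 1 by rewrite theta_dinv det1 av1.
  rewrite det_mulmx avM => <-; rewrite ler_piMr ?av_ge0// det_le//.
have ad : cabs v (theta v (u v) 0 0 * theta v (u v) 1 1) = 1.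
  rewrite -det1; apply: av_eq_lt; rewrite det1 det22 addrAC subrr add0r avN avM.
  by apply: le_lt_trans cs; rewrite -[leRHS]mul1r ler_pM ?av_ge0.
move: ad; rewrite avM => ad; split=> //.
  apply/eqP; rewrite eq_le h/= -ad ler_piMr ?av_ge0//.
apply/eqP; rewrite eq_le h/= -ad ler_piMl ?av_ge0//.
Qed.

Lemma U0_scalar_integral u u' (c : F) : U u -> U u' ->
  (forall v, u' v = qscal _ _ (cinc v c) * u v) -> OF c.
Proof.
move=> Uu Uu' h; apply: (@integral_of_places R) => v.
rewrite -cabs_cinc; apply: ODv_scalar_le1.
have -> : qscal _ _ (cinc v c) = u' v * Defs.dinv u v by rewrite h -mulrA dval_dinv mulr1.
by have [? _ _] := Uu' v; have [_ ? _] := Uu v; exact: ODvM.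
Qed.

End Level.

(** * Forms and their values at the representatives *)

Section Forms.
Variables (R : realType) (F : fieldExtType rat) (p : nat) (p_prime : prime p).
Variables (a b : F) (O : quat_order a b) (n : set F) (n_ideal : is_ideal n).
Variable theta : forall v : place R F, {rmorphism Dv a b v -> 'M[completion v]_2}.
Hypothesis theta_split : forall v, divides_np p n v -> integral_splitting O theta v.
Variables (s : nat) (s_ge1 : (1 <= s)%N) (h : nat) (t : 'I_h -> Dfx R O).
Local Notation U := (U0 theta p n s : set (Dfx R O)).
Hypotheses (t_repr : coset_representatives U t) (U_small : sufficiently_small U t).
Variables (L : fieldType) (w : absval R L) (cw : av_complete w).
Hypothesis wp : w p%:R = p%:R^-1.
Variables (g : nat) (sigma : 'I_g -> {rmorphism F -> L}).
Hypotheses (sigma_inj : forall i j, sigma i =1 sigma j -> i = j) (F_deg : \dim {:F} = g).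
Variables (nn vv : 'I_g -> int) (r : int) (nn_vv : forall i, nn i + 2 * vv i = r).
Variables (psi : Fp R F p -> L) (psi_char : is_weight_character s psi).
Hypothesis psi_units : forall x : F, x != 0 -> OF x -> OF x^-1 ->
  psi (fun v => cinc v x) = (\prod_i sigma i x) ^ r.
Local Notation act := (weight_act w sigma nn vv psi).
Local Notation comp := (comp_p theta (p := p)).
Local Notation S := (forms theta w sigma nn vv psi U).

Lemma U0_iwahori u i : U u -> in_iwahori w (sigma_mx w sigma i (comp u)).
Proof.
move=> Uu; have hu := U0_level_mx p_prime s_ge1 n_ideal theta_split Uu.
exact: level_mx_iwahori hu.
Qed.

Lemma U0_act_tate f u : tate w f -> U u -> tate w (act f (comp u)).
Proof.
move=> hf Uu; have hu := U0_level_mx p_prime s_ge1 n_ideal theta_split Uu.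
by apply: weight_act_tate => //; [exact: av_psi_le1 hu|move=> i; exact: U0_iwahori].
Qed.

Lemma U0_act_le f u (c : R) m : U u -> 0 <= c -> (forall l, w (f l) <= c) ->
  w (act f (comp u) m) <= c.
Proof.
move=> Uu c0 hf; have hu := U0_level_mx p_prime s_ge1 n_ideal theta_split Uu.
by apply: weight_act_le => //; [exact: av_psi_le1 hu|move=> i; exact: U0_iwahori].
Qed.

Lemma U0_actM f u u' : tate w f -> U u -> U u' ->
  act (act f (comp u)) (comp u') = act f (comp (u * u')%g).
Proof.
move=> hf Uu Uu'; have lv u0 := @U0_level_mx _ _ _ _ _ _ _ p_prime _ _ s_ge1 n_ideal theta_split u0.
have hM (v : place_above R F p) : comp (u * u')%g v = comp u v *m comp u' v.
  by rewrite /comp_p -[RHS]rmorphM.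
have Uuu' := U0_mul theta_split Uu Uu'.
exact: (weight_actM p_prime cw wp sigma nn vv s_ge1 psi_char (lv _ Uu) (lv _ Uu') (lv _ Uuu') hM hf).
Qed.

Lemma theta_scalar (v : place_above R F p) (c : completion v) x :
  theta v (qscal _ _ c * x) = c *: theta v x.
Proof.
have [[_ hs] _] := theta_split (above_divides p_prime n v).
by rewrite rmorphM hs; exact: mul_scalar_mx.
Qed.

(** Two expressions of an adele as [d t_i u] differ by an element of
    [F^* \cap U], that is by a unit of the ring of integers, which acts
    trivially. *)
Lemma coset_act_unique x i i' d d' u u' f : tate w f ->
  qinvertible d -> U u -> lmul_eq d x (t i * u)%g ->
  qinvertible d' -> U u' -> lmul_eq d' x (t i' * u')%g ->
  i = i' /\ act f (comp u) = act f (comp u').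
Proof.
move=> hf hd Uu xd hd' Uu' xd'.
have ii : i = i'.
  have [j [_ hj]] := t_repr x.
  rewrite -(hj i); last by exists d, u.
  by apply: hj; exists d', u'.
split; first exact: ii.
rewrite -{}ii in xd'.
have [e [de ed]] := hd; have [e' [de' ed']] := hd'.
have inv : qinvertible (e' * d).
  exists (e * d'); split; first by rewrite mulrA -(mulrA e') de mulr1 ed'.
  by rewrite mulrA -(mulrA e) de' mulr1 ed.
have qm (v : place R F) (y z : quat a b) : (qmap (cinc v) (y * z) : Dv a b v) =
    (qmap (cinc v) y : Dv a b v) * (qmap (cinc v) z : Dv a b v).
  exact: qmapM.
have eqv v : t i v * u' v = (qmap (cinc v) (e' * d) : Dv a b v) * (t i v * u v).
  have := xd v; have := xd' v; rewrite /= => -> E.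
  rewrite qm -mulrA -E mulrA -qm ed'.
  by rewrite [qmap _ _](@qmap1 _ _ (cinc v) a b) mul1r.
have [|c ec] := U_small inv (i := i).
  exists (u' * u^-1)%g; first exact/U0_mul/U0_inv.
  move=> v /=; rewrite mulr1 mulrA eqv -!mulrA [u v * _]mulrA dval_dinv mul1r.
  by rewrite dval_dinv mulr1.
have c0 : c != 0.
  apply/eqP => c0; have [y [+ _]] := inv; rewrite ec c0 => /(congr1 (@q0 _ _ _))/eqP.
  by rewrite /= !(mulr0, mul0r, addr0, subr0) eq_sym oner_eq0.
have qs v (y : F) : (qmap (cinc v) (qscal a b y) : Dv a b v) = qscal _ _ (cinc v y).
  by apply: quat_ext => //=; rewrite rmorph0.
have uu' v : u' v = qscal _ _ (cinc v c) * u v.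
  have := eqv v; rewrite ec qs => /(congr1 (fun z => Defs.dinv (t i) v * z)).
  rewrite mulrA dinv_dval mul1r => ->.
  by rewrite mulrA -qscalC -!mulrA [Defs.dinv _ _ * _]mulrA dinv_dval mul1r.
have u'u v : u v = qscal _ _ (cinc v c^-1) * u' v.
  rewrite uu' mulrA -qscalM -rmorphM mulVf// rmorph1.
  by rewrite [qscal _ _ _ * _]mul1r.
have oc : OF c := U0_scalar_integral Uu Uu' uu'.
have oc' : OF c^-1 := U0_scalar_integral Uu' Uu u'u.
apply/esym; apply: (weight_act_scalar p_prime cw wp s_ge1 psi_char (c := c) _ _ hf nn_vv c0).
- exact: (U0_level_mx p_prime s_ge1 n_ideal theta_split).
- exact: (U0_level_mx p_prime s_ge1 n_ideal theta_split).
- by move=> v; rewrite /comp_p uu' theta_scalar.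
- exact: psi_units.
- by move: sigma_inj; clear -F_deg c0 oc oc'; subst g => sigma_inj; exact: norm_unit.
Qed.

Definition decomposition (x : Dfx R O) (iu : 'I_h * Dfx R O) :=
  exists d, [/\ qinvertible d, U iu.2 & lmul_eq d x (t iu.1 * iu.2)%g].

Lemma decomposition_exists x : exists iu, decomposition x iu.
Proof. by have [i [[d [u hu]] _]] := t_repr x; exists (i, u), d. Qed.

(** Since [f (x u^-1) . u = f x], a form is determined by its values at the
    representatives, and these are arbitrary by uniqueness of the decomposition. *)
Definition form_of (phi : 'I_h -> mindex g -> L) (x : Dfx R O) : mindex g -> L :=
  let iu := projT1 (cid (decomposition_exists x)) in act (phi iu.1) (comp iu.2).

Lemma form_ofE phi x iu : (forall i, tate w (phi i)) -> decomposition x iu ->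
  form_of phi x = act (phi iu.1) (comp iu.2).
Proof.
move=> hphi [d [hd Uu xd]]; rewrite /form_of; case: cid => -[i u] [d' /= [hd' Uu' xd']].
by have [-> ->] := coset_act_unique (hphi i) hd' Uu' xd' hd Uu xd.
Qed.

Lemma qinvertible1 : qinvertible (1 : quat a b).
Proof. by exists 1; rewrite mulr1. Qed.

Lemma lmul_eq1 (x : Dfx R O) : lmul_eq 1 x x.
Proof. by move=> v; rewrite [qmap _ _](@qmap1 _ _ (cinc v) a b) mul1r. Qed.

Lemma form_of_repr phi i : (forall i, tate w (phi i)) -> form_of phi (t i) = phi i.
Proof.
move=> hphi; rewrite (@form_ofE _ _ (i, 1%g)) //=; last first.
  exists 1; split; [exact: qinvertible1|exact: U0_1|rewrite mulg1; exact: lmul_eq1].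
by apply: (weight_act1 p_prime cw wp sigma nn vv s_ge1 psi_char) => // v; exact: rmorph1.
Qed.

Lemma form_of_forms phi : (forall i, tate w (phi i)) -> S (form_of phi).
Proof.
move=> hphi; split=> [x|d x y hd yx|u x Uu].
- have [iu hiu] := decomposition_exists x; rewrite (form_ofE hphi hiu).
  by have [d [_ Uu _]] := hiu; exact: U0_act_tate.
- have [iu hiu] := decomposition_exists x; rewrite (form_ofE hphi hiu).
  apply: form_ofE => //; have [d' [hd' Uu xd']] := hiu.
  exists (d * d'); split=> //.
    have [e [de ed]] := hd; have [e' [de' ed']] := hd'.
    exists (e' * e); split; first by rewrite mulrA -(mulrA d) de' mulr1.
    by rewrite mulrA -(mulrA e') ed mulr1.
  move=> v; rewrite (yx v) (xd' v) mulrA; congr (_ * _).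
  exact/esym/qmapM.
- have [iu hiu] := decomposition_exists (x * u^-1)%g; rewrite (form_ofE hphi hiu).
  have [d [hd Uu' xd]] := hiu; rewrite (U0_actM (hphi _) Uu' Uu).
  apply/esym; apply: (@form_ofE _ _ (iu.1, iu.2 * u)%g) => //.
  exists d; split=> //; first exact: U0_mul.
  move=> v; have := xd v; rewrite /= => /(congr1 (fun z => z * u v)).
  by rewrite -!mulrA dinv_dval mulr1.
Qed.

Lemma forms_decomposition f x iu : S f -> decomposition x iu ->
  f x = act (f (t iu.1)) (comp iu.2).
Proof.
move=> [_ fD fU] [d [hd Uu xd]]; rewrite (fD _ _ _ hd xd).
by rewrite -[LHS](fU iu.2)// mulgK.
Qed.

Lemma forms_bij : set_bij S [set phi : 'I_h -> mindex g -> L | forall i, tate w (phi i)]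
  (fun f i => f (t i)).
Proof.
split.
- by move=> f [hf _ _] i; exact: hf.
- move=> f f' /set_mem Sf /set_mem Sf' E; apply/funext => x.
  have [iu hiu] := decomposition_exists x.
  rewrite (forms_decomposition Sf hiu) (forms_decomposition Sf' hiu).
  by congr (act _ _); exact: (congr1 (fun k => k iu.1) E).
- move=> phi hphi; exists (form_of phi); first exact: form_of_forms.
  by apply/funext => i; exact: form_of_repr.
Qed.

Lemma forms_le1 f : S f -> (forall i m, w (f (t i) m) <= 1) ->
  forall x m, w (f x m) <= 1.
Proof.
move=> Sf ft1 x m; have [iu hiu] := decomposition_exists x.
rewrite (forms_decomposition Sf hiu); have [d [_ Uu _]] := hiu.
by apply: (U0_act_le m Uu).
Qed.

End Forms.

(** * The Hecke operators *)

Lemma mx22P (K : Type) (A B : 'M[K]_2) : A 0 0 = B 0 0 -> A 0 1 = B 0 1 ->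
  A 1 0 = B 1 0 -> A 1 1 = B 1 1 -> A = B.
Proof.
move=> h00 h01 h10 h11; have ord2 (i : 'I_2) : i = 0 \/ i = 1.
  by case: i => [[|[|//]] hi]; [left|right]; exact: val_inj.
by apply/matrixP => i j; case: (ord2 i) => ->; case: (ord2 j) => ->.
Qed.

Definition lower_mx (K : fieldType) (x y : K) : 'M[K]_2 := \matrix_(i, j)
  (if i == 0 then if j == 0 then x else 0 else if j == 0 then y else 1).

Lemma lower_mxV (K : fieldType) (x y : K) : x != 0 ->
  lower_mx x y *m lower_mx x^-1 (- (y / x)) = 1%:M.
Proof. by move=> x0; apply: mx22P; rewrite mx22M !mxE /=; field. Qed.

Section Hecke.
Variables (R : realType) (F : fieldExtType rat) (p : nat) (p_prime : prime p).
Hypothesis p_unram : unramified R F p.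
Variables (a b : F) (O : quat_order a b) (n : set F).
Variable theta : forall v : place R F, {rmorphism Dv a b v -> 'M[completion v]_2}.
Hypothesis theta_split : forall v, divides_np p n v -> integral_splitting O theta v.
Variables (s : nat) (s_ge1 : (1 <= s)%N).
Variables (L : fieldType) (w : absval R L) (cw : av_complete w).
Hypothesis wp : w p%:R = p%:R^-1.
Variables (g : nat) (sigma : 'I_g -> {rmorphism F -> L}) (nn vv : 'I_g -> int).
Variables (psi : Fp R F p -> L) (psi_char : is_weight_character s psi).
Local Notation above := (place_above R F p).
Variable varpi : forall v : above, completion v.
Hypothesis varpi_unif : forall v : above, uniformiser (cabs v) (varpi v).
Variable residues : forall v : above, seq (completion v).
Hypothesis residuesP : is_residues varpi residues.
Local Notation mindex := (mindex g).
Local Notation r := (p%:R^-1 : R).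
Local Notation vpl := (vplace p_prime wp sigma).

Lemma local_adele (v : place R F) (x y : Dv a b v) : x * y = 1 -> y * x = 1 ->
  exists u : Dfx R O, u v = x /\ forall q, q != v -> u q = 1.
Proof.
move=> xy yx.
pose one (q : place R F) : Dv a b q := 1.
have out (z : Dv a b v) q : q != v -> eqtype.dfwith one z q = 1.
  by rewrite eq_sym => qv; rewrite dfwith_out.
have fin (z : Dv a b v) : finite_set [set q | ~ ODv O q (eqtype.dfwith one z q)].
  apply: (sub_finite_set _ (finite_set1 v)) => q /= nq; apply: contrapT => /eqP qv.
  by apply: nq; rewrite out//; exact: ODv1.
have m q : eqtype.dfwith one x q * eqtype.dfwith one y q = 1.
  have [->|qv] := eqVneq q v; first by rewrite !dfwith_in.
  by rewrite !out// mulr1.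
have m' q : eqtype.dfwith one y q * eqtype.dfwith one x q = 1.
  have [->|qv] := eqVneq q v; first by rewrite !dfwith_in.
  by rewrite !out// mulr1.
exists (MkDfx m m' (fin x) (fin y)); split=> /=; first by rewrite dfwith_in.
by move=> q /(out x).
Qed.

Lemma av_varpi (v : above) : cabs v (varpi v) = r.
Proof. exact: av_uniformiser. Qed.

Lemma r_gt0 : 0 < r. Proof. by rewrite invr_gt0 ltr0n prime_gt0. Qed.

Lemma u_alphaP (v : above) alpha (u := u_alpha O theta s varpi (v := v) alpha) :
  [/\ theta v (u v) 0 0 = varpi v, theta v (u v) 0 1 = 0,
      theta v (u v) 1 0 = alpha * varpi v ^+ s, theta v (u v) 1 1 = 1 &
      forall q : place R F, q != v -> u q = 1].
Proof.
rewrite {}/u /u_alpha.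
have [[[theta' K K'] _] _] := theta_split (above_divides p_prime n v).
have pi0 : varpi v != 0.
  by apply/eqP => E; have := av_varpi v; rewrite E av0 => /eqP; rewrite lt_eqF// r_gt0.
pose M := lower_mx (varpi v) (alpha * varpi v ^+ s).
pose N := lower_mx (varpi v)^-1 (- (alpha * varpi v ^+ s / varpi v)).
have MN : M *m N = 1%:M by exact: lower_mxV.
have NM : N *m M = 1%:M by exact: mulmx1C.
have [||u [uv uq]] := @local_adele v (theta' M) (theta' N).
- by apply: (can_inj K); rewrite rmorphM !K' rmorph1.
- by apply: (can_inj K); rewrite rmorphM !K' rmorph1.
case: xgetP => [u' _ [-> hu']|/(_ u)]; first by rewrite !mxE.
by case; split=> //; rewrite uv K'.
Qed.

(** [seen qs i] holds if the operator at the place induced by [sigma_i] has been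
    applied; from then on the coefficients decay like [r ^ m_i] in the
    variable [X_i]. *)
Definition seen (qs : seq above) (i : 'I_g) : bool := vpl i \in qs.

Definition hecke_bound (qs : seq above) (m : mindex) : R :=
  \prod_i (if seen qs i then r ^ vv i * r ^+ m i else 1).

Lemma sigma_ext_const (i : 'I_g) (c : nat) (x : Fp R F p) :
  x (vpl i) = c%:R -> sigma_ext w sigma i x = c%:R.
Proof.
move=> xc; rewrite -(rmorph_nat (sigma i)).
by apply: (sigma_ext_cinc (p_prime := p_prime) cw (wp := wp)); rewrite xc rmorph_nat.
Qed.

(** At the places [qs] already treated the matrix is the identity, of norm
    [1 / r] for the radius in which decay is measured, which the decay of the
    argument compensates; at [v] the substitution multiplies [X_i] by a
    uniformiser; at the other places nothing happens. *)
Lemma Uv_le (qs : seq above) (v : above) (G : Dfx R O -> mindex -> L) :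
  v \notin qs -> (forall x m, w (G x m) <= hecke_bound qs m) ->
  forall x m, w (Uv theta s w sigma nn vv psi varpi residues v G x m) <=
    hecke_bound (v :: qs) m.
Proof.
move=> vqs hG x m; have r0 := r_gt0; have r1 : r < 1 := pV_lt1 R p_prime.
have hb0 : 0 <= hecke_bound (v :: qs) m.
  apply: prodr_ge0 => i _; case: ifP => // _.
  by rewrite mulr_ge0 ?exprz_ge0 ?exprn_ge0// ltW.
apply: av_sum_le => // alpha alpha_res _.
have alpha1 : cabs v alpha <= 1 by have [_ + _] := residuesP v; exact.
set u := u_alpha O theta s varpi alpha.
have [u00 u01 u10 u11 uq] := u_alphaP alpha; rewrite -/u in u00 u01 u10 u11 uq.
set gam := comp_p theta u.
have gam1 (q : above) : q != v -> gam q = 1%:M.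
  move=> /eqP qv; rewrite /gam /comp_p uq; first exact: rmorph1.
  by apply/eqP => /val_inj.
apply: series_sum_le => // l; rewrite avM.
pose c i : R := if seen qs i then r^-1 else 1.
pose rho i : R := if seen (v :: qs) i then r else 1.
have psi1 : w (psi (lower_right gam)) <= 1.
  rewrite (_ : lower_right gam = fun v => 1).
    by have [-> _ _ _] := psi_char; rewrite av1.
  apply: functional_extensionality_dep => q; rewrite /lower_right.
  have [->|/gam1 ->] := eqVneq q v; first exact: u11.
  by rewrite mxE.
have seen_v i : vpl i = v -> seen qs i = false /\ seen (v :: qs) i.
  by move=> iv; rewrite /seen iv (negbTE vqs) mem_head.
have seen_other i : vpl i != v -> seen (v :: qs) i = seen qs i.
  by move=> iv; rewrite /seen inE (negbTE iv).
have E := av_sigma_mx p_prime cw wp sigma.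
have mat_other i : vpl i != v -> sigma_mx w sigma i gam = 1%:M.
  move=> iv; apply/matrixP => k j; rewrite !mxE.
  by apply: sigma_ext_const; rewrite gam1// mxE.
have mat_v i : vpl i = v -> [/\ w (sigma_mx w sigma i gam 0 0) = r,
    w (sigma_mx w sigma i gam 0 1) = 0, w (sigma_mx w sigma i gam 1 0) <= r &
    w (sigma_mx w sigma i gam 1 1) = 1].
  move=> iv; rewrite !E iv /gam /comp_p u00 u01 u10 u11 av_varpi av0 av1 avM avX av_varpi.
  split=> //; apply: (@le_trans _ _ (r ^+ s)).
    by rewrite ler_piMl// exprn_ge0// ltW.
  by rewrite -[X in _ <= X]expr1; apply: ler_wiXn2l => //; exact: ltW.
have mon := @monomial_act_le _ _ _ _ w _ sigma nn vv psi gam c rho l m _ _ psi1 _.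
apply: (le_trans (ler_pM (av_ge0 _ _) (av_ge0 _ _) (hG _ l) (mon _ _ _))).
- by move=> i; rewrite /c; case: ifP => // _; rewrite invr_ge0 ltW.
- by move=> i; rewrite /rho; case: ifP => // _; exact: ltW.
- move=> i; have [iv|iv] := eqVneq (vpl i) v.
    have [sq sv] := seen_v i iv; rewrite /c /rho sq sv.
    by have [-> -> h10 ->] := mat_v i iv; rewrite mul1r; split.
  rewrite /c /rho seen_other// mat_other// !mxE /= !av1 av0.
  by case: ifP => _; split; rewrite ?mulr1 ?mulVf ?invr_ge0 ?(ltW r0) ?lt0r_neq0.
- rewrite /hecke_bound -big_split/=; apply: ler_prod => i _; apply/andP; split.
    rewrite !mulr_ge0 ?exprz_ge0 ?exprn_ge0 ?av_ge0 /c /rho//.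
    + by case: ifP => // _; rewrite mulr_ge0 ?exprz_ge0 ?exprn_ge0// ltW.
    + by case: ifP => // _; rewrite invr_ge0 ltW.
    + by case: ifP => // _; exact: ltW.
  have [iv|iv] := eqVneq (vpl i) v.
    have [sq sv] := seen_v i iv; rewrite /c /rho sq sv.
    have [h00 /av_eq0 h01 _ h11] := mat_v i iv.
    by rewrite det22 h01 mul0r subr0 avM h00 h11 mulr1 expr1n !mul1r.
  rewrite /c /rho seen_other// mat_other// det1 av1 exp1rz mul1r.
  case: ifP => _; last by rewrite !expr1n !mul1r.
  have e : r ^+ l i * r^-1 ^+ l i = 1 by rewrite -exprMn divff ?expr1n// lt0r_neq0.
  by rewrite -mulrA [X in _ * X]mulrA e mul1r.
Qed.

Lemma Up_le (qs : seq above) (f : Dfx R O -> mindex -> L) : uniq qs ->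
  (forall x m, w (f x m) <= 1) -> forall x m,
  w (Up theta s w sigma nn vv psi varpi residues qs f x m) <= hecke_bound qs m.
Proof.
move=> + hf; rewrite /Up; elim: qs => [_ x m|v qs ih /= /andP[vqs uqs]] /=.
  by apply: le_trans (hf x m) _; rewrite /hecke_bound /seen/= big1.
by apply: Uv_le => //; exact: ih.
Qed.

Variables (ps : seq above) (ind : above -> 'I_g).
Hypotheses (ps_uniq : uniq ps) (ps_all : forall v, v \in ps).

(** The normalising factor is exactly the inverse of the product of the
    determinants, and the coefficient of [X^m] is divisible by [p ^ |m|]. *)
Lemma Up0_le (f : Dfx R O -> mindex -> L) : (forall x m, w (f x m) <= 1) ->
  forall x m, w (Up0 theta s w sigma nn vv psi varpi residues ps ind f x m) <=
    r ^+ (\sum_i m i)%N.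
Proof.
move=> hf x m; have r0 := r_gt0; have rn0 : r != 0 by rewrite lt0r_neq0.
rewrite avM av_prod.
have -> : \prod_(v <- ps) w (sigma_ext w sigma (ind v) varpi ^ (- v_kappa w sigma vv v)) =
    r ^ (- \sum_i vv i).
  transitivity (\prod_(v <- ps) r ^ (- v_kappa w sigma vv v)).
    by apply: eq_bigr => v _; rewrite avXz (av_sigma_ext p_prime cw wp) av_varpi.
  rewrite -(big_morph (fun k : int => r ^ k) (fun k l => expfzDr k l rn0) (expr0z r)).
  congr (_ ^ _); rewrite sumrN; congr (- _); rewrite /v_kappa (exchange_big_dep xpredT)//=.
  apply: eq_bigr => i _; rewrite -big_filter (perm_big [:: vpl i]) ?big_seq1//.
  apply: uniq_perm; rewrite ?filter_uniq// => v; rewrite mem_filter ps_all andbT inE.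
  apply/asboolP/eqP => [/(induces_vplace p_prime wp)//|->]; exact: vplaceP.
apply: le_trans (ler_wpM2l _ (Up_le ps_uniq hf x m)) _.
  by rewrite exprz_ge0// ltW.
rewrite /hecke_bound (eq_bigr (fun i => r ^ vv i * r ^+ m i)) => [|i _]; last first.
  by rewrite /seen ps_all.
rewrite big_split/= prodrXr mulrA.
rewrite -(big_morph (fun k : int => r ^ k) (fun k l => expfzDr k l rn0) (expr0z r)).
by rewrite -expfzDr// addNr expr0z mul1r.
Qed.

End Hecke.

(** * Slopes and polygons *)

Section Slopes.
Variables (mult : nat -> nat) (mult_gt0 : forall k, (0 < mult k)%N).

Definition slopes_below (k : nat) : nat := \sum_(i < k) mult i.

Let blocks k := flatten [seq nseq (mult i) i | i <- iota 0 k].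

Let blocksS k : blocks k.+1 = blocks k ++ nseq (mult k) k.
Proof. by rewrite /blocks -addn1 iotaD map_cat flatten_cat /= cats0 add0n. Qed.

Let size_blocks k : size (blocks k) = slopes_below k.
Proof.
elim: k => [|k ih]; first by rewrite /slopes_below big_ord0.
by rewrite blocksS size_cat size_nseq ih /slopes_below big_ord_recr.
Qed.

Lemma slopes_below_leq k m : (k <= m)%N -> (slopes_below k <= slopes_below m)%N.
Proof.
move=> km; rewrite /slopes_below -!(big_mkord xpredT mult) (big_cat_nat _ km)//.
exact: leq_addr.
Qed.

Let nth_blocks m j k : (j < slopes_below m)%N ->
  (nth 0%N (blocks m) j < k)%N = (j < slopes_below k)%N.
Proof.
elim: m => [|m ih] jm; first by rewrite /slopes_below big_ord0 in jm.
rewrite blocksS nth_cat size_blocks; case: (ltnP j (slopes_below m)) => [jm'|mj]; first exact: ih.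
rewrite nth_nseq; have -> : (j - slopes_below m < mult m)%N.
  by rewrite ltn_subLR//; rewrite /slopes_below big_ord_recr in jm.
apply/idP/idP => [mk|jk].
  exact: leq_trans jm (slopes_below_leq mk).
by rewrite ltnNge; apply: contraTN jk => /slopes_below_leq km; rewrite -leqNgt (leq_trans km).
Qed.

Lemma leq_slopes_below k : (k <= slopes_below k)%N.
Proof.
elim: k => // k ih; rewrite /slopes_below big_ord_recr/= -addn1.
by rewrite leq_add.
Qed.

Lemma slopes_lt j k : (slopes mult j < k)%N = (j < slopes_below k)%N.
Proof. exact: (@nth_blocks j.+1 j k (leq_slopes_below j.+1)). Qed.

Lemma slopes_leq i j : (i <= j)%N -> (slopes mult i <= slopes mult j)%N.
Proof.
by move=> ij; rewrite -ltnS slopes_lt (leq_ltn_trans ij)// -slopes_lt.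
Qed.

Definition slopes_sum (m : nat) : nat := \sum_(j < m) slopes mult j.

(** Remove the elements by decreasing weight: the largest of [m] weights is at
    least the slope of index [m - 1], since only [slopes_below k] elements have
    weight less than [k]. *)
Lemma slopes_sum_le (I : eqType) (wt : I -> nat) (t : seq I) :
  (forall (t' : seq I) k, uniq t' -> (forall x, x \in t' -> (wt x < k)%N) ->
     (size t' <= slopes_below k)%N) ->
  uniq t -> (slopes_sum (size t) <= \sum_(x <- t) wt x)%N.
Proof.
move=> hcount; move E : (size t) => m; elim: m t E => [|m ih] t tm ut.
  by rewrite /slopes_sum big_ord0.
have [x xt xmax] : exists2 x, x \in t & forall y, y \in t -> (wt y <= wt x)%N.
  case: t tm {ih ut} => // x0 t _; elim: t x0 => [|y t iht] x0.
    by exists x0; rewrite ?mem_head// => y; rewrite inE => /eqP ->.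
  have [x xt hx] := iht y.
  have [x0x|/ltnW xx0] := leqP (wt x0) (wt x).
    exists x; first by rewrite inE xt orbT.
    by move=> z; rewrite inE => /orP[/eqP ->//|/hx].
  exists x0; first exact: mem_head.
  move=> z; rewrite inE => /orP[/eqP ->//|/hx zx]; exact: leq_trans zx xx0.
rewrite (perm_big _ (perm_to_rem xt)) big_cons /slopes_sum big_ord_recr/= addnC leq_add//.
  rewrite -ltnS slopes_lt -tm; exact: hcount.
by apply: ih; [rewrite size_rem// tm|exact: rem_uniq].
Qed.

Section Polygon.
Variable R : realType.

(** The slopes are nondecreasing, so the polygon lies above the line that carries
    any of its sides. *)
Lemma slopes_sum_side (k m : nat) :
  (slopes_sum k)%:R + (m%:R - k%:R) * (slopes mult k)%:R <= (slopes_sum m)%:R :> R.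
Proof.
have seg i j : (i <= j)%N -> (slopes_sum j = slopes_sum i + \sum_(i <= l < j) slopes mult l)%N.
  by move=> ij; rewrite /slopes_sum -!(big_mkord xpredT (slopes mult)) (big_cat_nat _ ij).
have [km|/ltnW mk] := leqP k m.
  rewrite (seg _ _ km) natrD lerD2l -natrB// -natrM ler_nat -sum_nat_const_nat.
  rewrite big_nat [leqRHS]big_nat; apply: leq_sum => l /andP[kl _].
  exact: slopes_leq.
have h : (\sum_(m <= l < k) slopes mult l <= (k - m) * slopes mult k)%N.
  rewrite -sum_nat_const_nat big_nat [leqRHS]big_nat; apply: leq_sum => l /andP[_ lk].
  exact/slopes_leq/ltnW.
rewrite (seg _ _ mk) natrD -lerBrDl opprD addrA subrr add0r -opprB mulNr lerN2 in h *.
by rewrite -natrB// -natrM ler_nat.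
Qed.

Lemma polygon_le (N : nat) (lam : 'I_N -> R) (m : 'I_N -> nat) (x : R) : 0 <= x ->
  (forall i, 0 <= lam i) -> \sum_i lam i = 1 -> \sum_i lam i * (m i)%:R = x ->
  polygon (slopes mult) x <= \sum_i lam i * (slopes_sum (m i))%:R.
Proof.
move=> x0 lam0 lam1 lamx; rewrite /polygon -/(slopes_sum _); set k := Num.truncn x.
have -> : (slopes_sum k)%:R + (x - k%:R) * (slopes mult k)%:R =
    \sum_i lam i * ((slopes_sum k)%:R + ((m i)%:R - k%:R) * (slopes mult k)%:R).
  rewrite (eq_bigr (fun i => lam i * ((slopes_sum k)%:R - k%:R * (slopes mult k)%:R)
    + lam i * (m i)%:R * (slopes mult k)%:R)) => [|i _]; last by ring.
  by rewrite big_split/= -!mulr_suml lam1 lamx; ring.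
by apply: ler_sum => i _; apply: ler_wpM2l => //; exact: slopes_sum_side.
Qed.

(** The points of the Newton polygon of [c] are convex combinations of points that
    lie above a convex polygon. *)
Lemma newton_polygon_ge (L : fieldType) (w : absval R L) (p : nat) (c : nat -> L) (x : R) :
  (1 < p)%N -> 0 <= x -> (forall m, w (c m) <= p%:R^-1 ^+ slopes_sum m) ->
  ((polygon (slopes mult) x)%:E <= newton_polygon w p c x)%E.
Proof.
move=> p1 x0 hc; apply: le_ereal_inf_tmp => _ [y [N [lam [m [lam0 lam1 cm lamx <-]]]] <-].
rewrite lee_fin; apply: le_trans (polygon_le x0 lam0 lam1 lamx) _.
apply: ler_sum => i _; apply: ler_wpM2l => //.
have wc : 0 < w (c (m i)) by apply: av_gt0; exact/eqP.
have lnp : 0 < ln (p%:R : R) by rewrite ln_gt0// ltr1n.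
have p0 : 0 < p%:R :> R by rewrite ltr0n ltnW.
rewrite /valp ler_pdivlMr// lerNr -ler_expR lnK ?posrE//.
apply: le_trans (hc _) _; rewrite expRN expRM_natl lnK ?posrE// exprVn.
exact: lexx.
Qed.

End Polygon.
End Slopes.

(** * Fredholm series *)

Lemma tnth_in_tuple_inj (I : eqType) (s : seq I) : uniq s ->
  injective (tnth (in_tuple s)).
Proof.
move=> us i j; have x0 : I := tnth (in_tuple s) i.
rewrite !(tnth_nth x0) => /eqP; rewrite nth_uniq ?ltn_ord//.
by move=> /eqP/val_inj.
Qed.

Section DeterminantOverLists.
Variables (K : comNzRingType) (I : eqType).
Implicit Types (f : I -> I -> K) (s : seq I).

Definition list_mx f s : 'M[K]_(size s) :=
  \matrix_(i, j) f (tnth (in_tuple s) i) (tnth (in_tuple s) j).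

(** The enumerations of two finite sets, one contained in the other, are unrelated;
    reordering makes the smaller one a suffix of the other. *)
Lemma det_list_perm f s s' : perm_eq s s' -> \det (list_mx f s) = \det (list_mx f s').
Proof.
move=> ss; have sz := perm_size ss.
pose s1 : (size s').-tuple I := Tuple (introT eqP sz).
have /tuple_permP[q Eq] : perm_eq s1 (in_tuple s') by [].
have -> : \det (list_mx f s) =
    \det (\matrix_(i < size s', j < size s') f (tnth s1 i) (tnth s1 j)).
  rewrite /s1; move: (introT _ _) => {s1 Eq q}; rewrite -sz => e.
  congr (\det _); apply/matrixP => i j; rewrite !mxE.
  by have x0 : I := tnth (in_tuple s) i; rewrite !(tnth_nth x0).
have -> : (\matrix_(i < size s', j < size s') f (tnth s1 i) (tnth s1 j)) =
    row_perm q (col_perm q (list_mx f s')).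
  apply/matrixP => i j; rewrite !mxE.
  have E k : tnth s1 k = tnth (in_tuple s') (q k).
    by rewrite (_ : s1 = [tuple tnth (in_tuple s') (q i) | i < _]) ?tnth_mktuple//; exact: val_inj.
  by rewrite !E.
rewrite row_permE col_permE !det_mulmx !det_perm odd_permV.
by rewrite mulrC -mulrA -signr_addb addbb mulr1.
Qed.

(** Expansion along the first row, which is that of the identity matrix. *)
Lemma det_list_cons f x s : (forall y, y \in x :: s -> f x y = (x == y)%:R) ->
  x \notin s -> \det (list_mx f (x :: s)) = \det (list_mx f s).
Proof.
move=> hx xs; rewrite (expand_det_row _ (ord0 : 'I_(size s).+1)) big_ord_recl big1 ?addr0.
  rewrite !mxE !(tnth_nth x)/= hx ?mem_head// eqxx mul1r /cofactor/= addn0 expr0 mul1r.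
  congr (\det _); apply/matrixP => i j; rewrite !mxE !(tnth_nth x)/=.
  done.
move=> i _; rewrite !mxE !(tnth_nth x)/= hx; last first.
  by rewrite add0n inE mem_nth ?orbT.
rewrite add0n; case: eqP; last by rewrite mul0r.
by move=> E; case/negP: xs; rewrite E mem_nth.
Qed.

Lemma det_list_cat f s s' : (forall x y, x \in s' -> y \in s' ++ s -> f x y = (x == y)%:R) ->
  uniq (s' ++ s) -> \det (list_mx f (s' ++ s)) = \det (list_mx f s).
Proof.
elim: s' => //= x s' ih hf /andP[xs us].
rewrite det_list_cons ?ih// => [y z ys zs|y ys]; apply: hf; rewrite ?inE ?ys ?zs ?orbT//.
by rewrite eqxx.
Qed.
End DeterminantOverLists.

Section Fredholm.
Variables (R : realType) (L : fieldType) (w : absval R L) (cw : av_complete w).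

Definition poly_le (c : R) (q : {poly L}) := gauss_le w c 1 (fun k => q`_k).

Implicit Types (q : {poly L}).

Lemma poly_leM c d q q' : poly_le c q -> poly_le d q' -> poly_le (c * d) (q * q').
Proof. by move=> hq hq' k; rewrite coefM; exact: (gauss_le_smul ler01 hq hq'). Qed.

Lemma poly_leD c q q' : poly_le c q -> poly_le c q' -> poly_le c (q + q').
Proof.
by move=> hq hq' k; rewrite coefD (le_trans (av_ultra _ _ _))// ge_max hq hq'.
Qed.

Lemma poly_leP c q : (forall k, w q`_k <= c) <-> poly_le c q.
Proof. by split=> h k; have := h k; rewrite expr1n mulr1. Qed.

Lemma poly_leC c a : 0 <= c -> w a <= c -> poly_le c a%:P.
Proof. by move=> c0 h; apply/poly_leP => k; rewrite coefC; case: eqP => // _; rewrite av0. Qed.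

Lemma poly_leN c q : poly_le c q -> poly_le c (- q).
Proof. by move=> h k; rewrite coefN avN. Qed.

Lemma poly_leX c q : 0 <= c -> poly_le c q -> poly_le c ('X * q).
Proof.
move=> c0 /poly_leP h; apply/poly_leP => k.
by rewrite coefXM; case: eqP => // _; rewrite av0.
Qed.

Lemma poly_le_sign (b : bool) c q : poly_le c q -> poly_le c ((-1) ^+ b * q).
Proof. by case: b => h; rewrite ?expr1 ?expr0 ?mul1r// mulN1r; exact: poly_leN. Qed.

Lemma poly_le_sum (J : Type) (t : seq J) (P : pred J) c (q : J -> {poly L}) : 0 <= c ->
  (forall j, P j -> poly_le c (q j)) -> poly_le c (\sum_(j <- t | P j) q j).
Proof.
move=> c0 h; apply: (big_ind (poly_le c)) => //; last exact: poly_leD.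
by apply/poly_leP => k; rewrite coef0 av0.
Qed.

(** The determinant is Lipschitz on matrices with integral entries. *)
Lemma det_close n (M M' : 'M[{poly L}]_n) (c : R) : 0 <= c ->
  (forall i j, poly_le 1 (M i j)) -> (forall i j, poly_le 1 (M' i j)) ->
  (forall i j, poly_le c (M i j - M' i j)) -> poly_le c (\det M - \det M').
Proof.
move=> c0 hM hM' h; rewrite /determinant -sumrB; apply: poly_le_sum => // q _.
rewrite -mulrBr; apply: poly_le_sign.
have one : poly_le 1 1 by apply: poly_leC; rewrite ?av1.
have P1 (t : seq 'I_n) : poly_le 1 (\prod_(i <- t) M' i (q i)).
  apply: (big_ind (poly_le 1)) => // x y hx hy.
  by rewrite -(mulr1 1); exact: poly_leM.
elim: (index_enum _) => [|i t ih].
  by rewrite !big_nil subrr; apply/poly_leP => k; rewrite coef0 av0.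
rewrite !big_cons (_ : _ - _ = M i (q i) * (\prod_(j <- t) M j (q j) - \prod_(j <- t) M' j (q j))
  + (M i (q i) - M' i (q i)) * \prod_(j <- t) M' j (q j)); last by ring.
apply: poly_leD; first by rewrite -(mul1r c); exact: poly_leM.
by rewrite -(mulr1 c); exact: poly_leM.
Qed.

Variables (I : choiceType) (wt : I -> nat) (r : R) (r_gt0 : 0 < r) (r_lt1 : r < 1).
Hypothesis wt_fin : forall N, finite_set [set i | (wt i < N)%N].

Definition fredholm_entry (A : I -> I -> L) (i j : I) : {poly L} :=
  (i == j)%:R - 'X * (A i j)%:P.

Lemma trunc_fredholmE (A : I -> I -> L) (B : {fset I}) m :
  trunc_fredholm A B m = (\det (list_mx (fredholm_entry A) B))`_m.
Proof.
rewrite /trunc_fredholm; congr (polyseq (\det _))`_m; apply/matrixP => i j.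
rewrite !mxE /fredholm_entry; congr (_ - _); congr (_%:R).
by rewrite inj_eq//; apply: tnth_in_tuple_inj; exact: fset_uniq.
Qed.

Variable A : I -> I -> L.
Hypothesis A_le : forall i j, w (A i j) <= r ^+ wt i.

Let rX n : 0 <= r ^+ n. Proof. by rewrite exprn_ge0// ltW. Qed.

Lemma fredholm_entry_le1 (A' : I -> I -> L) i j :
  w (A' i j) <= 1 -> poly_le 1 (fredholm_entry A' i j).
Proof.
move=> h; apply: poly_leD; last first.
  by apply/poly_leN/poly_leX => //; exact: poly_leC.
by rewrite -polyC1 -polyCMn; apply: poly_leC => //; exact: av_nat_le1.
Qed.

Definition low N : {fset I} := fset_set [set i | (wt i < N)%N].

Lemma in_low N i : (i \in low N) = (wt i < N)%N.
Proof. by rewrite in_fset_set// mem_setE. Qed.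

(** Replacing by 0 the rows of weight at least [N] changes the determinant by at
    most [r ^ N], and these rows then disappear from it. *)
Lemma trunc_fredholm_close N (B : {fset I}) m : (low N `<=` B)%fset ->
  w (trunc_fredholm A B m - trunc_fredholm A (low N) m) <= r ^+ N.
Proof.
move=> /fsubsetP sB; rewrite !trunc_fredholmE.
pose A' i j := if i \in low N then A i j else 0.
have A1 i j : w (A i j) <= 1.
  by apply: le_trans (A_le i j) _; rewrite exprn_ile1 ?ltW.
have -> : \det (list_mx (fredholm_entry A) (low N)) = \det (list_mx (fredholm_entry A') B).
  pose s := [seq i <- B | i \notin low N] ++ low N.
  have ps : perm_eq B s.
    apply: uniq_perm; first exact: fset_uniq.
      rewrite cat_uniq filter_uniq ?fset_uniq//=.
      rewrite andbT.
      by apply/hasPn => x xl; rewrite mem_filter xl.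
    move=> x; rewrite mem_cat mem_filter; have [xl|//] := boolP (x \in low N).
      by rewrite (sB _ xl).
    by rewrite orbF.
  rewrite (det_list_perm _ ps) det_list_cat.
  - congr (\det _); apply/matrixP => i j; rewrite !mxE /fredholm_entry /A'.
    by rewrite mem_tnth.
  - move=> x y; rewrite mem_filter => /andP[/negbTE xl _] _.
    by rewrite /fredholm_entry /A' xl polyC0 mulr0 subr0.
  - by rewrite -(perm_uniq ps) fset_uniq.
rewrite -coefB; move: m; apply/poly_leP; apply: det_close => // [i j|i j|i j]; rewrite !mxE.
- exact: fredholm_entry_le1.
- by apply: fredholm_entry_le1; rewrite /A'; case: ifP => // _; rewrite av0.
- rewrite /fredholm_entry opprD addrACA subrr add0r opprK addrC -mulrBr -polyCB.
  apply: poly_leX => //; apply: poly_leC => //; rewrite /A' in_low.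
  case: ltnP => [_|Nw]; first by rewrite subrr av0.
  rewrite sub0r avN; apply: le_trans (A_le _ _) _.
  by rewrite ler_wiXn2l ?ltW.
Qed.

(** The coefficient of [X^m] in a product of binomials is a sum of products of
    [m] of their leading coefficients. *)
Lemma binomial_prod_le (J : eqType) (ht : J -> nat) (d a : J -> L) (l : seq J) m (c : R) :
  (forall j, w (d j) <= 1) -> (forall j, w (a j) <= r ^+ ht j) ->
  (forall t, subseq t l -> size t = m -> r ^+ (\sum_(j <- t) ht j)%N <= c) ->
  0 <= c -> w (\prod_(j <- l) ((d j)%:P - 'X * (a j)%:P))`_m <= c.
Proof.
move=> d1 ha; elim: l m c => [|j l ih] m c hc c0.
  rewrite big_nil coef1; case: eqP => [m0|_]; last by rewrite av0.
  by rewrite av1; apply: le_trans (hc [::] _ _) => //; rewrite big_nil.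
rewrite big_cons mulrBl coefB -mulrA coefCM coefXM.
apply: le_trans (av_ultra _ _ _) _; rewrite avN ge_max; apply/andP; split.
  rewrite avM; apply: le_trans (_ : 1 * c <= _); last by rewrite mul1r.
  apply: ler_pM; rewrite ?av_ge0//; apply: ih => // t tl st.
  by apply: hc st; apply: subseq_trans tl (subseq_cons _ _).
case: m hc => [|m] hc; first by rewrite av0.
rewrite coefCM avM.
have rj : 0 < r ^+ ht j by rewrite exprn_gt0.
rewrite -(divfK (lt0r_neq0 rj) c) mulrC; apply: ler_pM; rewrite ?av_ge0//.
apply: ih => [t tl st|]; last by rewrite divr_ge0// ltW.
rewrite ler_pdivlMr// -exprD addnC.
have := hc (j :: t); rewrite big_cons; apply; first by rewrite /= eqxx.
by rewrite /= st.
Qed.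

Variables (mult : nat -> nat) (mult_gt0 : forall k, (0 < mult k)%N).
Hypothesis wt_count : forall (t : seq I) k, uniq t ->
  (forall x, x \in t -> (wt x < k)%N) -> (size t <= slopes_below mult k)%N.

Lemma trunc_fredholm_le (B : {fset I}) m :
  w (trunc_fredholm A B m) <= r ^+ slopes_sum mult m.
Proof.
rewrite trunc_fredholmE /determinant coef_sum; apply: av_sum_le => // q _ _.
set P := \prod_i _; have -> : w ((-1) ^+ q * P)`_m = w P`_m.
  by case: (odd_perm q); rewrite ?expr1 ?expr0 ?mul1r// mulN1r coefN avN.
pose el (i : 'I_(size B)) := tnth (in_tuple B) i.
have elI : injective el by apply: tnth_in_tuple_inj; exact: fset_uniq.
rewrite /P (eq_bigr (fun i => ((el i == el (q i))%:R%:P - 'X * (A (el i) (el (q i)))%:P))).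
  apply: (binomial_prod_le (ht := wt \o el)) => // [i|t tsub tm].
    exact: av_nat_le1.
  apply: ler_wiXn2l; rewrite ?ltW// -tm.
  have ut : uniq t by apply: subseq_uniq tsub _; exact: index_enum_uniq.
  apply: slopes_sum_le => // t' k ut' ht'.
  rewrite -(size_map el); apply: wt_count; first by rewrite map_inj_uniq.
  by move=> _ /mapP[i it ->]; exact: ht'.
by move=> i _; rewrite mxE /fredholm_entry polyC_natr.
Qed.

Lemma fredholm_exists : exists c, is_fredholm w A c /\
  forall m, w (c m) <= r ^+ slopes_sum mult m.
Proof.
have low_sub N M : (N <= M)%N -> (low N `<=` low M)%fset.
  move=> NM; apply/fsubsetP => i; rewrite !in_low => /leq_trans; exact.
have cauchy m : av_cauchy w (fun N => trunc_fredholm A (low N) m).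
  move=> e e0; have [N hN] : exists N, r ^+ N < e by apply: small_power; rewrite ?ltW.
  exists N => j k Nj Nk; rewrite -[X in w X](subrKA (trunc_fredholm A (low N) m)).
  apply: av_lt_add; [|rewrite av_subC];
    by apply: le_lt_trans hN; apply: trunc_fredholm_close; exact: low_sub.
have /choice[c hc] : forall m, exists y, av_cvg w (fun N => trunc_fredholm A (low N) m) y.
  by move=> m; exact: cw.
exists c; split=> [m e e0|m].
  have [N hN] : exists N, r ^+ N < e by apply: small_power; rewrite ?ltW.
  have [M hM] := hc m _ e0; exists (low (maxn N M)) => B hB.
  rewrite -[X in w X](subrKA (trunc_fredholm A (low (maxn N M)) m)).
  apply: av_lt_add; last by apply: hM; exact: leq_maxr.
  apply: le_lt_trans (trunc_fredholm_close m hB) _.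
  apply: le_lt_trans hN; apply: ler_wiXn2l; rewrite ?ltW//; exact: leq_maxl.
apply/ler_addgt0Pr => e e0; have [M /(_ _ (leqnn M)) hM] := hc m _ e0.
rewrite -[c m](subKr (trunc_fredholm A (low M) m)).
apply: le_trans (av_ultra _ _ _) _; rewrite avN ge_max; apply/andP; split.
  by apply: le_trans (trunc_fredholm_le _ _) _; rewrite lerDl ltW.
by apply: le_trans (ltW hM) _; rewrite lerDr.
Qed.

End Fredholm.

(** * Counting monomials, and the theorem *)

Lemma finite_box (g N : nat) : finite_set [set m : mindex g | forall i, (m i < N)%N].
Proof.
pose inj (f : {ffun 'I_g -> 'I_N}) : mindex g := [ffun i => val (f i)].
apply: (sub_finite_set (B := inj @` [set: {ffun 'I_g -> 'I_N}])) => [m hm|]; last first.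
  exact/finite_image/finite_finset.
exists [ffun i => Ordinal (hm i)] => //.
by apply/ffunP => i; rewrite !ffunE.
Qed.

Lemma finite_degree_lt (g N : nat) : finite_set [set m : mindex g | (\sum_i m i < N)%N].
Proof.
apply: sub_finite_set (finite_box g N) => m /= hm i.
by apply: leq_ltn_trans hm; rewrite (bigD1 i)//= leq_addr.
Qed.

Section Count.
Variables (g h : nat) (g_gt0 : (0 < g)%N) (h_gt0 : (0 < h)%N).
Variables (Bi : mindex g -> nat) (Bi_inv : nat -> mindex g).
Hypotheses (BiK : cancel Bi Bi_inv) (Bi_invK : cancel Bi_inv Bi).
Let b m := (\sum_i Bi_inv m i)%N.
Let mult k := (#|` fset_set [set m | b m = k]| * h)%N.

Let finite_b k : finite_set [set m | b m = k].
Proof.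
apply: (sub_finite_set (B := Bi @` [set m : mindex g | (\sum_i m i < k.+1)%N])).
  by move=> m /= bm; exists (Bi_inv m); rewrite ?Bi_invK//= -bm.
exact/finite_image/finite_degree_lt.
Qed.

Lemma mult_gt0 k : (0 < mult k)%N.
Proof.
rewrite muln_gt0 h_gt0 andbT cardfs_gt0; apply/fset0Pn.
pose m : mindex g := [ffun i => if i == Ordinal g_gt0 then k else 0%N].
exists (Bi m); rewrite in_fset_set// inE/= /b BiK.
rewrite (bigD1 (Ordinal g_gt0))//= ffunE eqxx big1 ?addn0// => i /negbTE hi.
by rewrite ffunE hi.
Qed.

Lemma count_monomials (t : seq ('I_h * mindex g)) k : uniq t ->
  (forall x, x \in t -> (\sum_i x.2 i < k)%N) -> (size t <= slopes_below mult k)%N.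
Proof.
move=> ut ht; pose code (x : 'I_h * mindex g) := (x.1, Bi x.2).
have codeI : injective code.
  by move=> [i m] [i' m'] [-> /(can_inj BiK) ->].
pose l := flatten [seq [seq (i, m) | i <- enum 'I_h, m <- fset_set [set m | b m = j]] | j <- iota 0 k].
have -> : slopes_below mult k = size l.
  rewrite /l size_flatten sumnE /shape -map_comp big_map /slopes_below.
  rewrite -(big_mkord xpredT mult) /index_iota subn0; apply: eq_bigr => j _ /=.
  by rewrite size_allpairs size_enum_ord mulnC.
rewrite -(size_map code); apply: uniq_leq_size; first by rewrite map_inj_uniq.
move=> _ /mapP[[i m] /ht /= mk ->]; apply/flatten_mapP; exists (\sum_i m i)%N.
  by rewrite mem_iota.
by apply/allpairs_f; rewrite ?mem_enum// in_fset_set// inE/= /b BiK.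
Qed.

End Count.

Theorem proposition3p1p21
  (R : realType)
  (* the totally real field F of even degree g, and p unramified in F *)
  (F : fieldExtType rat) (g : nat) (p : nat)
  (F_real : totally_real R F) (F_deg : \dim {:F} = g) (g_even : ~~ odd g)
  (p_prime : prime p) (p_unram : unramified R F p)
  (* the quaternion algebra D = (a, b / F), the maximal order O and the
     splittings theta_v at the primes v dividing n p *)
  (a b : F) (a_neq0 : a != 0) (b_neq0 : b != 0)
  (D_def : totally_definite R a b) (D_unram : finitely_unramified R a b)
  (O : quat_order a b) (O_max : maximal_order O)
  (n : set F) (n_ideal : is_ideal n) (n_p : prime_to n p)
  (theta : forall v : place R F, {rmorphism Dv a b v -> 'M[completion v]_2})
  (theta_split : forall v, divides_np p n v -> integral_splitting O theta v)
  (* the level U = U_0(n p^s), with D_f^* the disjoint union of h sets D^* t_i U *)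
  (s : nat) (s_ge1 : (1 <= s)%N)
  (h : nat) (t : 'I_h -> Dfx R O)
  (t_repr : coset_representatives (U0 theta p n s) t)
  (U_small : sufficiently_small (U0 theta p n s) t)
  (* the coefficient field L, a complete subfield of C_p, and the embeddings
     sigma_1, ..., sigma_g of F *)
  (C : closedFieldType) (vC : absval R C) (C_Cp : is_Cp p vC)
  (L : fieldType) (w : absval R L) (iota : {rmorphism L -> C})
  (iota_isom : forall x, vC (iota x) = w x) (L_complete : av_complete w)
  (sigma : 'I_g -> {rmorphism F -> L})
  (sigma_inj : forall i j, sigma i =1 sigma j -> i = j)
  (* the weight *)
  (nn vv : 'I_g -> int) (r : int) (nn_vv : forall i, nn i + 2 * vv i = r)
  (psi : Fp R F p -> L) (psi_char : is_weight_character s psi)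
  (psi_units : forall x : F, x != 0 -> OF x -> OF x^-1 ->
     psi (fun v => cinc v x) = (\prod_i sigma i x) ^ r)
  (* uniformisers pi_v, representatives of O_v / pi_v, an enumeration of the
     places v above p, and for each v some i such that sigma_i induces v *)
  (varpi : forall v : place_above R F p, completion v)
  (varpi_unif : forall v : place_above R F p, uniformiser (cabs v) (varpi v))
  (residues : forall v : place_above R F p, seq (completion v))
  (residuesP : is_residues varpi residues)
  (ps : seq (place_above R F p)) (ps_uniq : uniq ps) (ps_all : forall v : place_above R F p, v \in ps)
  (ind : place_above R F p -> 'I_g) (indP : forall v, induces w sigma (ind v) v)
  (* the function b *)
  (Bi : mindex g -> nat) (Bi_inv : nat -> mindex g)
  (BiK : cancel Bi Bi_inv) (Bi_invK : cancel Bi_inv Bi) :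
  let U := U0 theta p n s in
  let S := forms theta w sigma nn vv psi U in
  let V := Up0 theta s w sigma nn vv psi varpi residues ps ind in
  let bfun := fun m => (\sum_i Bi_inv m i)%N in
  let s_of := fun k : nat => #|` fset_set [set m | bfun m = k]| in
  set_bij S [set phi : 'I_h -> mindex g -> L | forall i, tate w (phi i)]
    (fun f i => f (t i)) /\
  exists A c,
    [/\ matrix_on_forms theta w sigma nn vv psi t U V A,
        is_fredholm w A c &
        forall x : R, 0 <= x ->
          ((polygon (slopes (fun k => s_of k * h)%N) x)%:E <= newton_polygon w p c x)%E].
Proof.
have wp : w p%:R = p%:R^-1.
  by have [Cp _ _] := C_Cp; rewrite -iota_isom rmorph_nat.
have g_gt0 : (0 < g)%N by rewrite -F_deg; exact: (adim_gt0 {:F}).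
have h_gt0 : (0 < h)%N by have [[i hi] _] := t_repr 1%g; exact: leq_ltn_trans hi.
move=> U S V bfun s_of.
have bij := forms_bij p_prime n_ideal theta_split s_ge1 t_repr U_small L_complete wp
  sigma_inj F_deg nn_vv psi_char psi_units.
split; first exact: bij.
have /choice[f hf] : forall il : 'I_h * mindex g, exists f, S f /\
    forall k m, f (t k) m = ((k, m) == il)%:R.
  move=> il; pose phi (k : 'I_h) (m : mindex g) : L := ((k, m) == il)%:R.
  have phi_tate k : tate w (phi k).
    move=> e e0; apply: (sub_finite_set _ (finite_set1 il.2)) => m /=.
    rewrite /phi; case: eqP => [<-//|_]; rewrite av0 leNgt e0//.
  have [_ _ /(_ phi phi_tate)[f Sf E]] := bij.
  by exists f; split=> // k m; have := congr1 (fun z => z k m) E.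
pose A (km il : 'I_h * mindex g) : L := V (f il) (t km.1) km.2.
pose wt (km : 'I_h * mindex g) := (\sum_i km.2 i)%N.
have A_le km il : w (A km il) <= p%:R^-1 ^+ wt km.
  apply: (Up0_le p_prime p_unram theta_split s_ge1 L_complete wp sigma nn vv
    psi_char varpi_unif residuesP ind ps_uniq ps_all).
  have [Sf ft] := hf il.
  apply: (forms_le1 p_prime n_ideal theta_split s_ge1 t_repr L_complete wp psi_char Sf) => i m.
  by rewrite ft av_nat_le1.
have wt_fin N : finite_set [set km | (wt km < N)%N].
  have h1 : finite_set ([set: 'I_h] `*` [set m : mindex g | (\sum_i m i < N)%N]).
    by apply: finite_setX; [exact: finite_finset|exact: finite_degree_lt].
  by apply: sub_finite_set h1 => km /= ?; split.
have mult_gt0 := mult_gt0 g_gt0 h_gt0 BiK Bi_invK.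
have [c [Ac c_le]] := fredholm_exists L_complete (r_gt0 R p_prime) (pV_lt1 R p_prime)
  wt_fin A_le mult_gt0 (count_monomials BiK Bi_invK).
exists A, c; split=> // [il|x x0].
  by have [Sf ft] := hf il; exists (f il).
by apply: newton_polygon_ge => //; exact: prime_gt1.
Qed.
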